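(* Let $B\ge 1$ be an integer, $\alpha>0$, $\varepsilon>0$, and let $\mathcal{G}$ be a $(B,\alpha)$-partitionable family of graphs of bounded maximum degree. Then there are a constant $K$, a polynomial $p$ and a constant $C$, depending only on $\mathcal{G},B,\alpha,\varepsilon$, such that for every sufficiently large connected graph $G\in\mathcal{G}$ with $n=|V(G)|$ vertices, every integer $$q\ge (1+\varepsilon)\frac{n}{\alpha B},$$ and every $\delta\in(0,1/2]$, the Glauber dynamics $\mathcal{M}$ (the version in which the empty set is counted at most once) on the state space $\Omega^K_{q,B,G}$ has mixing time, to within total variation distance $\delta$ of its stationary distribution, $$\le\ p(n)\,2^{C\,\mathrm{band}(G)}\,\log(1/\delta).$$
   Context: All graphs are finite. The bandwidth of a graph $G$ on $n$ vertices is $\mathrm{band}(G)=\min_{\sigma}\max_{u\sim v}|\sigma(u)-\sigma(v)|$, the minimum over bijections $\sigma:V(G)\to\{1,\dots,n\}$, the maximum over adjacent pairs. A $q$-partition of $G$ is a partition of $V(G)$ into $q$ (not necessarily nonempty) unordered pieces (classes). It is contiguous if every piece induces a connected subgraph of $G$, and a contiguous $q$-partition is $B$-bounded if every piece has size $\le B$. Two partitions agree except on a vertex set $W$ if their classes can be labelled so that each vertex outside $W$ has the same label in both. A family $\mathcal{G}$ of graphs is $(B,\alpha)$-partitionable if for every $\varepsilon>0$ there are $K$ and $\delta_0>0$ such that for every sufficiently large $G\in\mathcal{G}$, with $n=|V(G)|$, and every integer $q>(1+\varepsilon)n/(\alpha B)$: (1) there is a polynomial time algorithm to find a $B$-bounded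 contiguous $q$-partition of $G$; and (2) for any $B$-bounded contiguous partition $\omega$ of $G$ with exactly $q$ nonempty classes, there are at least $\delta_0|V(G)|$ distinct $B$-bounded contiguous partitions $\omega_i$ of $G$, each using fewer than $q$ nonempty classes, and each agreeing with $\omega$ except on (the vertex set of) a connected subgraph $H_i$ of $G$ with at most $K$ vertices. $\Omega_{q,B,G}$ is the set of all $B$-bounded contiguous $q$-partitions of $G$. $\Omega^K_{q,B,G}$ is the set of all $q$-partitions $\omega$ of $G$ which agree with some $\omega'\in\Omega_{q,B,G}$ on all but at most $K$ vertices. Glauber dynamics $\mathcal{M}$ on $\Omega=\Omega^K_{q,B,G}$: from a state $\omega\in\Omega$, (a) choose a uniformly random vertex $v$ of $G$; (b) choose a uniformly random set among all the sets (classes) in $\omega$; (c) remove $v$ from its current class and make it a member of the chosen set, if the resulting $q$-partition belongs to $\Omega$; otherwise remain at $\omega$. In the version used here, the choice in (b) is uniform over the distinct sets in $\omega$, so the empty set, if it is a class of $\omega$, is counted once. The mixing time to within $\delta$ is the least $t$ such that from every starting state the distribution after $t$ steps is within total variation distance $\delta$ of the stationary distribution. *)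

(* Defs.v *)
From mathcomp Require Import all_boot all_order all_algebra.
From mathcomp Require Import reals.

Set Implicit Arguments.
Unset Strict Implicit.
Unset Printing Implicit Defensive.

Import Order.TTheory GRing.Theory Num.Theory.
Local Open Scope nat_scope.

Record sgraph := SGraph {
  vertex :> finType;
  adj : rel vertex;
  adj_sym : symmetric adj;
  adj_irr : irreflexive adj
}.

(* The subgraph induced on A is connected. As every spanning supergraph of a
   connected graph is connected, A is the vertex set of some connected
   subgraph of G exactly when this holds. The empty set is accepted. *)
Definition connected_set (G : sgraph) (A : {set G}) : bool :=
  [forall u in A, forall v in A,
     connect [rel x y | [&& x \in A, y \in A & adj x y]] u v].

Definition connected_graph (G : sgraph) : bool := connected_set [set: G].

(* The values of an injective sigma are 0, ..., n-1 rather than 1, ..., n.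
   All stretches are < n, so the initial value #|G| of the minimum is
   never attained when G is nonempty. *)
Definition bandwidth (G : sgraph) : nat :=
  \big[minn/#|G|]_(sigma : {ffun G -> 'I_#|G|} | injectiveb sigma)
    \max_(u : G) \max_(v : G | adj u v) `|sigma u - sigma v|.

Definition bounded_degree (F : sgraph -> Prop) : Prop :=
  exists D : nat, forall G : sgraph, F G ->
    forall v : G, #|[set w | adj v w]| <= D.

Section Partitions.
Variable G : sgraph.
Implicit Types (P Q : {set {set G}}) (W A : {set G}).

(* An unordered partition into q possibly empty classes is represented by the
   set of its nonempty classes; it has q - #|P| further classes, all empty. *)
Definition qpartition (q : nat) P : bool :=
  partition P [set: G] && (#|P| <= q).

(* The distinct sets among the q classes: set0 is counted once if present. *)
Definition classes (q : nat) P : {set {set G}} :=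
  if #|P| < q then set0 |: P else P.

Definition contiguous P : bool := [forall A in P, connected_set A].

Definition size_bounded (B : nat) P : bool := [forall A in P, #|A| <= B].

Definition Omega (q B : nat) : {set {set {set G}}} :=
  [set P | [&& qpartition q P, contiguous P & size_bounded B P]].

(* preim_partition f [set: G] is the set of nonempty fibres of f, so the first
   two clauses say that f and g label the classes of P and Q. *)
Definition agree_except (q : nat) W P Q : bool :=
  [exists f : {ffun G -> 'I_q}, exists g : {ffun G -> 'I_q},
    [&& P == preim_partition f [set: G],
        Q == preim_partition g [set: G] &
        [forall v, (v \notin W) ==> (f v == g v)]]].

Definition OmegaK (K q B : nat) : {set {set {set G}}} :=
  [set P | qpartition q P &&
    [exists Q in Omega q B, exists W : {set G},
       (#|W| <= K) && agree_except q W P Q]].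

(* The partitions with fewer nonempty classes that agree with P except on the
   vertex set of a connected subgraph with at most K vertices. *)
Definition local_reductions (K q B : nat) P : {set {set {set G}}} :=
  [set Q in Omega q B | (#|Q| < #|P|) &&
    [exists W : {set G},
       [&& connected_set W, #|W| <= K & agree_except q W P Q]]].

(* v leaves its class and joins A, where A is a class of P or set0. If A is the
   class of v, or A = set0 and {v} is a class, this is P itself. *)
Definition reassign P (v : G) A : {set {set G}} :=
  ((v |: A) |: [set X :\ v | X in P :\ A]) :\ set0.

End Partitions.

Inductive direction := GoLeft | Stay | GoRight.

(* Deterministic one-tape Turing machines. Tape symbols are bits, with None
   as the blank; mtrans returns None to halt. *)
Record machine := Machine {
  mstate : finType;
  mstart : mstate;
  mtrans : mstate -> option bool -> option (mstate * option bool * direction)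
}.

(* (s, l, r): state s, head on the first cell of r, and l the cells to the left
   of the head, nearest first; all cells not listed are blank. *)
Definition config (M : machine) : Type :=
  (mstate M * seq (option bool) * seq (option bool))%type.

Definition mstep (M : machine) (c : config M) : option (config M) :=
  let: (s, l, r) := c in
  if mtrans s (head None r) is Some (s', a, d) then
    Some (match d with
          | GoLeft => (s', behead l, [:: head None l, a & behead r])
          | Stay => (s', l, a :: behead r)
          | GoRight => (s', a :: l, behead r)
          end)
  else None.

(* Started on x, M halts after at most t steps with output y, the blank-free
   word that starts at the final head position. *)
Definition outputs_within (M : machine) (x : seq bool) (t : nat)
    (y : seq bool) : Prop :=
  let: c := iter t (fun c => odflt c (mstep c))
                 ((mstart M, [::], map some x) : config M) in
  mstep c = None /\ y = pmap id (take (index None c.2) c.2).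

(* For a list s of the vertices of G: n and q in unary, and the adjacency
   matrix. Since the output consists of q classes, q is given in unary. *)
Definition code_instance (G : sgraph) (s : seq G) (q : nat) : seq bool :=
  nseq #|G| true ++ false :: [seq adj u v | u <- s, v <- s] ++ nseq q true.

Definition code_labelling (G : sgraph) (s : seq G) (q : nat)
    (f : G -> 'I_q) : seq bool :=
  flatten [seq rcons (nseq (f v) true) false | v <- s].

(* Polynomial-time search for an element of Omega q B on the pairs (G, q) in I:
   one machine handles all these pairs and all orderings s of the vertices. *)
Definition poly_time_findable (B : nat) (I : sgraph -> nat -> Prop) : Prop :=
  exists (M : machine) (p : {poly nat}),
    forall (G : sgraph) (q : nat), I G q ->
    forall s : seq G, perm_eq s (enum G) ->
    exists f : G -> 'I_q,
      outputs_within M (code_instance s q)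
        (p.[size (code_instance s q)])%R (code_labelling s f) /\
      preim_partition f [set: G] \in Omega G q B.

Definition partitionable (R : realType) (B : nat) (alpha : R)
    (F : sgraph -> Prop) : Prop :=
  forall eps : R, (0 < eps)%R ->
  exists (K : nat) (delta0 : R) (n0 : nat), (0 < delta0)%R /\
    let admissible (G : sgraph) (q : nat) :=
      [/\ F G, n0 <= #|G| &
          ((1 + eps) * #|G|%:R / (alpha * B%:R) < q%:R)%R] in
    poly_time_findable B admissible /\
    (forall (G : sgraph) (q : nat), admissible G q ->
     forall P : {set {set G}}, P \in Omega G q B -> #|P| = q ->
     (delta0 * #|G|%:R <= #|local_reductions K q B P|%:R)%R).

Section MarkovChains.
Local Open Scope ring_scope.
Variables (R : realType) (S : finType).
Implicit Types (M : S -> S -> R) (mu nu pi : S -> R).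

Definition distribution mu : Prop :=
  (forall x, 0 <= mu x) /\ \sum_x mu x = 1.

Definition evolve M mu : S -> R := fun y => \sum_x mu x * M x y.

Definition law M (t : nat) (x : S) : S -> R :=
  iter t (evolve M) (fun y => (y == x)%:R).

Definition stationary M pi : Prop :=
  distribution pi /\ evolve M pi =1 pi.

Definition unique_stationary M pi : Prop :=
  stationary M pi /\ forall pi', stationary M pi' -> pi' =1 pi.

Definition tv_dist mu nu : R := 2^-1 * \sum_x `|mu x - nu x|.

Definition is_mixing_time M pi (delta : R) (tau : nat) : Prop :=
  let mixed t := forall x, tv_dist (law M t x) pi <= delta in
  mixed tau /\ forall t, mixed t -> (tau <= t)%N.

End MarkovChains.

Definition glauber_state (G : sgraph) (K q B : nat) : finType :=
  {w : {set {set G}} | w \in OmegaK G K q B}.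

(* insubd w X is X as a state if X \in OmegaK G K q B, and w otherwise. *)
Definition glauber (R : realType) (G : sgraph) (K q B : nat)
    (w w' : glauber_state G K q B) : R :=
  (\sum_(v : G) \sum_(A in classes q (val w))
     #|G|%:R^-1 * #|classes q (val w)|%:R^-1 *
     (insubd w (reassign (val w) v A) == w')%:R)%R.

(* Main.v *)
(* The chain is reversible for the weights #|classes q P|, which lie between 1 and n + 1, and
   it rests with probability at least 1 / (n + 1); so the mixing time is polynomially
   related to the constant A of a Poincare inequality for the uniform measure on OmegaK, and
   single-vertex moves reduce that to one on Omega q for moves inside a ball of fixed radius.

   For X and Y in Omega q, order the vertices cyclically with small stretch and let S grow from
   empty to everything as a cyclic interval; mix X Y S consists of the blocks of Y inside S,
   those of X outside S, and singletons near the two ends of S. A circular mountain climbing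
   argument moves the two ends so that the numbers of blocks of X and Y that have been
   exchanged stay balanced; hence mix X Y S and mix Y X S both have at most q + O(bandwidth)
   blocks, and since together they determine X and Y up to 2 ^ O(bandwidth) choices near the
   ends, these paths have congestion polynomial times 2 ^ O(bandwidth) on Omega (q + s) with
   s = O(bandwidth).

   To return to Omega q, a function on Omega k is extended to the partitions with exactly k + 1
   blocks by averaging over their local reductions. As there are at least delta0 n of these
   and only O(n) partitions have a given local reduction, this multiplies the energy (and
   the number of partitions) by a constant at most; iterate s times. *)
Require Import Defs.
From mathcomp Require Import all_boot all_order all_algebra.
From mathcomp Require Import reals exp.
From mathcomp Require Import ring lra zify.

Import Order.TTheory GRing.Theory Num.Theory.
Local Open Scope ring_scope.
Set Implicit Arguments.
Unset Strict Implicit.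
Unset Printing Implicit Defensive.

(** * Mixing from a Poincare inequality *)

(** The mixtures exceed q blocks because the blocks cut at the two ends dissolve into singletons, so
    everything hinges on the price of returning to q blocks. It is a constant per block, independent
    of n, because surgeries far apart commute. Let P and P' differ by a local move and be averaged
    over reductions such as Q1 and Q2. One surgery S, taken from another reduction of P and applied
    to all of them, leads from Q1 to Q2 by five local moves without an excess block. Only boundedly
    many of the linearly many reductions of P touch the region where these partitions differ, so at
    least half of them can serve as S, and the load is spread over linearly many detours. Encoding a
    surgery as a symmetric difference of sets of blocks makes surgeries commute and locality
    invariant under them.

    The extended function agrees with the original one on partitions into at most q blocks, so paths
    through larger partitions still bound the differences of the original one.

    The K of the state space bounds the size of a ball that contains a local move, so that the move
    can be made vertex by vertex inside the state space. *)

Section Averages.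
Variable R : realType.

Lemma weighted_cauchy_schwarz (T : finType) (w a : T -> R) :
  (forall i, 0 <= w i) ->
  (\sum_i w i * a i) ^+ 2 <= (\sum_i w i) * \sum_i w i * a i ^+ 2.
Proof.
move=> w0; rewrite -subr_ge0.
have E : (\sum_i w i) * (\sum_i w i * a i ^+ 2) - (\sum_i w i * a i) ^+ 2
   = 2^-1 * \sum_i \sum_j w i * w j * (a i - a j) ^+ 2.
  have -> : \sum_i \sum_j w i * w j * (a i - a j) ^+ 2 =
     \sum_i \sum_j (w i * (w j * a j ^+ 2)) + \sum_i \sum_j (w j * (w i * a i ^+ 2))
      - 2 * \sum_i \sum_j ((w i * a i) * (w j * a j)).
    rewrite mulr_sumr -big_split -sumrB; apply: eq_bigr => i _.
    rewrite mulr_sumr -big_split -sumrB; apply: eq_bigr => j _ /=; ring.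
  rewrite [X in _ + X - _]exchange_big /= -!big_distrlr /=; by field.
rewrite E; apply: mulr_ge0; first by rewrite invr_ge0 ler0n.
apply: sumr_ge0 => i _; apply: sumr_ge0 => j _.
by rewrite mulr_ge0 ?sqr_ge0 ?mulr_ge0.
Qed.

End Averages.

Section Mixing.
Variables (R : realType) (S : finType) (M : S -> S -> R) (m : S -> R) (c lam : R).
Hypotheses (M_ge0 : forall x y, 0 <= M x y) (M_row : forall x, \sum_y M x y = 1).
Hypotheses (m_ge1 : forall x, 1 <= m x).
Hypothesis rev : forall x y, m x * M x y = m y * M y x.
Hypothesis (M_loop : forall x, c <= M x x).
Hypothesis lam_gt0 : 0 < lam.

Let W := \sum_x m x.
Let V (f : S -> R) := \sum_x \sum_y m x * m y * (f x - f y) ^+ 2.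

Hypothesis poincare : forall f : S -> R,
  lam * V f <= 2 * c * W * \sum_x \sum_y m x * M x y * (f x - f y) ^+ 2.
Hypothesis x0 : S.

Let m_gt0 x : 0 < m x. Proof. exact: lt_le_trans ltr01 (m_ge1 x). Qed.

Let W_ge x : m x <= W.
Proof. by rewrite /W (bigD1 x) //= lerDl sumr_ge0 // => y _; exact: ltW. Qed.

Let W_gt0 : 0 < W. Proof. exact: lt_le_trans (m_gt0 x0) (W_ge x0). Qed.

Let apply_M (f : S -> R) x := \sum_y M x y * f y.

Lemma spread_energy (f : S -> R) :
  V f = 2 * (W * (\sum_x m x * f x ^+ 2) - (\sum_x m x * f x) ^+ 2).
Proof.
have -> : V f =
   \sum_x \sum_y (m x * (m y * f y ^+ 2)) + \sum_x \sum_y (m y * (m x * f x ^+ 2))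
      - 2 * \sum_x \sum_y ((m x * f x) * (m y * f y)).
  rewrite mulr_sumr -big_split -sumrB; apply: eq_bigr => i _.
  rewrite mulr_sumr -big_split -sumrB; apply: eq_bigr => j _ /=; ring.
by rewrite [X in _ + X - _]exchange_big /= -!big_distrlr /= -/W; ring.
Qed.

Let mass f : \sum_x m x * apply_M f x = \sum_x m x * f x.
Proof.
under eq_bigr => x _ do rewrite /apply_M mulr_sumr.
rewrite exchange_big /=; apply: eq_bigr => y _.
under eq_bigr => x _ do rewrite mulrA rev -mulrA.
by rewrite -mulr_sumr -mulr_suml M_row mul1r.
Qed.

(* Two steps move x to y != x at least with probability 2 c M x y: rest at x and then
   move, or move and then rest at y. *)
Let energy_drop f :
  c * (\sum_x \sum_y m x * M x y * (f x - f y) ^+ 2) <=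
  \sum_x m x * f x ^+ 2 - \sum_x m x * apply_M f x ^+ 2.
Proof.
pose M2 x y := \sum_z M x z * M z y.
have M2_row x : \sum_y M2 x y = 1.
  rewrite exchange_big /= -[RHS](M_row x); apply: eq_bigr => z _.
  by rewrite -mulr_sumr M_row mulr1.
have rev2 x y : m x * M2 x y = m y * M2 y x.
  rewrite !mulr_sumr; apply: eq_bigr => z _.
  by rewrite mulrA rev [RHS]mulrA (rev y z); ring.
have E1 : \sum_x m x * apply_M f x ^+ 2 = \sum_x \sum_y (m x * M2 x y) * (f x * f y).
  transitivity (\sum_z \sum_x \sum_y (m z * M z x * M z y) * (f x * f y)).
    apply: eq_bigr => z _; rewrite expr2 big_distrlr /= mulr_sumr.
    apply: eq_bigr => x _; rewrite mulr_sumr; apply: eq_bigr => y _; ring.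
  rewrite exchange_big /=; apply: eq_bigr => x _; rewrite exchange_big /=.
  apply: eq_bigr => y _; rewrite -mulr_suml mulr_sumr; congr (_ * _).
  by apply: eq_bigr => z _; rewrite rev mulrA.
have E2 : \sum_x \sum_y (m x * M2 x y) * (f x - f y) ^+ 2 =
   2 * (\sum_x m x * f x ^+ 2 - \sum_x m x * apply_M f x ^+ 2).
  have -> : \sum_x \sum_y (m x * M2 x y) * (f x - f y) ^+ 2 =
     \sum_x \sum_y (m x * f x ^+ 2) * M2 x y + \sum_x \sum_y (m y * M2 y x * f y ^+ 2)
      - 2 * \sum_x \sum_y (m x * M2 x y) * (f x * f y).
    rewrite mulr_sumr -big_split -sumrB; apply: eq_bigr => i _.
    rewrite mulr_sumr -big_split -sumrB; apply: eq_bigr => j _ /=.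
    by rewrite -(rev2 i j); ring.
  rewrite E1; under eq_bigr => x _ do rewrite -mulr_sumr M2_row mulr1.
  rewrite [X in _ + X - _]exchange_big /=.
  under [X in _ + X - _]eq_bigr => y _.
    under eq_bigr => x _ do rewrite mulrAC.
    rewrite -mulr_sumr M2_row mulr1; over.
  ring.
suff : 2 * (c * (\sum_x \sum_y m x * M x y * (f x - f y) ^+ 2)) <=
   \sum_x \sum_y (m x * M2 x y) * (f x - f y) ^+ 2 by rewrite E2 ler_pM2l.
rewrite mulrA mulr_sumr ler_sum // => x _; rewrite mulr_sumr ler_sum // => y _.
have [->|nxy] := eqVneq x y; first by rewrite subrr expr0n /= !mulr0.
rewrite mulrA ler_wpM2r ?sqr_ge0 // mulrCA ler_wpM2l ?(ltW (m_gt0 x)) //.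
rewrite /M2 (bigD1 x) //= (bigD1 y) 1?eq_sym //= addrA.
apply: le_trans (_ : M x x * M x y + M x y * M y y <= _); last first.
  by rewrite lerDl sumr_ge0 // => z _; rewrite mulr_ge0.
rewrite -mulrA mulr2n mulrDl !mul1r lerD // ?ler_wpM2r //.
by rewrite mulrC ler_wpM2l.
Qed.

(** [V f] is 2 W times the second moment of f minus a term that depends only on the mean, which the
    chain preserves. So one step lowers [V] by 2 W times the drop of the second moment; this is the
    origin of the factor 2 c W in [poincare]. *)
Let contract f : V (apply_M f) <= (1 - lam) * V f.
Proof.
have := energy_drop f; have := poincare f; rewrite !spread_energy mass.
set D := \sum_x \sum_y _; set a := \sum_x m x * f x ^+ 2.
set b := \sum_x m x * _ ^+ 2; set s := \sum_x _ => h1 h2.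
have := ler_wpM2l (ltW W_gt0) h2.
nra.
Qed.

Lemma stationary_weights : stationary M (fun x => m x / W).
Proof.
split; first split.
- by move=> x; rewrite divr_ge0 ?ltW.
- by rewrite -mulr_suml divff // gt_eqF.
move=> y; rewrite /evolve; under eq_bigr => x _ do rewrite mulrAC rev mulrAC.
by rewrite -mulr_sumr M_row mulr1.
Qed.

Let evolveE (mu : S -> R) y :
  evolve M mu y = m y * apply_M (fun x => mu x / m x) y.
Proof.
rewrite /evolve /apply_M mulr_sumr; apply: eq_bigr => x _.
by rewrite mulrA -rev; field; rewrite gt_eqF.
Qed.

(** By reversibility the density h of a stationary mu with respect to m is fixed by [apply_M]. The
    contraction then forces [V h] = 0, so h is constant. *)
Lemma unique_stationary_weights : unique_stationary M (fun x => m x / W).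
Proof.
split; first exact: stationary_weights.
move=> mu [[mu0 mu1] st] y.
pose h x := mu x / m x.
have hE x : apply_M h x = h x.
  by rewrite /h -[in RHS]st evolveE mulrAC divff ?mul1r // gt_eqF.
have V0 : V h = 0.
  apply/eqP; rewrite eq_le; apply/andP; split; last first.
    by rewrite !sumr_ge0 // => x _; rewrite sumr_ge0 // => z _; rewrite mulr_ge0 ?sqr_ge0 ?mulr_ge0 ?ltW.
  have -> : V h = V (apply_M h) by apply: eq_bigr => x _; apply: eq_bigr => z _; rewrite !hE.
  have := contract h; have -> : V (apply_M h) = V h.
    by apply: eq_bigr => x _; apply: eq_bigr => z _; rewrite !hE.
  by rewrite mulrBl mul1r lerDl oppr_ge0 => hl; rewrite -(pmulr_rle0 _ lam_gt0).
have hc x : h x = h y.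
  apply/eqP; rewrite -subr_eq0 -sqrf_eq0.
  move/eqP: V0; rewrite psumr_eq0; last first.
    by move=> z _; rewrite sumr_ge0 // => t _; rewrite mulr_ge0 ?sqr_ge0 ?mulr_ge0 ?ltW.
  move=> /allP/(_ x (mem_index_enum x)) /=.
  rewrite psumr_eq0; last by move=> t _; rewrite mulr_ge0 ?sqr_ge0 ?mulr_ge0 ?ltW.
  move=> /allP/(_ y (mem_index_enum y)) /=.
  by rewrite mulf_eq0 mulf_eq0 (gt_eqF (m_gt0 x)) (gt_eqF (m_gt0 y)).
have : \sum_x m x * h x = 1.
  by rewrite -mu1; apply: eq_bigr => x _; rewrite mulrC divfK // gt_eqF.
under eq_bigr => x _ do rewrite hc.
rewrite -mulr_suml -/W /h => e.
have my := gt_eqF (m_gt0 y); have Wn := gt_eqF W_gt0.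
apply: (mulfI (negbT Wn)); rewrite mulrCA divff ?Wn // mulr1.
by rewrite -[RHS]mulr1 -e mulrCA (mulrC (m y)) divfK ?my.
Qed.

(** The density of the law with respect to m evolves by [apply_M], so its spread contracts at each
    step. At time 0 the density is 1 / m x at x and 0 elsewhere, with spread at most 2 W since m >=
    1. Cauchy-Schwarz turns spread into total variation. *)
Lemma tv_dist_law x t :
  (2 * tv_dist (law M t x) (fun y => m y / W)) ^+ 2 <= W * `|1 - lam| ^+ t.
Proof.
have law1 n : \sum_y law M n x y = 1.
  elim: n => [|n IH]; first by rewrite /law /= (bigD1 x) //= eqxx big1 ?addr0 // => y /negbTE ->.
  rewrite /law iterS -/(law M n x) /evolve exchange_big /= -[RHS]IH.
  by apply: eq_bigr => y _; rewrite -mulr_sumr M_row mulr1.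
pose h n y := law M n x y / m y.
have hS n y : h n.+1 y = apply_M (h n) y.
  by rewrite /h /law iterS -/(law M n x) evolveE mulrAC divff ?mul1r // gt_eqF.
have V_ge0 f : 0 <= V f.
  by rewrite !sumr_ge0 // => z _; rewrite sumr_ge0 // => y _; rewrite mulr_ge0 ?sqr_ge0 ?mulr_ge0 ?ltW.
have VS n : V (h n) <= 2 * W * `|1 - lam| ^+ n.
  elim: n => [|n IH].
    rewrite expr0 mulr1 spread_energy ler_pM2l //.
    apply: le_trans (_ : W * (\sum_y m y * h 0%N y ^+ 2) <= _); first by rewrite gerDl oppr_le0 sqr_ge0.
    rewrite ger_pMr // (bigD1 x) //= big1 => [|y /negbTE ny]; last by rewrite /h /law /= ny mul0r expr0n mulr0.
    rewrite addr0 /h /law /= eqxx mul1r expr2 mulrA divff ?gt_eqF // mul1r.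
    by rewrite invf_le1.
  have -> : V (h n.+1) = V (apply_M (h n)).
    by apply: eq_bigr => z _; apply: eq_bigr => y _; rewrite !hS.
  apply: le_trans (contract _) _; rewrite exprS mulrCA.
  apply: le_trans (ler_wpM2r (V_ge0 _) (ler_norm _)) _.
  by rewrite ler_wpM2l.
have Wn := gt_eqF W_gt0.
rewrite /tv_dist mulrA divff ?pnatr_eq0 // mul1r.
have -> : \sum_y `|law M t x y - m y / W| = \sum_y m y * `|h t y - W^-1|.
  apply: eq_bigr => y _; rewrite -[m y in RHS]gtr0_norm // -normrM mulrBr.
  by rewrite /h mulrCA divff ?gt_eqF // mulr1.
apply: le_trans (weighted_cauchy_schwarz _ _) _; first by move=> y; exact: ltW.
rewrite -/W ler_pM2l //; rewrite -(ler_pM2l W_gt0).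
have -> : W * (\sum_y m y * `|h t y - W^-1| ^+ 2) = 2^-1 * V (h t).
  have mh : \sum_y m y * h t y = 1.
    by rewrite -(law1 t); apply: eq_bigr => y _; rewrite mulrC divfK // gt_eqF.
  rewrite spread_energy mh.
  have -> : \sum_y m y * `|h t y - W^-1| ^+ 2 =
    \sum_y (m y * h t y ^+ 2) - 2 * W^-1 * (\sum_y m y * h t y) + W^-1 ^+ 2 * (\sum_y m y).
    rewrite !mulr_sumr -sumrB -big_split; apply: eq_bigr => y _ /=.
    by rewrite real_normK ?num_real //; ring.
  by rewrite mh -/W; field; rewrite Wn.
have := VS t; lra.
Qed.

(** As ln (1 - lam) <= - lam, any T > tau makes W (1 - lam)^T at most delta^2. The [+ 1] pays for
    rounding tau up to an integer. *)
Lemma mixing_time_le delta (tau : R) :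
  0 < delta -> (ln W + 2 * ln (1 / delta)) / lam <= tau -> lam < 1 -> 0 <= tau ->
  exists2 t : nat, is_mixing_time M (fun x => m x / W) delta t & t%:R <= tau + 1.
Proof.
move=> d0 htau lam1 tau0.
pose mixed t := [forall x, tv_dist (law M t x) (fun x => m x / W) <= delta].
pose T := (Num.truncn tau).+1.
have /andP[T1 T2] := truncn_itv tau0.
have mT : mixed T.
  apply/forallP => x.
  have tv0 : 0 <= tv_dist (law M T x) (fun x => m x / W).
    by rewrite mulr_ge0 ?invr_ge0 // sumr_ge0.
  rewrite -(ler_pXn2r (n := 2)) ?nnegrE ?(ltW d0) //.
  have := tv_dist_law x T; rewrite exprMn ger0_norm ?subr_ge0 ?(ltW lam1) //.
  suff : W * (1 - lam) ^+ T <= delta ^+ 2.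
    move=> h2 h1; apply: le_trans (le_trans h1 h2).
    by rewrite ler_peMl ?exprn_ege1 ?ler1n ?exprn_ge0.
  have l0 : 0 < 1 - lam by rewrite subr_gt0.
  rewrite -ler_ln ?posrE ?mulr_gt0 ?exprn_gt0 //.
  rewrite lnM ?posrE ?exprn_gt0 // (lnXn T l0) (lnXn 2 d0).
  rewrite -[_ *+ T]mulr_natl -[_ *+ 2]mulr_natl.
  have := @le_ln1Dx R (- lam); rewrite ltrN2 => /(_ lam1) e1.
  have := ler_wpM2l (ler0n R T) e1.
  move: htau; rewrite ler_pdivrMr // ln_div ?posrE // ln1 sub0r.
  move: T2; rewrite -/T -(ltr_pM2r lam_gt0); lra.
have ex : exists t, mixed t by exists T.
exists (ex_minn ex); case: ex_minnP => t mt tmin.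
  split; first by move/forallP: mt.
  by move=> s ms; apply: tmin; apply/forallP.
apply: le_trans (_ : T%:R <= _); first by rewrite ler_nat tmin.
by rewrite /T -natr1 lerD2r.
Qed.

End Mixing.

(** * Mountain climbing on a cycle *)

Section Connectivity.

Lemma connect_map (T T' : finType) (e : rel T) (e' : rel T') (g : T -> T') x y :
  (forall u v, e u v -> connect e' (g u) (g v)) ->
  connect e x y -> connect e' (g x) (g y).
Proof.
move=> eg /connectP[s]; elim: s x => [|z s IH] x /=; first by move=> _ ->.
by move=> /andP[/eg xz zs] /(IH _ zs); apply: connect_trans.
Qed.

(** Every edge inside C is counted once from each of its ends; [a] retains the direction in which
    [enum_rank] increases. *)
Lemma odd_degree_sum (T : finType) (e : rel T) (C : {set T}) :
  symmetric e -> irreflexive e ->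
  ~~ odd (\sum_(x in C) \sum_(y in C) e x y)%N.
Proof.
move=> es ei; pose a x y : nat := e x y && (enum_rank x < enum_rank y)%N.
have -> : (\sum_(x in C) \sum_(y in C) e x y =
    \sum_(x in C) \sum_(y in C) a x y + \sum_(x in C) \sum_(y in C) a y x)%N.
  rewrite -big_split; apply: eq_bigr => x _; rewrite -big_split.
  apply: eq_bigr => y _; rewrite /a /= (es y x).
  case exy: (e x y) => //=; case: ltngtP => // /ord_inj/enum_rank_inj xy.
  by rewrite xy ei in exy.
by rewrite [X in (_ + X)%N]exchange_big addnn odd_double.
Qed.

(** Otherwise the component of x misses y, and x is its only vertex of odd degree, against the
    evenness of its degree sum. *)
Lemma handshake (T : finType) (e : rel T) x y :
  symmetric e -> irreflexive e ->
  odd #|[set z | e x z]| ->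
  (forall u, u != x -> u != y -> ~~ odd #|[set z | e u z]|) ->
  connect e x y.
Proof.
move=> es ei ox oe; apply/negPn/negP => nxy.
pose C := [set z | connect e x z].
have := odd_degree_sum C es ei.
have degC u : u \in C -> (\sum_(z in C) e u z = #|[set z | e u z]|)%N.
  rewrite inE => xu; rewrite -sum1_card [RHS]big_mkcond [LHS]big_mkcond.
  apply: eq_bigr => z _; rewrite !inE; case euz: (e u z); last by case: ifP.
  by rewrite (connect_trans xu (connect1 euz)).
rewrite (eq_bigr _ degC) (bigD1 x) ?inE ?connect0 //= oddD ox /=.
rewrite negbK; apply/negP.
apply: (big_ind (fun n => ~~ odd n)) => // [a b ha hb|u].
  by rewrite oddD (negbTE ha) (negbTE hb).
rewrite inE => /andP[xu ux]; apply: oe => //; apply: contraNneq nxy => <- //.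
Qed.

End Connectivity.

Section MountainClimbing.
Local Open Scope nat_scope.

Definition unit_steps (f : nat -> int) (p : nat) : Prop :=
  forall i, i < p -> (f i.+1 = f i + 1 \/ f i = f i.+1 + 1)%R.

Definition climb_step (f h : nat -> int) (p q : nat) : rel ('I_p.+1 * 'I_q.+1) :=
  [rel x y : 'I_p.+1 * 'I_q.+1 | [&& f x.1 == h x.2, f y.1 == h y.2,
    (x.1.+1 == y.1 :> nat) || (y.1.+1 == x.1 :> nat) &
    (x.2.+1 == y.2 :> nat) || (y.2.+1 == x.2 :> nat)]].

Arguments climb_step : clear implicits.

Variables (f h : nat -> int) (p q : nat) (M : int).
Hypotheses (M_gt0 : (0 < M)%R).
Hypotheses (f_start : f 0 = 0%R) (f_end : f p = M) (f_step : unit_steps f p).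
Hypotheses (h_start : h 0 = 0%R) (h_end : h q = M) (h_step : unit_steps h q).
Hypotheses (f_range : forall i, i <= p -> (0 <= f i <= M)%R).
Hypotheses (h_range : forall i, i <= q -> (0 <= h i <= M)%R).

Let nbr (n : nat) (i j : 'I_n.+1) := (i.+1 == j :> nat) || (j.+1 == i :> nat).
Let up (g : nat -> int) n (i : 'I_n.+1) := #|[set j : 'I_n.+1 | nbr i j && (g j == g i + 1 :> int)%R]|.
Let down (g : nat -> int) n (i : 'I_n.+1) := #|[set j : 'I_n.+1 | nbr i j && (g j + 1 == g i :> int)%R]|.

Let up_down (g : nat -> int) n (i : 'I_n.+1) : unit_steps g n ->
  up g i + down g i = (0 < i) + (i < n).
Proof.
move=> gs.
have -> : up g i + down g i = #|[set j : 'I_n.+1 | nbr i j]|.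
  rewrite /up /down -cardsUI [X in _ + X]eq_card0 ?addn0; last first.
    by move=> j; rewrite !inE; apply/negP; lia.
  apply: eq_card => j; rewrite !inE -andb_orr.
  case nij: (nbr i j) => //=; apply/orP; case/orP: nij => /eqP ij.
    have : i < n by rewrite -ltnS ij.
    by move/gs; rewrite ij => -[] E; [left|right]; apply/eqP; rewrite E.
  have : j < n by rewrite -ltnS ij.
  by move/gs; rewrite ij => -[] E; [right|left]; apply/eqP; rewrite E.
have cardI k : #|[set j : 'I_n.+1 | j == k :> nat]| = (k < n.+1).
  have [kn|nk] := ltnP k n.+1.
    by rewrite (_ : [set _ | _] = [set Ordinal kn]) ?cards1 //; apply/setP => j; rewrite !inE.
  by apply: eq_card0 => j; rewrite inE ltn_eqF // (leq_trans (ltn_ord j)).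
have -> : [set j : 'I_n.+1 | nbr i j] =
    [set j : 'I_n.+1 | j == i.-1 :> nat & 0 < i] :|: [set j : 'I_n.+1 | j == i.+1 :> nat].
  by apply/setP => j; rewrite !inE /nbr; have := ltn_ord i; lia.
rewrite cardsU [X in _ - X]eq_card0 ?subn0; last by move=> j; rewrite !inE; lia.
rewrite cardI ltnS; congr (_ + _); have [i0|] := posnP i.
  by apply: eq_card0 => j; rewrite inE andbF.
move=> i0; rewrite (_ : [set j : 'I_n.+1 | _ & _] = [set j : 'I_n.+1 | j == i.-1 :> nat]).
  by rewrite cardI; have := ltn_ord i; lia.
by apply/setP => j; rewrite !inE andbT.
Qed.

(* In the graph of simultaneous steps, all vertices but the two given ones have even degree. *)
Lemma mountain_climbing : connect (climb_step f h p q) (ord0, ord0) (ord_max, ord_max).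
Proof.
have p0 : 0 < p by case: p f_end f_start => // -> ?; lia.
have q0 : 0 < q by case: q h_end h_start => // -> ?; lia.
have down0 (g : nat -> int) n (i : 'I_n.+1) : (forall i, i <= n -> (0 <= g i <= M)%R) -> g i = 0%R -> down g i = 0.
  move=> gr gi; apply: eq_card0 => j; rewrite !inE; apply/negP => /andP[_].
  by have := gr j; rewrite -ltnS ltn_ord => /(_ isT); rewrite gi; lia.
have upM (g : nat -> int) n (i : 'I_n.+1) : (forall i, i <= n -> (0 <= g i <= M)%R) -> g i = M -> up g i = 0.
  move=> gr gi; apply: eq_card0 => j; rewrite !inE; apply/negP => /andP[_].
  by have := gr j; rewrite -ltnS ltn_ord => /(_ isT); rewrite gi; lia.
(* Two climbers at equal heights stay level exactly when both step up or both step down. *)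
have deg (x : 'I_p.+1 * 'I_q.+1) : f x.1 = h x.2 ->
    #|[set z | climb_step f h p q x z]| = up f x.1 * up h x.2 + down f x.1 * down h x.2.
  case: x => i j /= fh; rewrite /up /down -!cardsX -cardsUI.
  rewrite [X in _ + X]eq_card0 ?addn0; last by move=> [a b]; rewrite !inE /=; lia.
  apply: eq_card => -[a b]; rewrite !inE.
  have -> : climb_step f h p q (i, j) (a, b) = [&& f i == h j, f a == h b, nbr i a & nbr j b] by [].
  rewrite fh eqxx /=; case na: (nbr i a); case nb: (nbr j b); rewrite ?andbF //= !andbT.
  apply/eqP/orP => [ab|]; last by case=> /andP[]; lia.
  have [an ai] := (ltn_ord a, ltn_ord i).
  case/orP: na => /eqP ia.
    have : i < p by lia.
    by move=> /f_step; rewrite ia => -[] E; [left|right]; lia.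
  have : a < p by lia.
  by move=> /f_step; rewrite ia => -[] E; [right|left]; lia.
apply: handshake.
- by move=> [i j] [a b]; rewrite /climb_step /= andbCA; congr [&& _, _, _ & _]; exact: orbC.
- by move=> [i j]; rewrite /climb_step /= !gtn_eqF ?andbF.
- rewrite deg /= ?f_start ?h_start // (down0 f) // addn0.
  have := @up_down f p ord0 f_step; have := @up_down h q ord0 h_step.
  by rewrite (down0 f) // (down0 h) // !addn0 /= p0 q0 => -> ->.
move=> [i j] n0 nM.
have [fh|nfh] := eqVneq (f i) (h j); last first.
  by rewrite eq_card0 // => -[a b]; rewrite !inE /climb_step /= (negbTE nfh).
rewrite deg //=.
have ud := up_down i f_step; have ud' := up_down j h_step.
have odd2 a b c d : a + b = 2 -> c + d = 2 -> ~~ odd (a * c + b * d).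
  move=> ab cd; rewrite oddD !oddM.
  have -> : odd b = odd a by have := congr1 odd ab; rewrite oddD; case: (odd a); case: (odd b).
  have -> : odd d = odd c by have := congr1 odd cd; rewrite oddD; case: (odd c); case: (odd d).
  by rewrite addbb.
have [ip jq] := (ltn_ord i, ltn_ord j); rewrite ltnS in ip; rewrite ltnS in jq.
have split_end k n : k <= n -> [\/ k = 0, k = n | 0 < k < n].
  case: (posnP k) => [-> _|k0]; first by constructor 1.
  by rewrite leq_eqVlt => /orP[/eqP ?|kn]; [constructor 2|constructor 3; apply/andP; split].
have [iE jE] := (split_end _ _ ip, split_end _ _ jq).
(* At height 0 both climbers can only go up, with one choice at index 0 and two elsewhere, so the
   degree is odd only at the starting pair. The maximal height is symmetric. *)
have [f0|fn0] := eqVneq (f i) 0%R.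
  have h0 : h j = 0%R by rewrite -fh.
  rewrite (down0 f) // (down0 h) // !addn0 in ud ud' *.
  have {}ip : i < p by case: iE => [->|iE|/andP[]] //; move: f0; rewrite iE; lia.
  have {}jq : j < q by case: jE => [->|jE|/andP[]] //; move: h0; rewrite jE; lia.
  rewrite ud ud' ip jq oddM !oddD /= !oddb.
  by move: n0; rewrite xpair_eqE -!val_eqE /= !lt0n; case: eqP; case: eqP.
have [f1|fnM] := eqVneq (f i) M.
  have h1 : h j = M by rewrite -fh.
  rewrite (upM f) // (upM h) // !add0n in ud ud' *.
  have [ip0 jq0] := (ip, jq); have {}ip : 0 < i by case: iE => [iE|->|/andP[]] //; move: f1; rewrite iE; lia.
  have {}jq : 0 < j by case: jE => [jE|->|/andP[]] //; move: h1; rewrite jE; lia.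
  rewrite ud ud' ip jq oddM !oddD /= !oddb.
  by move: nM; rewrite xpair_eqE -!val_eqE /= !ltn_neqAle ip0 jq0 !andbT; case: eqP; case: eqP.
apply: odd2; rewrite ?ud ?ud'.
  by case: iE => [iE|iE|/andP[-> ->]] //; move: fn0 fnM; rewrite iE ?f_start ?f_end eqxx.
by case: jE => [jE|jE|/andP[-> ->]] //; move: fn0 fnM; rewrite fh jE ?h_start ?h_end eqxx.
Qed.

End MountainClimbing.

(** * Balanced arcs of a cycle *)

Section CircularWalk.
Local Open Scope nat_scope.
Variables (F : nat -> int) (L : nat).

(* A pair (k, a) stands for the arc {k, ..., a - 1} of the cycle of length L, along which
   F changes by at most 2; a step moves one end of the arc by one place. *)
Definition balanced_arc (x : 'I_(2 * L).+1 * 'I_(2 * L).+1) : bool :=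
  [&& x.1 <= x.2, x.2 <= x.1 + L & (`|F x.2 - F x.1| <= 2)%R].

Definition arc_step : rel ('I_(2 * L).+1 * 'I_(2 * L).+1) :=
  [rel x y | [&& balanced_arc x, balanced_arc y &
    (x.2 == y.2) && ((x.1.+1 == y.1 :> nat) || (y.1.+1 == x.1 :> nat)) ||
    (x.1 == y.1) && ((x.2.+1 == y.2 :> nat) || (y.2.+1 == x.2 :> nat))]].

Hypotheses (L_gt0 : 0 < L) (F_period : forall i, F (i + L) = F i).
Hypothesis F_step : forall i, (`|F i.+1 - F i| <= 1)%R.

(* The walk F slowed down and doubled, so that every step is +1 or -1. *)
Let W x : int :=
  let d := F x./2 in
  (if odd x then if F x./2 <= F (x./2).+1 then 2 * d + 1 else 2 * d - 1 else 2 * d)%R.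

Let W_step x : (W x.+1 = W x + 1 \/ W x = W x.+1 + 1)%R.
Proof.
rewrite /W /= uphalf_half; case ox: (odd x) => /=.
  rewrite add1n; have := F_step x./2; case: ifP => ?; lia.
by rewrite add0n; case: ifP => ?; lia.
Qed.

Let F_mod i : F i = F (i %% L).
Proof.
rewrite {1}(divn_eq i L); elim: (i %/ L) => [|n IH]; first by rewrite mul0n add0n.
by rewrite mulSn -addnA addnC F_period.
Qed.

(* Two climbers leave a minimum of W in opposite directions and meet at a maximum. *)
Lemma circular_climbing : exists i0 m : nat,
  [/\ i0 < L, i0 <= m <= i0 + L &
   connect arc_step (inord i0, inord (i0 + L)) (inord m, inord m)].
Proof.
pose i0 : nat := [arg min_(i < Ordinal L_gt0) F (i : 'I_L)]%O.
have [i0L Fmin] : i0 < L /\ forall i, (F i0 <= F i)%R.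
  rewrite /i0; case: arg_minP => // i _ imin; split => // j.
  by rewrite (F_mod j) (imin (Ordinal (ltn_pmod j L_gt0))).
have Wmin x : (2 * F i0 <= W x)%R.
  rewrite /W; have := Fmin x./2; have := Fmin (x./2).+1.
  by case: ifP => _; [case: ifP|]; lia.
have W_period x : W (x + 2 * L) = W x.
  rewrite /W oddD mul2n odd_double addbF halfD odd_double andbF add0n doubleK.
  by rewrite F_period -addSn F_period.
pose s : 'I_(2 * L).+1 := [arg max_(t > ord0) W (2 * i0 + t)]%O.
have smax t : t <= 2 * L -> (W (2 * i0 + t) <= W (2 * i0 + s))%R.
  rewrite /s; case: arg_maxP => // u _ umax tL.
  exact: (umax (Ordinal (tL : t < (2 * L).+1)) isT).
pose M := (W (2 * i0 + s) - 2 * F i0)%R.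
have sL : s <= 2 * L by rewrite -ltnS.
have W0 : W (2 * i0) = (2 * F i0)%R by rewrite /W mul2n odd_double doubleK.
(* The slowed-down walk rises right after a minimum of F, even if F is constant there. *)
have M1 : (0 < M)%R.
  have := @smax 1; rewrite /M addn1 => /(_ ltac:(lia)).
  rewrite {1}/W /= mul2n odd_double /= uphalf_double Fmin; lia.
pose f t := (W (2 * i0 + t) - 2 * F i0)%R.
pose h t := (W (2 * i0 + 2 * L - t) - 2 * F i0)%R.
have fs : unit_steps f s by move=> t _; rewrite /f addnS; have := W_step (2 * i0 + t); lia.
have hs : unit_steps h (2 * L - s).
  move=> t tq; rewrite /h; have := W_step (2 * i0 + 2 * L - t.+1).
  by rewrite (_ : (2 * i0 + 2 * L - t.+1).+1 = 2 * i0 + 2 * L - t); lia.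
have fr t : t <= s -> (0 <= f t <= M)%R.
  by move=> ts; have := Wmin (2 * i0 + t); have := smax t; rewrite /f /M; lia.
have hr t : t <= 2 * L - s -> (0 <= h t <= M)%R.
  move=> ts; rewrite /h -addnBA; last by lia.
  by have := Wmin (2 * i0 + (2 * L - t)); have := smax (2 * L - t); rewrite /M; lia.
have f0 : f 0 = 0%R by rewrite /f addn0 W0 subrr.
have h0 : h 0 = 0%R by rewrite /h subn0 W_period W0 subrr.
have hq : h (2 * L - s) = M by rewrite /h /M; congr (W _ - _)%R; lia.
have C := mountain_climbing M1 f0 (erefl : f s = M) fs h0 hq hs fr hr.
exists i0, (2 * i0 + s)./2; split=> //; first by lia.
pose g (x : 'I_s.+1 * 'I_(2 * L - s).+1) : 'I_(2 * L).+1 * 'I_(2 * L).+1 :=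
  (inord (2 * i0 + x.1)./2, inord (2 * i0 + 2 * L - x.2)./2).
have -> : (inord i0, inord (i0 + L)) = g (ord0, ord0).
  by rewrite /g /= addn0 subn0; congr (inord _, inord _); lia.
have -> : (inord (2 * i0 + s)./2, inord (2 * i0 + s)./2) = g (ord_max, ord_max).
  by rewrite /g /=; congr (inord _, inord _); lia.
(* A simultaneous step becomes at most two arc steps, left end first. Equal values of W leave an
   imbalance of F of at most 1 before and after; moving one end by one place adds at most 1, hence
   the bound 2 for the intermediate arc. *)
apply: connect_map C => -[a b] [a' b'] /=; rewrite /climb_step /=.
case/and4P => /eqP fh /eqP fh' ha hb.
have [[[aE bE] a'E] b'E] := (ltn_ord a, ltn_ord b, ltn_ord a', ltn_ord b').
have WF x : (`|W x - 2 * F x./2| <= 1)%R.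
  by rewrite /W; case: ifP => _; [case: ifP|]; lia.
have mk u v : u <= v -> v <= 2 * L -> v <= u + L -> (`|F v - F u| <= 2)%R ->
    balanced_arc (inord u, inord v).
  by move=> uv vL vu Fuv; rewrite /balanced_arc /= !inordK ?uv ?vu //; lia.
rewrite /g /=; set x := 2 * i0 + a; set x' := 2 * i0 + a'.
set y := 2 * i0 + 2 * L - b; set y' := 2 * i0 + 2 * L - b'.
have {fh}W1 : W x = W y by move: fh; rewrite /f /h -/x -/y; lia.
have {fh'}W2 : W x' = W y' by move: fh'; rewrite /f /h -/x' -/y'; lia.
have B1 : balanced_arc (inord x./2, inord y./2).
  by apply: mk; try lia; have := WF x; have := WF y; lia.
have B3 : balanced_arc (inord x'./2, inord y'./2).
  by apply: mk; try lia; have := WF x'; have := WF y'; lia.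
have Fx : (`|F x'./2 - F x./2| <= 1)%R.
  have [->|[->|->]] : x'./2 = x./2 \/ x'./2 = (x./2).+1 \/ x./2 = (x'./2).+1 by lia.
  - by rewrite subrr.
  - exact: F_step.
  - by rewrite distrC; exact: F_step.
have B2 : balanced_arc (inord x'./2, inord y./2).
  by apply: mk; try lia; have := WF x; have := WF y; lia.
apply: connect_trans (_ : connect _ (inord x'./2, inord y./2) _).
  have [->|xx] := eqVneq x'./2 x./2; first exact: connect0.
  apply: connect1; rewrite /arc_step /= B1 B2 eqxx /= !inordK; lia.
have [->|yy] := eqVneq y'./2 y./2; first exact: connect0.
by apply: connect1; rewrite /arc_step /= B2 B3 eqxx /= !inordK; lia.
Qed.

End CircularWalk.

(** * Balls, partitions and local moves *)

Section Balls.
Local Open Scope nat_scope.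
Variable G : sgraph.

Fixpoint ball (v : G) (r : nat) : {set G} :=
  if r is r'.+1 then \bigcup_(u in ball v r') (u |: [set w | adj u w]) else [set v].

Lemma ball_center v r : v \in ball v r.
Proof.
elim: r => [|r IH] /=; first exact: set11.
by apply/bigcupP; exists v => //; exact: setU11.
Qed.

Lemma ball_trans u v w r s : u \in ball v r -> w \in ball u s -> w \in ball v (r + s).
Proof.
move=> uv; elim: s w => [|s IH] w /=; first by rewrite inE => /eqP ->; rewrite addn0.
by rewrite addnS => /bigcupP[x xu wx]; apply/bigcupP; exists x => //; exact: IH.
Qed.

Lemma ball_mono v r s : r <= s -> ball v r \subset ball v s.
Proof.
move=> rs; apply/subsetP => u uv; rewrite -(subnKC rs).
exact: ball_trans uv (ball_center _ _).
Qed.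

Lemma adj_ball (u v : G) : adj u v -> v \in ball u 1.
Proof.
by move=> uv; apply/bigcupP; exists u; [exact: set11|rewrite !inE uv orbT].
Qed.

Lemma ball_sym u v r : (u \in ball v r) = (v \in ball u r).
Proof.
suff sub a b : a \in ball b r -> b \in ball a r by apply/idP/idP; exact: sub.
elim: r a => [|r IH] a /=; first by rewrite !inE eq_sym.
case/bigcupP=> x /IH bx; rewrite !inE => /orP[/eqP -> | xa].
  exact: subsetP (ball_mono x (leqnSn r)) _ bx.
by apply: (@ball_trans x a b 1 r) => //; apply: adj_ball; rewrite adj_sym.
Qed.

Lemma card_ball D v r : (forall u : G, #|[set w | adj u w]| <= D) ->
  #|ball v r| <= D.+1 ^ r.
Proof.
move=> deg; elim: r => [|r IH] /=; first by rewrite cards1.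
have card_bigcup (A : {set G}) (f : G -> {set G}) :
    #|\bigcup_(u in A) f u| <= \sum_(u in A) #|f u|.
  by apply: (big_ind2 (fun (X : {set G}) k => #|X| <= k)); rewrite ?cards0 // => X a Y b ha hb;
    apply: leq_trans (leq_card_setU _ _) (leq_add ha hb).
apply: leq_trans (card_bigcup _ _) _.
apply: leq_trans (_ : \sum_(u in ball v r) D.+1 <= _).
  apply: leq_sum => u _; apply: leq_trans (leq_card_setU _ _) _.
  by rewrite cards1 ltnS.
by rewrite sum_nat_const expnS mulnC leq_mul2l IH orbT.
Qed.

Lemma connected_ball (A : {set G}) v :
  connected_set A -> v \in A -> A \subset ball v #|A|.
Proof.
move=> /forallP/(_ v)/implyP cA vA; apply/subsetP => u uA.
move/forallP: (cA vA) => /(_ u); rewrite uA /= => /connectP[p0 p0p ->].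
case/shortenP: p0p => p pp up _.
have pA : {subset p <= A}.
  elim: p v pp {cA up vA} => //= x p IH v /andP[/and3P[_ xA _] pp] y.
  by rewrite inE => /predU1P[-> //|]; exact: IH pp y.
have sp : size p <= #|A|.
  rewrite -(card_uniqP (subseq_uniq (subseq_cons p v) up)).
  by apply/subset_leq_card/subsetP.
apply: subsetP (ball_mono v sp) _ _.
elim: p v pp {cA up vA pA sp} => [|x p IH] v /=; first by rewrite inE.
move=> /andP[/and3P[_ _ vx] /IH]; exact: (@ball_trans x v _ 1) (adj_ball vx).
Qed.

Lemma ball_stretch (s : G -> nat) w v u r :
  (forall x y : G, adj x y -> s x <= s y + w) ->
  u \in ball v r -> s u <= s v + r * w /\ s v <= s u + r * w.
Proof.
move=> sw; suff sub a b : a \in ball b r -> s a <= s b + r * w.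
  by move=> uv; split; apply: sub => //; rewrite ball_sym.
elim: r a => [|r IH] a /=; first by rewrite inE => /eqP ->; rewrite leq_addr.
case/bigcupP=> x /IH xb; rewrite !inE => /orP[/eqP ->|xa].
  by apply: leq_trans xb _; rewrite leq_add2l leq_mul2r leqnSn orbT.
have /sw : adj a x by rewrite adj_sym.
by move/leq_trans; apply; rewrite mulSn; lia.
Qed.

End Balls.

(** * Sets of blocks under symmetric difference *)

Section SymmetricDifference.
Variable T : finType.
Implicit Types P Q S : {set T}.

Definition symdiff P Q : {set T} := [set x | (x \in P) (+) (x \in Q)].

Lemma symdiffC P Q : symdiff P Q = symdiff Q P.
Proof. by apply/setP => x; rewrite !inE addbC. Qed.

Lemma symdiffA P Q S : symdiff P (symdiff Q S) = symdiff (symdiff P Q) S.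
Proof. by apply/setP => x; rewrite !inE addbA. Qed.

Lemma symdiffK P Q : symdiff P (symdiff P Q) = Q.
Proof. by apply/setP => x; rewrite !inE addKb. Qed.

Lemma symdiff_cancel P Q S : symdiff (symdiff P S) (symdiff Q S) = symdiff P Q.
Proof. by apply/setP => x; rewrite !inE -addbA (addbC (x \in S)) addbK. Qed.

Lemma symdiff_inj P : injective (symdiff P).
Proof. exact: can_inj (symdiffK P). Qed.

Lemma subset_setD_symdiff P Q : P :\: Q \subset symdiff P Q.
Proof. by apply/subsetP => x; rewrite !inE => /andP[/negbTE -> ->]. Qed.

End SymmetricDifference.

Section Partitions.
Local Open Scope nat_scope.
Variable G : sgraph.
Implicit Types (P Q T : {set {set G}}) (A C : {set G}).

Lemma partition_intro P : set0 \notin P -> (forall x, exists2 A, A \in P & x \in A) ->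
  (forall x A C, A \in P -> C \in P -> x \in A -> x \in C -> A = C) ->
  partition P [set: G].
Proof.
move=> P0 ex un; rewrite /partition P0 andbT; apply/andP; split.
  by apply/eqP/setP => x; rewrite inE; have [A AP xA] := ex x; apply/bigcupP; exists A.
apply/trivIsetP => A C AP CP; apply: contraNT => /pred0Pn[x /andP[xA xC]].
by apply/eqP; exact: un xA xC.
Qed.

Section Blocks.
Variables (P : {set {set G}}) (part : partition P [set: G]).

Lemma mem_own_pblock x : x \in pblock P x.
Proof. by rewrite mem_pblock (cover_partition part) inE. Qed.

Lemma pblock_in x : pblock P x \in P.
Proof. by rewrite pblock_mem // (cover_partition part) inE. Qed.

Lemma pblock_eq A x : A \in P -> x \in A -> pblock P x = A.
Proof. by apply: def_pblock; case/and3P: part. Qed.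

Lemma block_eq A C x : A \in P -> C \in P -> x \in A -> x \in C -> A = C.
Proof. by move=> AP CP xA xC; rewrite -(pblock_eq AP xA) (pblock_eq CP xC). Qed.

Lemma block_inhabited A : A \in P -> exists x, x \in A.
Proof.
by move=> AP; apply/set0Pn; apply: contraTneq AP => ->; case/and3P: part.
Qed.

Lemma block_pblock A : A \in P -> exists x, A = pblock P x.
Proof.
by move=> AP; have [x xA] := block_inhabited AP; exists x; rewrite (pblock_eq AP xA).
Qed.

End Blocks.

Lemma eq_partition P Q : partition P [set: G] -> partition Q [set: G] ->
  pblock P =1 pblock Q -> P = Q.
Proof.
move=> pP pQ e; apply/setP => A; apply/idP/idP => /block_pblock.
  by case/(_ pP) => x ->; rewrite e pblock_in.
by case/(_ pQ) => x ->; rewrite -e pblock_in.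
Qed.

Lemma partition_blocks (blk : G -> {set G}) :
  (forall u, u \in blk u) -> (forall u v, v \in blk u -> blk v = blk u) ->
  let P := [set blk u | u : G] in partition P [set: G] /\ pblock P =1 blk.
Proof.
move=> b1 b2 P.
have pP : partition P [set: G].
  apply: partition_intro => [|x|x A C].
  - by apply/imsetP => -[u _ u0]; have := b1 u; rewrite -u0 inE.
  - by exists (blk x) => //; exact: imset_f.
  by move=> /imsetP[u _ ->] /imsetP[v _ ->] /b2 <- /b2 <-.
by split=> // u; apply: pblock_eq => //; exact: imset_f.
Qed.

Definition valid (B : nat) P : bool :=
  [&& partition P [set: G], contiguous P & size_bounded B P].

Lemma in_Omega k B P : (P \in Omega G k B) = valid B P && (#|P| <= k).
Proof. by rewrite inE /valid /qpartition; case: partition => //=; rewrite andbC. Qed.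

(* The surgery that turns P into Q is applied to T as a symmetric difference. *)
Section Surgery.
Variables (B : nat) (P Q T : {set {set G}}).
Hypotheses (vP : valid B P) (vQ : valid B Q) (vT : valid B T) (PT : P :\: Q \subset T).

Let pP : partition P [set: G]. Proof. by case/and3P: vP. Qed.
Let pQ : partition Q [set: G]. Proof. by case/and3P: vQ. Qed.
Let pT : partition T [set: G]. Proof. by case/and3P: vT. Qed.

(** Both P and Q being partitions, [P :\: Q] and [Q :\: P] cover the same vertices, and the former
    consists of blocks of T. So an inserted block meets no block of T except those that the surgery
    removes. *)
Let new_disjoint A C x : A \in Q :\: P -> C \in T -> x \in A -> x \in C -> C \in P :\: Q.
Proof.
rewrite inE => /andP[AP AQ] CT xA xC.
have DP : pblock P x \in P :\: Q.
  rewrite inE pblock_in // andbT; apply: contra AP => DQ.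
  by rewrite (block_eq pQ AQ DQ xA (mem_own_pblock pP x)) pblock_in.
by rewrite (block_eq pT CT (subsetP PT _ DP) xC (mem_own_pblock pP x)).
Qed.

Let surgeryE : symdiff T (symdiff P Q) = (T :\: (P :\: Q)) :|: (Q :\: P).
Proof.
apply/setP => A; rewrite !inE.
have := subsetP PT A; rewrite !inE.
case AP: (A \in P); case AQ: (A \in Q); case AT: (A \in T) => //=.
- by move=> /(_ isT).
- move=> _; have [x xA] := block_inhabited pQ AQ.
  by have := @new_disjoint A A x; rewrite !inE AP AQ AT /= => /(_ isT isT xA xA).
Qed.

Lemma valid_surgery : valid B (symdiff T (symdiff P Q)).
Proof.
rewrite surgeryE; apply/and3P; split.
- apply: partition_intro => [|x|x A C].
  + have [/negbTE t0 /negbTE q0] : set0 \notin T /\ set0 \notin Q.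
      by split; [case/and3P: pT|case/and3P: pQ].
    by rewrite !inE t0 q0 !andbF.
  + have [TP|TP] := boolP (pblock T x \in P :\: Q); last first.
      by exists (pblock T x); rewrite ?mem_own_pblock // in_setU in_setD TP pblock_in.
    exists (pblock Q x); rewrite ?mem_own_pblock // inE orbC inE pblock_in // andbT.
    move: TP; rewrite inE => /andP[TQ TP]; apply/orP; left; apply: contra TQ => QP.
    by rewrite (block_eq pP TP QP (mem_own_pblock pT x) (mem_own_pblock pQ x)) pblock_in.
  rewrite !in_setU.
  move=> /orP[|] hA /orP[|] hC xA xC.
  + by move: hA hC; rewrite !in_setD => /andP[_ hA] /andP[_ hC]; exact: (block_eq pT) xA xC.
  + move: hA; rewrite in_setD => /andP[nA AT].
    by rewrite (new_disjoint hC AT xC xA) in nA.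
  + move: hC; rewrite in_setD => /andP[nC CT].
    by rewrite (new_disjoint hA CT xA xC) in nC.
  by move: hA hC; rewrite !in_setD => /andP[_ hA] /andP[_ hC]; exact: (block_eq pQ) xA xC.
- apply/forallP => A; apply/implyP; rewrite in_setU !in_setD => /orP[/andP[_]|/andP[_]].
    by case/and3P: vT => _ /forallP/(_ A)/implyP.
  by case/and3P: vQ => _ /forallP/(_ A)/implyP.
apply/forallP => A; apply/implyP; rewrite in_setU !in_setD => /orP[/andP[_]|/andP[_]].
  by case/and3P: vT => _ _ /forallP/(_ A)/implyP.
by case/and3P: vQ => _ _ /forallP/(_ A)/implyP.
Qed.

Lemma card_surgery : #|symdiff T (symdiff P Q)| + #|P| = #|T| + #|Q|.
Proof.
rewrite surgeryE cardsU [X in _ - X]eq_card0 ?subn0; last first.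
  move=> A; rewrite !inE; apply/negP => /andP[/andP[_ AT] /andP[AP AQ]].
  have [x xA] := block_inhabited pQ AQ.
  by have := @new_disjoint A A x; rewrite !inE AQ (negbTE AP) AT /= => /(_ isT isT xA xA).
rewrite cardsD (setIidPr PT).
have := subset_leq_card PT.
by have := cardsID Q P; have := cardsID P Q; rewrite (setIC Q P); lia.
Qed.

End Surgery.

Lemma card_cover_subset (S : {set {set G}}) A : S \subset powerset A -> #|cover S| <= #|A|.
Proof.
move=> SA; apply/subset_leq_card/bigcupsP => C CS.
by have := subsetP SA _ CS; rewrite inE.
Qed.

Section LocalMoves.
Variable r : nat.

Definition loc : rel {set {set G}} :=
  [rel P Q | [exists v, symdiff P Q \subset powerset (ball v r)]].

Lemma loc_sym P Q : loc P Q = loc Q P.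
Proof. by rewrite /loc /= symdiffC. Qed.

Lemma loc_symdiff P Q T : loc (symdiff P T) (symdiff Q T) = loc P Q.
Proof. by rewrite /loc /= symdiff_cancel. Qed.

Variable b : nat.
Hypothesis card_b : forall v : G, #|ball v r| <= b.

Lemma card_cover_loc P Q : loc P Q -> #|cover (P :\: Q)| <= b.
Proof.
case/existsP=> v PQ; apply: leq_trans (card_b v).
by apply/card_cover_subset/subset_trans/PQ/subset_setD_symdiff.
Qed.

Let card_powers (v : G) : #|powerset (powerset (ball v r))| <= 2 ^ 2 ^ b.
Proof. by rewrite !card_powerset !leq_exp2l. Qed.

(** Q is determined by [symdiff P Q], a family of subsets of a ball with at most b vertices; there
    are at most 2 ^ 2 ^ b such families for each centre. *)
Lemma card_moves_at P (Y : {set G}) :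
  #|[set Q | [exists v in Y, symdiff P Q \subset powerset (ball v r)]]| <= #|Y| * 2 ^ 2 ^ b.
Proof.
apply: leq_trans (_ : #|\bigcup_(v in Y) [set symdiff P S | S in powerset (powerset (ball v r))]| <= _).
  apply/subset_leq_card/subsetP => Q; rewrite inE => /existsP[v /andP[vY PQ]].
  apply/bigcupP; exists v => //; apply/imsetP; exists (symdiff P Q); first by rewrite inE.
  by rewrite symdiffK.
rewrite -sum_nat_const; apply: (big_ind2 (fun (X : {set {set {set G}}}) k => #|X| <= k)).
- by rewrite cards0.
- by move=> X a Z c ha hc; apply: leq_trans (leq_card_setU _ _) (leq_add ha hc).
- by move=> v _; apply: leq_trans (leq_imset_card _ _) (card_powers v).
Qed.

Lemma card_loc P : #|[set Q | loc P Q]| <= #|G| * 2 ^ 2 ^ b.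
Proof.
rewrite -cardsT; apply: leq_trans (card_moves_at P [set: G]).
apply/subset_leq_card/subsetP => Q; rewrite !inE => /existsP[v h].
by apply/existsP; exists v; rewrite inE.
Qed.

(** If a block lost by P contains y in Y, the centre of the move lies within distance r of y. The
    bound does not involve the size of G, so when Y is bounded only boundedly many of the reductions
    can disturb it. *)
Lemma card_moves_meeting P (Y : {set G}) :
  #|[set Q | loc P Q && ~~ [disjoint cover (P :\: Q) & Y]]| <= #|Y| * b * 2 ^ 2 ^ b.
Proof.
apply: leq_trans (_ : #|\bigcup_(y in Y) ball y r| * 2 ^ 2 ^ b <= _); last first.
  rewrite leq_mul2r; apply/orP; right; rewrite -sum_nat_const.
  apply: (big_ind2 (fun (X : {set G}) k => #|X| <= k)); rewrite ?cards0 // => X a Z c ha hc.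
  exact: leq_trans (leq_card_setU _ _) (leq_add ha hc).
apply: leq_trans (card_moves_at _ _); apply/subset_leq_card/subsetP => Q.
rewrite !inE => /andP[/existsP[v PQ]] /pred0Pn[y /andP[/= yc yY]].
apply/existsP; exists v; apply/andP; split; last exact: PQ.
apply/bigcupP; exists y => //.
case/bigcupP: yc => A APQ yA; rewrite ball_sym.
have := subsetP PQ A (subsetP (subset_setD_symdiff P Q) A APQ).
by rewrite inE => /subsetP/(_ y yA).
Qed.

End LocalMoves.

Lemma mem_preim_partition (T : finType) (f : G -> T) u :
  pblock (preim_partition f [set: G]) u = [set v | f v == f u].
Proof.
have e : {in [set: G] & &, equivalence_rel (fun x y => f x == f y)}.
  by move=> x y z _ _ _; split=> // /eqP ->.
by apply/setP => v; rewrite (pblock_equivalence_partition e) ?in_setT // inE eq_sym.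
Qed.

End Partitions.

(** * Extension to partitions with more blocks *)

Section Extension.
Variables (R : realType) (X : finType) (loc : rel {set X}) (X0 X1 : {set {set X}}).
Implicit Types (P Q S T U : {set X}) (f : {set X} -> R).
Variables (kap : {set X} -> {set X} -> R) (far : {set X} -> {set X} -> {set X} -> {set X} -> {set {set X}}).
Variables (d : nat) (N eta : R).
Hypotheses (loc_sym : forall P Q, loc P Q = loc Q P)
  (loc_symdiff : forall P Q S, loc (symdiff P S) (symdiff Q S) = loc P Q)
  (loc_deg : forall P, (#|[set Q | loc P Q]| <= d)%N).
Hypotheses (X01 : X0 \subset X1) (eta_ge0 : 0 <= eta) (N_gt0 : 0 < N).
Hypotheses (kap_ge0 : forall P Q, 0 <= kap P Q)
  (kap1 : forall P, P \in X1 -> \sum_Q kap P Q = 1)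
  (kap_stay : forall P Q, P \in X0 -> kap P Q = (Q == P)%:R)
  (kap_move : forall P Q, P \in X1 -> P \notin X0 ->
     kap P Q <= if (Q \in X0) && loc P Q then eta else 0).

(* Every admissible Q1, Q2 is joined through the moves below, in which S is the surgery
   that turns P into Q3:  Q1 -> Q1 + S -> Q3 = P + S -> P' + S -> Q2 + S -> Q2. *)
Hypothesis far_spec : forall P P' Q1 Q2,
  P \in X1 -> P \notin X0 -> P' \in X1 -> loc P P' -> kap P Q1 != 0 -> kap P' Q2 != 0 ->
  N <= #|far P P' Q1 Q2|%:R /\
  forall Q3, Q3 \in far P P' Q1 Q2 ->
    [/\ loc P Q3, Q3 \in X0, symdiff Q1 (symdiff P Q3) \in X0, symdiff P' (symdiff P Q3) \in X0 &
        symdiff Q2 (symdiff P Q3) \in X0].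

Definition energy (Y : {set {set X}}) f :=
  \sum_(P in Y) \sum_(Q in Y | loc P Q) (f P - f Q) ^+ 2.

Definition extension f P := \sum_Q kap P Q * f Q.

Lemma extensionE f P : P \in X0 -> extension f P = f P.
Proof.
move=> PX; rewrite /extension (bigD1 P) //= kap_stay // eqxx mul1r big1 ?addr0 // => Q /negbTE QP.
by rewrite kap_stay // QP mul0r.
Qed.

Let ler_sumW (I : finType) (A A' : pred I) (F : I -> R) :
  (forall i, 0 <= F i) -> subpred A A' -> \sum_(i | A i) F i <= \sum_(i | A' i) F i.
Proof.
move=> F0 AA; rewrite [X in X <= _]big_mkcond [X in _ <= X]big_mkcond ler_sum // => i _.
by case: ifP => [/AA -> // | _]; case: ifP.
Qed.

Let sum_loc (F : {set X} -> R) (A : pred {set X}) : (forall P, 0 <= F P) ->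
  \sum_(P : {set X}) \sum_(Q | A Q && loc P Q) F Q <= d%:R * \sum_(Q | A Q) F Q.
Proof.
move=> F0; rewrite (exchange_big_dep A) /=; last by move=> P Q _ /andP[].
rewrite mulr_sumr ler_sum // => Q AQ.
rewrite sumr_const -[F Q *+ _]mulr_natl ler_wpM2r ?F0 // ler_nat.
apply: leq_trans (loc_deg Q); apply/subset_leq_card/subsetP => P.
by rewrite !inE => /andP[_]; rewrite loc_sym.
Qed.

Section Energy.
Variable f : {set X} -> R.
Let E0 := energy X0 f.
Let ell P := \sum_(Q in X0 | loc P Q) (f P - f Q) ^+ 2.

Let ell_ge0 P : 0 <= ell P. Proof. by apply: sumr_ge0 => Q _; exact: sqr_ge0. Qed.
Let E0_ge0 : 0 <= E0. Proof. by apply: sumr_ge0 => P _; exact: ell_ge0. Qed.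

Let sum_loc_const P (x : R) : 0 <= x -> \sum_(Q | loc P Q) x <= d%:R * x.
Proof.
move=> x0; rewrite sumr_const -[x *+ _]mulr_natl ler_wpM2r // ler_nat.
by apply: leq_trans (loc_deg P); apply/subset_leq_card/subsetP => Q; rewrite !inE.
Qed.

(* The moves from U + S to P + S over all S, for a move from U to P. *)
Let shifted P U := \sum_(Q3 in X0 | loc P Q3 && (symdiff U (symdiff P Q3) \in X0))
  (f (symdiff U (symdiff P Q3)) - f Q3) ^+ 2.

Let shifted_ge0 P U : 0 <= shifted P U.
Proof. by apply: sumr_ge0 => Q _; exact: sqr_ge0. Qed.

(** For fixed P and Q3, adding the surgery to both ends of a move from P to U gives a move that
    starts at Q3, injectively in U; so the sum over U is at most [ell Q3]. *)
Let sum_shifted : \sum_(P : {set X}) \sum_(U | loc P U) shifted P U <= d%:R * E0.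
Proof.
apply: le_trans (sum_loc (mem X0) ell_ge0); apply: ler_sum => P _.
rewrite (exchange_big_dep (fun Q3 => (Q3 \in X0) && loc P Q3)) /=; last first.
  by move=> U Q3 _ /and3P[-> ->].
apply: ler_sum => Q3 /andP[QX PQ].
rewrite /ell [X in _ <= X](reindex_inj (@symdiff_inj _ (symdiff P Q3))) /=.
rewrite [X in X <= _]big_mkcond [X in _ <= X]big_mkcond; apply: ler_sum => U _.
rewrite (symdiffC (symdiff P Q3) U) -(loc_symdiff P U (symdiff P Q3)) symdiffK QX PQ /= andbC.
by case: ifP => // _; rewrite -sqrrN opprB.
Qed.

(** With S = [symdiff P Q3], these are the moves from P' + S to Q2 + S. *)
Let doubly P P' Q2 := \sum_(Q3 | [&& loc P Q3, symdiff P' (symdiff P Q3) \in X0 & symdiff Q2 (symdiff P Q3) \in X0])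
  (f (symdiff P' (symdiff P Q3)) - f (symdiff Q2 (symdiff P Q3))) ^+ 2.

Let doubly_ge0 P P' Q2 : 0 <= doubly P P' Q2.
Proof. by apply: sumr_ge0 => Q _; exact: sqr_ge0. Qed.

(** Put T = P' + S. It is local to P' because Q3 is local to P, and for fixed P, P' it determines
    Q3. The sum over Q2 is then at most [ell T], and each T arises from at most d choices of P',
    each with at most d choices of P. *)
Let sum_doubly :
  \sum_(P : {set X}) \sum_(P' | loc P P') \sum_(Q2 | loc P' Q2) doubly P P' Q2 <= d%:R ^+ 2 * E0.
Proof.
apply: le_trans (_ : \sum_(P : {set X}) \sum_(P' | loc P P')
    \sum_(T in X0 | loc P' T) ell T <= _).
  apply: ler_sum => P _; apply: ler_sum => P' PP'.
  rewrite (exchange_big_dep (fun Q3 => loc P Q3 && (symdiff P' (symdiff P Q3) \in X0))) /=; last first.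
    by move=> U Q3 _ /and3P[-> ->].
  rewrite [X in _ <= X](reindex_inj (@symdiff_inj _ (symdiff P P'))) /=.
  rewrite [X in X <= _]big_mkcond [X in _ <= X]big_mkcond; apply: ler_sum => Q3 _.
  have -> : symdiff (symdiff P P') Q3 = symdiff P' (symdiff P Q3) by rewrite (symdiffC P P') symdiffA.
  have -> : loc P' (symdiff P' (symdiff P Q3)) = loc P Q3.
    by rewrite -(loc_symdiff P Q3 (symdiff P P')) symdiffK; congr (loc _ _); rewrite (symdiffC Q3) (symdiffC P P') symdiffA.
  rewrite andbC; case: ifP => // /andP[PQ PX]; rewrite /ell.
  rewrite [X in _ <= X](reindex_inj (@symdiff_inj _ (symdiff P Q3))) /=.
  rewrite [X in X <= _]big_mkcond [X in _ <= X]big_mkcond; apply: ler_sum => U _.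
  rewrite PQ PX /= [symdiff (symdiff P Q3) U]symdiffC loc_symdiff andbC.
  by case: ifP.
apply: le_trans (_ : \sum_(P' : {set X}) d%:R * \sum_(T in X0 | loc P' T) ell T <= _).
  have := sum_loc predT (F := fun P' => \sum_(T in X0 | loc P' T) ell T).
  by rewrite mulr_sumr; apply => P'; apply: sumr_ge0.
by rewrite -mulr_sumr expr2 -mulrA ler_wpM2l //; exact: sum_loc.
Qed.

Let five (x0 x1 x2 x3 x4 x5 : R) : (x0 - x5) ^+ 2 <=
  5 * ((x0 - x1) ^+ 2 + (x1 - x2) ^+ 2 + (x2 - x3) ^+ 2 + (x3 - x4) ^+ 2 + (x4 - x5) ^+ 2).
Proof.
pose a := x0 - x1; pose b := x1 - x2; pose c := x2 - x3; pose e := x3 - x4; pose g := x4 - x5.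
have -> : x0 - x5 = a + b + c + e + g by rewrite /a /b /c /e /g; ring.
rewrite -/a -/b -/c -/e -/g.
rewrite -subr_ge0 (_ : _ - _ = (a - b) ^+ 2 + (a - c) ^+ 2 + (a - e) ^+ 2 + (a - g) ^+ 2 +
  (b - c) ^+ 2 + (b - e) ^+ 2 + (b - g) ^+ 2 + (c - e) ^+ 2 + (c - g) ^+ 2 + (e - g) ^+ 2);
  last by ring.
by rewrite !addr_ge0 ?sqr_ge0.
Qed.

(** The rows of [kap] sum to 1, so the difference of the two averages is an average over the product
    of the rows, and Cauchy-Schwarz applies. *)
Let average_gap P P' : P \in X1 -> P' \in X1 ->
  (extension f P - extension f P') ^+ 2 <=
  \sum_Q1 \sum_Q2 kap P Q1 * kap P' Q2 * (f Q1 - f Q2) ^+ 2.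
Proof.
move=> PX PX'.
have E : extension f P - extension f P' =
    \sum_(q : {set X} * {set X}) kap P q.1 * kap P' q.2 * (f q.1 - f q.2).
  rewrite -(pair_bigA _ (fun Q1 Q2 => kap P Q1 * kap P' Q2 * (f Q1 - f Q2))) /=.
  under eq_bigr => Q1 _.
    under eq_bigr => Q2 _ do rewrite mulrBr.
    rewrite sumrB -mulr_suml -mulr_sumr kap1 // mulr1.
    under [X in _ - X]eq_bigr => Q2 _ do rewrite -mulrA.
    rewrite -mulr_sumr; over.
  by rewrite sumrB -mulr_suml kap1 // mul1r.
rewrite E; apply: le_trans (weighted_cauchy_schwarz _ _) _; first by move=> q; exact: mulr_ge0.
rewrite -(pair_bigA _ (fun Q1 Q2 => kap P Q1 * kap P' Q2)) /=.
rewrite -(pair_bigA _ (fun Q1 Q2 => kap P Q1 * kap P' Q2 * (f Q1 - f Q2) ^+ 2)) /=.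
by rewrite -big_distrlr /= !kap1 // !mul1r.
Qed.

Let kap_near P Q : P \in X1 -> kap P Q != 0 -> Q \in X0.
Proof.
move=> P1; have [P0|P0] := boolP (P \in X0).
  by rewrite kap_stay // pnatr_eq0 eqb0 negbK => /eqP ->.
have := kap_move Q P1 P0; case: ifP => [/andP[] // | _ k0 /negP[]].
by rewrite eq_le k0 kap_ge0.
Qed.

(** The detours for all Q3 in [far] are averaged, whence the division by N. Each of the five legs is
    then bounded by a sum over all admissible Q3, which no longer refers to [far]. *)
Let detour P P' Q1 Q2 : P \in X1 -> P \notin X0 -> P' \in X1 -> loc P P' ->
  kap P Q1 * kap P' Q2 * (f Q1 - f Q2) ^+ 2 <=
  kap P Q1 * kap P' Q2 * (5 / N *
    (ell Q1 + shifted P Q1 + shifted P P' + doubly P P' Q2 + ell Q2)).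
Proof.
move=> P1 P0 P1' PP'.
have [->|k1] := eqVneq (kap P Q1) 0; first by rewrite !mul0r.
have [->|k2] := eqVneq (kap P' Q2) 0; first by rewrite mulr0 !mul0r.
rewrite ler_wpM2l ?mulr_ge0 //.
have [cardN far_ok] := far_spec P1 P0 P1' PP' k1 k2.
have Q1X := kap_near P1 k1; have Q2X := kap_near P1' k2.
rewrite mulrAC ler_pdivlMr // mulrC.
apply: le_trans (_ : \sum_(Q3 in far P P' Q1 Q2) (f Q1 - f Q2) ^+ 2 <= _).
  by rewrite sumr_const -[X in _ <= X]mulr_natl ler_wpM2r ?sqr_ge0.
pose S Q3 := symdiff P Q3.
apply: le_trans (_ : \sum_(Q3 in far P P' Q1 Q2)
   5 * ((f Q1 - f (symdiff Q1 (S Q3))) ^+ 2 + (f (symdiff Q1 (S Q3)) - f Q3) ^+ 2 +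
     (f Q3 - f (symdiff P' (S Q3))) ^+ 2 + (f (symdiff P' (S Q3)) - f (symdiff Q2 (S Q3))) ^+ 2 +
     (f (symdiff Q2 (S Q3)) - f Q2) ^+ 2) <= _); first by apply: ler_sum => Q3 _; exact: five.
rewrite -mulr_sumr ler_pM2l // !big_split /=.
have sub_ell Q : Q \in X0 -> (forall Q3, Q3 \in far P P' Q1 Q2 -> symdiff Q (symdiff P Q3) \in X0) ->
    \sum_(Q3 in far P P' Q1 Q2) (f Q - f (symdiff Q (S Q3))) ^+ 2 <= ell Q.
  move=> QX hf; rewrite /ell [X in _ <= X](reindex_inj (@symdiff_inj _ (symdiff P Q))) /=.
  rewrite [X in X <= _]big_mkcond [X in _ <= X]big_mkcond; apply: ler_sum => Q3 _.
  have -> : symdiff (symdiff P Q) Q3 = symdiff Q (S Q3) by rewrite (symdiffC P) /S symdiffA.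
  have [QF|_] := boolP (Q3 \in _); last by case: ifP => // _; exact: sqr_ge0.
  have [PQ _ _ _ _] := far_ok _ QF.
  rewrite hf //=; suff -> : loc Q (symdiff Q (S Q3)) = loc P Q3 by rewrite PQ.
  by rewrite -(loc_symdiff P Q3 (symdiff P Q)) symdiffK; congr (loc _ _); rewrite (symdiffC Q3) (symdiffC P Q) /S symdiffA.
do 4?apply: lerD.
- by apply: sub_ell => // Q3 /far_ok[].
- apply: ler_sumW => [Q3|Q3 /far_ok[? ? ? _ _]]; first exact: sqr_ge0.
  by apply/and3P.
- rewrite (eq_bigr (fun Q3 => (f (symdiff P' (S Q3)) - f Q3) ^+ 2)); last by move=> Q3 _; rewrite -sqrrN opprB.
  apply: ler_sumW => [Q3|Q3 /far_ok[? ? _ ? _]]; first exact: sqr_ge0.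
  by apply/and3P.
- apply: ler_sumW => [Q3|Q3 /far_ok[? _ _ ? ?]]; first exact: sqr_ge0.
  by apply/and3P.
rewrite (eq_bigr (fun Q3 => (f Q2 - f (symdiff Q2 (S Q3))) ^+ 2)); last by move=> Q3 _; rewrite -sqrrN opprB.
by apply: sub_ell => // Q3 /far_ok[].
Qed.

Let near_ell P := \sum_(Q in X0 | loc P Q) ell Q.

Let near_ell_ge0 P : 0 <= near_ell P. Proof. exact: sumr_ge0. Qed.

Let sum_near_ell : \sum_(P : {set X}) near_ell P <= d%:R * E0.
Proof. exact: (sum_loc (mem X0) ell_ge0). Qed.

Let kap_sum P (F : {set X} -> R) : P \in X1 -> P \notin X0 -> (forall Q, 0 <= F Q) ->
  \sum_Q kap P Q * F Q <= eta * \sum_(Q in X0 | loc P Q) F Q.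
Proof.
move=> P1 P0 F0; rewrite mulr_sumr [X in _ <= X]big_mkcond; apply: ler_sum => Q _.
apply: le_trans (ler_wpM2r (F0 Q) (kap_move Q P1 P0)) _.
by case: ifP => // _; rewrite mul0r.
Qed.

Let detour_sum P P' : P \in X1 -> P \notin X0 -> P' \in X1 -> loc P P' ->
  (extension f P - extension f P') ^+ 2 <= 5 / N * (eta * near_ell P +
    eta * (\sum_(Q | loc P Q) shifted P Q) + shifted P P' +
    eta * (\sum_(Q | loc P' Q) doubly P P' Q) +
    ((if P' \in X0 then ell P' else 0) + eta * near_ell P')).
Proof.
move=> P1 P0 P1' PP'.
apply: le_trans (average_gap P1 P1') _.
apply: le_trans (_ : \sum_Q1 \sum_Q2 kap P Q1 * kap P' Q2 * (5 / N *
    (ell Q1 + shifted P Q1 + shifted P P' + doubly P P' Q2 + ell Q2)) <= _).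
  by apply: ler_sum => Q1 _; apply: ler_sum => Q2 _; exact: detour.
pose A F := \sum_Q kap P Q * F Q; pose A' F := \sum_Q kap P' Q * F Q.
have -> : \sum_Q1 \sum_Q2 kap P Q1 * kap P' Q2 * (5 / N *
    (ell Q1 + shifted P Q1 + shifted P P' + doubly P P' Q2 + ell Q2)) =
  5 / N * (A ell + A (shifted P) + shifted P P' + A' (doubly P P') + A' ell).
  set c := 5 / N.
  have inner Q1 : \sum_Q2 kap P Q1 * kap P' Q2 * (c *
      (ell Q1 + shifted P Q1 + shifted P P' + doubly P P' Q2 + ell Q2)) =
    c * (kap P Q1 * ell Q1 + kap P Q1 * shifted P Q1 +
      kap P Q1 * (shifted P P' + A' (doubly P P') + A' ell)).
    transitivity (c * (kap P Q1 * ((ell Q1 + shifted P Q1 + shifted P P') *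
        (\sum_Q2 kap P' Q2) + A' (doubly P P') + A' ell))); last by rewrite kap1 //; ring.
    rewrite mulr_sumr -!big_split !mulr_sumr; apply: eq_bigr => Q2 _ /=; ring.
  rewrite (eq_bigr _ (fun Q1 _ => inner Q1)) -mulr_sumr !big_split /= -mulr_suml kap1 // mul1r.
  by rewrite -!/(A _); ring.
rewrite ler_wpM2l ?divr_ge0 ?(ltW N_gt0) // !lerD //.
- exact: kap_sum.
- apply: le_trans (kap_sum P1 P0 (shifted_ge0 P)) _.
  rewrite ler_wpM2l //; apply: ler_sumW => // Q; exact: (fun h => proj2 (andP h)).
(* For P' in X0 the row of [kap] is the point mass at P', and the leg from P' + S to Q2 + S has
   length zero. *)
- have [P0'|P0'] := boolP (P' \in X0).
    rewrite /A' (bigD1 P') //= big1 => [|Q /negbTE QP]; last by rewrite kap_stay // QP mul0r.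
    rewrite addr0 /doubly big1 ?mulr0 => [|Q _]; last by rewrite subrr expr0n.
    by apply: mulr_ge0 => //; apply: sumr_ge0 => Q _; exact: doubly_ge0.
  apply: le_trans (kap_sum P1' P0' (doubly_ge0 P P')) _.
  rewrite ler_wpM2l //; apply: ler_sumW => // Q; exact: (fun h => proj2 (andP h)).
have [P0'|P0'] := boolP (P' \in X0); last by rewrite add0r; exact: kap_sum.
rewrite /A' (bigD1 P') //= big1 => [|Q /negbTE QP]; last by rewrite kap_stay // QP mul0r.
by rewrite kap_stay // eqxx mul1r addr0 lerDl mulr_ge0.
Qed.

Let sum_ext (g : {set X} -> {set X} -> R) : (forall P Q, 0 <= g P Q) ->
  \sum_(P in X1 | P \notin X0) \sum_(P' in X1 | loc P P') g P P' <=
  \sum_(P : {set X}) \sum_(P' | loc P P') g P P'.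
Proof.
move=> g0; apply: le_trans (_ : \sum_(P in X1 | P \notin X0) \sum_(P' | loc P P') g P P' <= _).
  by apply: ler_sum => P _; apply: ler_sumW => // P' /andP[].
by apply: ler_sumW => // P; exact: sumr_ge0.
Qed.

(** Four of the six sums are averages over [kap] and cost eta d^2 each. The other two, from
    [shifted P P'] and from [ell P'] with P' in X0, cost d each. *)
Let exact_energy :
  \sum_(P in X1 | P \notin X0) \sum_(P' in X1 | loc P P')
    (extension f P - extension f P') ^+ 2 <=
  5 / N * (4 * eta * d%:R ^+ 2 + 2 * d%:R) * E0.
Proof.
pose g P P' := eta * near_ell P +
    eta * (\sum_(Q | loc P Q) shifted P Q) + shifted P P' +
    eta * (\sum_(Q | loc P' Q) doubly P P' Q) +
    ((if P' \in X0 then ell P' else 0) + eta * near_ell P').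
have if_ge0 P' : 0 <= if P' \in X0 then ell P' else 0 by case: ifP.
have g0 P P' : 0 <= g P P'.
  by rewrite /g !addr_ge0 ?mulr_ge0 //; apply: sumr_ge0.
apply: le_trans (_ : \sum_(P in X1 | P \notin X0) \sum_(P' in X1 | loc P P')
   5 / N * g P P' <= _).
  apply: ler_sum => P /andP[P1 P0]; apply: ler_sum => P' /andP[P1' PP'].
  exact: detour_sum.
apply: le_trans (sum_ext _) _; first by move=> P P'; rewrite mulr_ge0 ?divr_ge0 ?(ltW N_gt0).
under eq_bigr => P _ do rewrite -mulr_sumr.
rewrite -mulr_sumr -mulrA ler_wpM2l ?divr_ge0 ?(ltW N_gt0) //.
under eq_bigr => P _ do rewrite !big_split /=.
rewrite !big_split /=.
have d0 : 0 <= d%:R :> R by [].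
have h1 : \sum_(P : {set X}) \sum_(P' | loc P P') eta * near_ell P <= eta * (d%:R * (d%:R * E0)).
  apply: le_trans (_ : \sum_(P : {set X}) d%:R * (eta * near_ell P) <= _).
    by apply: ler_sum => P _; apply: sum_loc_const; exact: mulr_ge0.
  rewrite -mulr_sumr -mulr_sumr mulrCA ler_wpM2l // ler_wpM2l //.
have h2 : \sum_(P : {set X}) \sum_(P' | loc P P') eta * (\sum_(Q | loc P Q) shifted P Q)
    <= eta * (d%:R * (d%:R * E0)).
  apply: le_trans (_ : \sum_(P : {set X}) d%:R * (eta * (\sum_(Q | loc P Q) shifted P Q)) <= _).
    by apply: ler_sum => P _; apply: sum_loc_const; rewrite mulr_ge0 // sumr_ge0.
  by rewrite -mulr_sumr -mulr_sumr mulrCA ler_wpM2l // ler_wpM2l.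
have h4 : \sum_(P : {set X}) \sum_(P' | loc P P') eta * (\sum_(Q | loc P' Q) doubly P P' Q)
    <= eta * (d%:R * (d%:R * E0)).
  under eq_bigr => P _ do rewrite -mulr_sumr.
  by rewrite -mulr_sumr ler_wpM2l // mulrA -expr2.
have h5 : \sum_(P : {set X}) \sum_(P' | loc P P') (if P' \in X0 then ell P' else 0) <= d%:R * E0.
  apply: le_trans (sum_loc predT if_ge0) _.
  by rewrite -big_mkcond.
have h6 : \sum_(P : {set X}) \sum_(P' | loc P P') eta * near_ell P' <= eta * (d%:R * (d%:R * E0)).
  under eq_bigr => P _ do rewrite -mulr_sumr.
  rewrite -mulr_sumr ler_wpM2l //; apply: le_trans (sum_loc predT near_ell_ge0) _.
  by rewrite ler_wpM2l.
have := sum_shifted; nra.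
Qed.

(** A local pair inside X1 lies in X0 or has an end in the new layer. Counting the latter pairs in
    both orders doubles the 5 of the five-leg detour. *)
Lemma energy_extension :
  energy X1 (extension f) <= (1 + 10 / N * (4 * eta * d%:R ^+ 2 + 2 * d%:R)) * energy X0 f.
Proof.
pose g P Q := (extension f P - extension f Q) ^+ 2.
have g0 P Q : 0 <= g P Q by exact: sqr_ge0.
have conv (A : pred {set X}) (C : rel {set X}) : \sum_(P | A P) \sum_(Q | C P Q) g P Q =
    \sum_P \sum_Q (if A P && C P Q then g P Q else 0).
  rewrite big_mkcond; apply: eq_bigr => P _; case: (A P) => /=; first by rewrite big_mkcond.
  by rewrite big1.
pose ex P := (P \in X1) && (P \notin X0).
pose hx P Q := if ex P && ((Q \in X1) && loc P Q) then g P Q else 0.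
apply: le_trans (_ : \sum_(P in X0) \sum_(Q in X0 | loc P Q) g P Q +
    (\sum_P \sum_Q hx P Q + \sum_P \sum_Q hx Q P) <= _).
  rewrite /energy !conv -!big_split ler_sum // => P _; rewrite -!big_split ler_sum // => Q _.
  rewrite /hx /ex /= [loc Q P]loc_sym [g Q P](_ : _ = g P Q); last by rewrite /g -sqrrN opprB.
  have := subsetP X01 P; have := subsetP X01 Q; have := g0 P Q.
  case: (P \in X1); case: (Q \in X1); case: (P \in X0); case: (Q \in X0) => //= gPQ hQ hP;
    first [by have := hQ isT | by have := hP isT | case: loc => //=; lra].
rewrite [X in _ + (_ + X)]exchange_big /=.
have -> : \sum_(P in X0) \sum_(Q in X0 | loc P Q) g P Q = E0.
  by apply: eq_bigr => P P0; apply: eq_bigr => Q /andP[Q0 _]; rewrite /g !extensionE.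
have := exact_energy; rewrite -/(g _ _) conv -/E0 -/(ex _) => h.
have {}h : \sum_P \sum_Q hx P Q <= 5 / N * (4 * eta * d%:R ^+ 2 + 2 * d%:R) * E0 by [].
lra.
Qed.

End Energy.

(** A row of total weight 1 is spread over neighbours in X0 with weight at most eta each, and every
    element of X0 has at most d neighbours. *)
Lemma card_layer : (\sum_(P in X1 | P \notin X0) 1 : R) <= eta * (d * #|X0|)%N%:R.
Proof.
apply: le_trans (_ : \sum_(P in X1 | P \notin X0) \sum_(Q in X0 | loc P Q) eta <= _).
  apply: ler_sum => P /andP[P1 P0]; rewrite -(kap1 P1) [X in _ <= X]big_mkcond.
  by apply: ler_sum => Q _; exact: kap_move.
apply: le_trans (_ : \sum_(P : {set X}) \sum_(Q in X0 | loc P Q) eta <= _).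
  by apply: ler_sumW => // P; exact: sumr_ge0.
apply: le_trans (sum_loc (mem X0) (fun=> eta_ge0)) _.
by rewrite sumr_const natrM -[eta *+ _]mulr_natl; lra.
Qed.

End Extension.

(** * Local reductions of graph partitions *)

Section LocalReductions.
Variables (G : sgraph) (B : nat).
Implicit Types (P Q T : {set {set G}}).

(** A block that changes either meets W, or lies in a strictly larger block of the other partition
    whose additional vertices are in W. Either way it lies within distance B of a vertex of W, and W
    lies within distance K of any of its vertices. *)
Lemma local_reduction_loc K q P Q : P \in Omega G q B -> Q \in local_reductions K q B P ->
  loc (K + B) P Q.
Proof.
rewrite in_Omega => /andP[vP _]; rewrite inE in_Omega => /andP[/andP[vQ _]].
case/andP=> QP /existsP[W /and3P[cW WK /existsP[f /existsP[g /and3P[/eqP Pf /eqP Qg /forallP fg]]]]].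
have {}fg v : v \notin W -> f v = g v by move=> vW; apply/eqP/(implyP (fg v)).
(* If W were empty the labellings would coincide, whereas Q has fewer blocks than P. *)
have [v vW] : exists v, v \in W.
  apply/set0Pn; apply: contraTneq QP => W0.
  suff E : f = g by rewrite Pf Qg E ltnn.
  by apply/ffunP => v; apply: fg; rewrite W0 inE.
have block_ball P' (A : {set G}) w : valid B P' -> A \in P' -> w \in A -> A \subset ball w B.
  case/and3P=> _ /forallP/(_ A)/implyP cA /forallP/(_ A)/implyP sA AP wA.
  exact: subset_trans (connected_ball (cA AP) wA) (ball_mono _ (sA AP)).
have far_ball w (A : {set G}) : w \in W -> A \subset ball w B -> A \subset ball v (K + B).
  move=> wW Aw; apply/subsetP => x /(subsetP Aw); apply: ball_trans.
  exact: (subsetP (ball_mono v WK) _ (subsetP (connected_ball cW vW) _ wW)).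
have moved P1 P2 (f1 f2 : {ffun G -> 'I_q}) (A : {set G}) : valid B P1 -> valid B P2 ->
    P1 = preim_partition f1 [set: G] -> P2 = preim_partition f2 [set: G] ->
    (forall u, u \notin W -> f1 u = f2 u) -> A \in P1 -> A \notin P2 -> A \subset ball v (K + B).
  move=> v1 v2 E1 E2 f12 A1 A2.
  have [p1 p2] : partition P1 [set: G] /\ partition P2 [set: G].
    by case/and3P: v1; case/and3P: v2.
  have [/pred0Pn[w /andP[/= wA wW]]|AW] := boolP (~~ [disjoint A & W]).
    exact: far_ball wW (block_ball _ _ _ v1 A1 wA).
  rewrite negbK in AW.
  have [x xA] := block_inhabited p1 A1.
  have AE : A = [set y | f1 y == f1 x] by rewrite -mem_preim_partition -E1 (pblock_eq p1 A1).
  have fx : f1 x = f2 x by rewrite f12 // (disjointFr AW xA).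
  pose C := [set y | f2 y == f2 x].
  have C2 : C \in P2 by rewrite /C -mem_preim_partition -E2 pblock_in.
  have AsubC : A \subset C.
    apply/subsetP => y yA; rewrite inE -fx -f12 ?(disjointFr AW yA) //.
    by move: yA; rewrite AE inE.
  have [w wC wA] : exists2 w, w \in C & w \notin A.
    by apply/subsetPn; apply: contra A2 => CA; rewrite (_ : A = C) //; apply/eqP; rewrite eqEsubset AsubC.
  have wW : w \in W.
    apply: contraR wA => wW; by move: wC; rewrite /C AE !inE -fx (f12 _ wW).
  exact: (subset_trans AsubC (far_ball _ _ wW (block_ball _ _ _ v2 C2 wC))).
apply/existsP; exists v; apply/subsetP => A; rewrite inE [_ \in powerset _]inE.
case AP: (A \in P); case AQ: (A \in Q) => //= _.
  by apply: (moved P Q f g); rewrite ?AQ.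
by apply: (moved Q P g f); rewrite ?AP // => u /fg.
Qed.

End LocalReductions.

Section GraphExtension.
Variables (R : realType) (G : sgraph) (B K b : nat) (delta0 : R).
Implicit Types (P Q T : {set {set G}}).
Let r := (K + B)%N.
Let beta := (2 ^ 2 ^ b)%N.
Hypotheses (delta0_gt0 : 0 < delta0) (card_b : forall v : G, (#|ball v r| <= b)%N).
Hypothesis G_large : (3 * b * b * beta)%N%:R <= delta0 * #|G|%:R / 2.
Hypothesis G_gt0 : (0 < #|G|)%N.

(** The factor of [energy_extension] for N = delta0 n / 2, eta = 1 / (delta0 n) and d = n [beta],
    where all powers of n cancel. *)
Definition layer_const : R := 1 + 20 / delta0 * (4 * beta%:R ^+ 2 / delta0 + 2 * beta%:R).

Section OneLayer.
Variable k : nat.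
Hypothesis reductions : forall P, P \in Omega G k.+1 B -> #|P| = k.+1 ->
  delta0 * #|G|%:R <= #|local_reductions K k.+1 B P|%:R.

Let red P := local_reductions K k.+1 B P.
Let X0 := Omega G k B.
Let X1 := Omega G k.+1 B.
Let eta : R := (delta0 * #|G|%:R)^-1.
Let kap P Q : R := if P \in X0 then (Q == P)%:R else if Q \in red P then (#|red P|%:R)^-1 else 0.
Let region P P' Q1 Q2 := cover (P :\: Q1) :|: cover (P :\: P') :|: cover (P' :\: Q2).
Let far P P' Q1 Q2 := [set Q3 in red P | [disjoint cover (P :\: Q3) & region P P' Q1 Q2]].

Let dn_gt0 : 0 < delta0 * #|G|%:R. Proof. by rewrite mulr_gt0 // ltr0n. Qed.
Let eta_ge0 : 0 <= eta. Proof. by rewrite invr_ge0 ltW. Qed.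

Let X01 : X0 \subset X1.
Proof. by apply/subsetP => P; rewrite !in_Omega => /andP[-> /leqW]. Qed.

Let exactE P : P \in X1 -> P \notin X0 -> #|P| = k.+1.
Proof. by rewrite !in_Omega => /andP[-> Pk] /= Pk'; apply/eqP; rewrite eqn_leq Pk ltnNge Pk'. Qed.

Let card_red P : P \in X1 -> P \notin X0 -> delta0 * #|G|%:R <= #|red P|%:R.
Proof. by move=> P1 P0; apply: reductions => //; exact: exactE. Qed.

Let red_X0 P Q : P \in X1 -> Q \in red P -> (Q \in X0) && loc r P Q.
Proof.
move=> P1 QP; rewrite (local_reduction_loc P1 QP) andbT.
move: P1; rewrite in_Omega => /andP[_ Pk].
move: QP; rewrite inE in_Omega => /andP[/andP[vQ _] /andP[QP _]].
by rewrite in_Omega vQ -ltnS (leq_trans QP).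
Qed.

Let kap_ge0 P Q : 0 <= kap P Q.
Proof. by rewrite /kap; case: ifP => // _; case: ifP => //; rewrite invr_ge0. Qed.

Let kap1 P : P \in X1 -> \sum_Q kap P Q = 1.
Proof.
rewrite /kap => P1; have [P0|P0] := boolP (P \in X0).
  by rewrite (bigD1 P) //= eqxx big1 ?addr0 // => Q /negbTE ->.
rewrite -big_mkcond sumr_const -[_ *+ _]mulr_natl divff // gt_eqF //.
exact: lt_le_trans (card_red P1 P0).
Qed.

Let kap_stay P Q : P \in X0 -> kap P Q = (Q == P)%:R.
Proof. by rewrite /kap => ->. Qed.

Let kap_move P Q : P \in X1 -> P \notin X0 ->
  kap P Q <= if (Q \in X0) && loc r P Q then eta else 0.
Proof.
move=> P1 P0; rewrite /kap (negbTE P0); case: ifP => [QP|_]; last by case: ifP.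
rewrite (red_X0 P1 QP) lef_pV2 ?posrE //; first exact: card_red.
exact: lt_le_trans (card_red P1 P0).
Qed.

Let card_region P P' Q1 Q2 : P \in X1 -> P' \in X1 ->
  loc r P P' -> kap P Q1 != 0 -> kap P' Q2 != 0 ->
  (#|region P P' Q1 Q2| <= 3 * b)%N.
Proof.
have side T U : T \in X1 -> kap T U != 0 -> (#|cover (T :\: U)| <= b)%N.
  move=> T1; rewrite /kap; case: ifP => [_|_].
    by rewrite pnatr_eq0 eqb0 negbK => /eqP ->; rewrite setDv /cover big_set0 cards0.
  case: ifP => [UT _|]; last by rewrite eqxx.
  by apply: (card_cover_loc (r := r)) => //; case/andP: (red_X0 T1 UT).
move=> P1 P1' PP' k1 k2; rewrite /region.
rewrite (_ : 3 * b = b + b + b)%N; last by ring.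
apply: leq_trans (leq_card_setU _ _) (leq_add _ (side _ _ P1' k2)).
apply: leq_trans (leq_card_setU _ _) (leq_add (side _ _ P1 k1) _).
exact: card_cover_loc PP'.
Qed.

(** By disjointness, T retains all blocks of P that the surgery removes, so the surgery applies to
    T. It lowers the number of blocks, which was at most k + 1. *)
Let surgery_X0 P Q3 T : P \in X1 -> Q3 \in red P -> T \in X1 ->
  [disjoint cover (P :\: Q3) & cover (P :\: T)] -> symdiff T (symdiff P Q3) \in X0.
Proof.
rewrite !in_Omega => /andP[vP _]; rewrite inE in_Omega => /andP[/andP[vQ _] /andP[QP _]].
case/andP=> vT Tk dis.
have PT : P :\: Q3 \subset T.
  apply/subsetP => A AP; apply: contraTT dis => AT.
  have AP' : A \in P by move: AP; rewrite inE => /andP[].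
  have pP : partition P [set: G] by case/and3P: vP.
  have [x xA] := block_inhabited pP AP'.
  apply/pred0Pn; exists x; apply/andP; split; apply/bigcupP; exists A => //.
  by rewrite inE AT.
rewrite (valid_surgery vP vQ vT PT) -ltnS -(ltn_add2r #|P|) (card_surgery vP vQ vT PT).
by apply: leq_ltn_trans (leq_add Tk (leqnn _)) _; rewrite ltn_add2l.
Qed.

(** The region has at most 3 b vertices, so at most 3 b * b * [beta] local moves touch it. By
    [G_large] this is at most half of the lower bound on the number of reductions, and the rest are
    far. *)
Let far_spec P P' Q1 Q2 :
  P \in X1 -> P \notin X0 -> P' \in X1 -> loc r P P' -> kap P Q1 != 0 -> kap P' Q2 != 0 ->
  delta0 * #|G|%:R / 2 <= #|far P P' Q1 Q2|%:R /\
  forall Q3, Q3 \in far P P' Q1 Q2 ->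
    [/\ loc r P Q3, Q3 \in X0, symdiff Q1 (symdiff P Q3) \in X0, symdiff P' (symdiff P Q3) \in X0 &
        symdiff Q2 (symdiff P Q3) \in X0].
Proof.
move=> P1 P0 P1' PP' k1 k2.
have kX1 T U : T \in X1 -> kap T U != 0 -> U \in X1.
  move=> T1; rewrite /kap; case: ifP => [_|_].
    by rewrite pnatr_eq0 eqb0 negbK => /eqP ->.
  case: ifP => [UT _|]; last by rewrite eqxx.
  by apply: (subsetP X01); case/andP: (red_X0 T1 UT).
split.
  have : (#|red P| <= #|far P P' Q1 Q2| + 3 * b * b * beta)%N.
    rewrite -(cardsID [set Q3 | [disjoint cover (P :\: Q3) & region P P' Q1 Q2]] (red P)).
    apply: leq_add.
      by apply/subset_leq_card/subsetP => Q; rewrite !inE.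
    apply: leq_trans (_ : #|region P P' Q1 Q2| * b * beta <= _)%N; last first.
      by rewrite !leq_mul2r card_region ?orbT.
    apply: leq_trans (card_moves_meeting card_b P _).
    apply/subset_leq_card/subsetP => Q; rewrite in_setD inE => /andP[dQ QP].
    by rewrite inE dQ andbT; case/andP: (red_X0 P1 QP).
  rewrite -(ler_nat R) natrD; have := G_large; have := card_red P1 P0.
  move: #|_|%:R (_ * _)%:R #|_|%:R (delta0 * _) => x y z t; lra.
move=> Q3; rewrite inE => /andP[QP dis].
have [d1 d2 d3] : [/\ [disjoint cover (P :\: Q3) & cover (P :\: Q1)],
    [disjoint cover (P :\: Q3) & cover (P :\: P')] &
    [disjoint cover (P :\: Q3) & cover (P' :\: Q2)]].
  split; apply: disjointWr dis; rewrite /region ?subsetUr // -setUA ?subsetUl //.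
  by rewrite setUCA subsetUl.
have /andP[Q0 PQ] := red_X0 P1 QP; split=> //; apply: surgery_X0 => //.
- exact: kX1 k1.
- exact: kX1 k2.
(* A block of P that is missing in Q2 was lost on the way from P to P' or from P' to Q2; both losses
   belong to the region. *)
apply/pred0P => x; apply/negP => /andP[/= x3 /bigcupP[A]].
rewrite inE => /andP[A2 AP] xA.
have [AP'|AP'] := boolP (A \in P').
  have : x \in cover (P' :\: Q2) by apply/bigcupP; exists A => //; rewrite inE A2.
  by rewrite (disjointFr d3 x3).
have : x \in cover (P :\: P') by apply/bigcupP; exists A => //; rewrite inE AP'.
by rewrite (disjointFr d2 x3).
Qed.

Lemma energy_layer f : exists2 g, {in Omega G k B, g =1 f} &
  energy (loc r) (Omega G k.+1 B) g <= layer_const * energy (loc r) (Omega G k B) f.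
Proof.
exists (extension kap f); first by move=> P PX; apply: extensionE PX.
have N0 : 0 < delta0 * #|G|%:R / 2 by rewrite divr_gt0.
apply: le_trans (energy_extension (@loc_sym G r) (@loc_symdiff G r) (card_loc card_b) X01
  eta_ge0 N0 kap_ge0 kap1 kap_stay kap_move far_spec f) _.
rewrite ler_wpM2r //; first by apply: sumr_ge0 => P _; apply: sumr_ge0 => Q _; exact: sqr_ge0.
rewrite /layer_const /eta natrM -/beta.
have n0 : #|G|%:R != 0 :> R by rewrite pnatr_eq0 -lt0n.
rewrite le_eqVlt; apply/orP; left; apply/eqP; field.
by rewrite n0 gt_eqF.
Qed.

Lemma card_next_layer : #|Omega G k.+1 B|%:R <= layer_const * #|Omega G k B|%:R.
Proof.
have := card_layer (@loc_sym G r) (card_loc card_b) eta_ge0 kap1 kap_move.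
have -> : (\sum_(P in X1 | P \notin X0) 1 : R) = #|X1|%:R - #|X0|%:R.
  rewrite sumr_const (_ : #|_| = #|X1 :\: X0|); last by apply: eq_card => P; rewrite in_setD andbC.
  rewrite cardsD (setIidPr X01) natrB //; exact: subset_leq_card X01.
rewrite /eta -/beta !natrM.
have n0 : #|G|%:R != 0 :> R by rewrite pnatr_eq0 -lt0n.
have -> : (delta0 * #|G|%:R)^-1 * (#|G|%:R * beta%:R * #|X0|%:R) = beta%:R / delta0 * #|X0|%:R.
  by field; rewrite n0 gt_eqF.
rewrite -/X0 -/X1 /layer_const => h.
have h1 : 0 <= beta%:R / delta0 by rewrite divr_ge0 // ltW.
have h2 : 0 <= (beta%:R / delta0) ^+ 2 by rewrite exprn_ge0.
have -> : 1 + 20 / delta0 * (4 * beta%:R ^+ 2 / delta0 + 2 * beta%:R) =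
  1 + beta%:R / delta0 + (80 * (beta%:R / delta0) ^+ 2 + 39 * (beta%:R / delta0)).
  by field; rewrite gt_eqF.
have : 0 <= #|X0|%:R :> R by [].
nra.
Qed.

End OneLayer.

Lemma layer_const_ge1 : 1 <= layer_const.
Proof.
rewrite lerDl mulr_ge0 ?divr_ge0 ?(ltW delta0_gt0) // addr_ge0 // ?mulr_ge0 //.
by rewrite invr_ge0 ltW.
Qed.

Lemma energy_layers q f :
  (forall k P, (q <= k)%N -> P \in Omega G k B -> #|P| = k ->
    delta0 * #|G|%:R <= #|local_reductions K k B P|%:R) ->
  forall s, exists g, [/\ {in Omega G q B, g =1 f},
    energy (loc r) (Omega G (q + s) B) g <= layer_const ^+ s * energy (loc r) (Omega G q B) f &
    #|Omega G (q + s) B|%:R <= layer_const ^+ s * #|Omega G q B|%:R].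
Proof.
move=> red; elim=> [|s [g [gf gE gC]]].
  by exists f; rewrite addn0 expr0 !mul1r.
have red' P : P \in Omega G (q + s).+1 B -> #|P| = (q + s).+1 ->
    delta0 * #|G|%:R <= #|local_reductions K (q + s).+1 B P|%:R.
  by apply: red; rewrite -addnS leq_addr.
have [h hg hE] := energy_layer red' g.
have c0 : 0 <= layer_const by apply: le_trans layer_const_ge1.
exists h; split.
- move=> P PX; rewrite -(gf P PX) hg //.
  by move: PX; rewrite !in_Omega => /andP[-> /leq_trans -> //]; rewrite leq_addr.
- rewrite addnS exprS -mulrA; apply: le_trans hE _.
  by rewrite ler_wpM2l.
rewrite addnS exprS -mulrA; apply: le_trans (card_next_layer red') _.
by rewrite ler_wpM2l.
Qed.

End GraphExtension.

(** * Paths between partitions *)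

Section Mixture.
Local Open Scope nat_scope.
Variables (G : sgraph) (B : nat).
Hypothesis B_gt0 : 0 < B.
Implicit Types (X Y : {set {set G}}) (S A : {set G}).

(** A block cut by S dissolves into singletons, since its part on one side need not be connected. *)
Definition mix_block X Y S (u : G) : {set G} :=
  if u \in S then (if pblock Y u \subset S then pblock Y u else [set u])
  else (if pblock X u \subset ~: S then pblock X u else [set u]).

Definition mix X Y S : {set {set G}} := [set mix_block X Y S u | u : G].

(** A connected block with at most B vertices lies in the B-ball of each of its vertices. So outside
    this zone the blocks of a vertex in X and in Y stay on its own side of S. *)
Definition edge_zone S : {set G} :=
  [set u | ~~ (ball u B \subset S) && ~~ (ball u B \subset ~: S)].

Lemma block_sub_ball X u : valid B X -> pblock X u \subset ball u B.
Proof.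
case/and3P=> pX /forallP/(_ (pblock X u))/implyP/(_ (pblock_in pX u)) cX.
move=> /forallP/(_ (pblock X u))/implyP/(_ (pblock_in pX u)) sX.
exact: subset_trans (connected_ball cX (mem_own_pblock pX u)) (ball_mono u sX).
Qed.

Section Pair.
Variables (X Y : {set {set G}}).
Hypotheses (vX : valid B X) (vY : valid B Y).

Let pX : partition X [set: G]. Proof. by case/and3P: vX. Qed.
Let pY : partition Y [set: G]. Proof. by case/and3P: vY. Qed.

Lemma mix_partition S :
  partition (mix X Y S) [set: G] /\ pblock (mix X Y S) =1 mix_block X Y S.
Proof.
apply: partition_blocks => [u|u v].
  by rewrite /mix_block; case: ifP => _; case: ifP => _; rewrite ?set11 ?mem_own_pblock.
have same Z (pZ : partition Z [set: G]) : v \in pblock Z u -> pblock Z v = pblock Z u.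
  by apply: pblock_eq => //; exact: pblock_in.
rewrite /mix_block; case: ifP => uS; case: ifP => sub; rewrite ?inE.
- by move=> vu; rewrite (subsetP sub _ vu) (same Y) // sub.
- by move=> /eqP ->; rewrite uS sub.
- by move=> vu; have := subsetP sub _ vu; rewrite inE => /negbTE ->; rewrite (same X) // sub.
- by move=> /eqP ->; rewrite uS sub.
Qed.

Lemma mix_block_sub_ball S u : mix_block X Y S u \subset ball u B.
Proof.
by rewrite /mix_block; case: ifP => _; case: ifP => _; rewrite ?block_sub_ball // sub1set ball_center.
Qed.

Lemma valid_mix S : valid B (mix X Y S).
Proof.
have [pM bM] := mix_partition S.
have good u : connected_set (mix_block X Y S u) && (#|mix_block X Y S u| <= B).
  have sing : connected_set [set u] && (#|[set u]| <= B).
    rewrite cards1 B_gt0 andbT; apply/forallP => a; apply/implyP => /set1P ->.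
    by apply/forallP => c; apply/implyP => /set1P ->; exact: connect0.
  rewrite /mix_block; case: ifP => _; case: ifP => _ //.
    case/and3P: vY => _ /forallP/(_ (pblock Y u))/implyP/(_ (pblock_in pY u)) ->.
    by move=> /forallP/(_ (pblock Y u))/implyP/(_ (pblock_in pY u)) ->.
  case/and3P: vX => _ /forallP/(_ (pblock X u))/implyP/(_ (pblock_in pX u)) ->.
  by move=> /forallP/(_ (pblock X u))/implyP/(_ (pblock_in pX u)) ->.
apply/and3P; split=> //; apply/forallP => A; apply/implyP => /imsetP[u _ ->];
  by case/andP: (good u).
Qed.

Lemma mix_set0 : mix X Y set0 = X.
Proof.
have [pM bM] := mix_partition set0; apply: eq_partition => // u.
by rewrite bM /mix_block inE setC0 subsetT.
Qed.

Lemma mix_setT : mix X Y [set: G] = Y.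
Proof.
have [pM bM] := mix_partition [set: G]; apply: eq_partition => // u.
by rewrite bM /mix_block inE subsetT.
Qed.

(** Whether a block fits into S or its complement depends on v only if the block contains v. So
    every block that changes comes from a block of X or Y through v, or is the block of v in a
    mixture; all these lie in the B-ball of v. *)
Lemma loc_mix r S S' v : B <= r -> (forall u, u != v -> (u \in S) = (u \in S')) ->
  loc r (mix X Y S) (mix X Y S').
Proof.
move=> Br; move: S S'.
suff sub S S' A : (forall u, u != v -> (u \in S) = (u \in S')) ->
    A \in mix X Y S -> A \notin mix X Y S' -> A \subset ball v r.
  move=> S S' SS'; apply/existsP; exists v; apply/subsetP => A.
  rewrite inE [_ \in powerset _]inE.
  case AP: (A \in mix X Y S); case AQ: (A \in mix X Y S') => //= _.
    by apply: (sub S S' A SS' AP); rewrite AQ.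
  by apply: (sub S' S A _ AQ); rewrite ?AP // => u uv; rewrite SS'.
move=> SS' /imsetP[u _ ->] nA; apply: subset_trans (ball_mono v Br).
have {nA} neq : mix_block X Y S u != mix_block X Y S' u.
  by apply: contraNneq nA => ->; exact: imset_f.
have [<-|uv] := eqVneq u v; first exact: mix_block_sub_ball.
have through Z : valid B Z -> v \in pblock Z u -> pblock Z u \subset ball v B.
  move=> vZ vu; have pZ : partition Z [set: G] by case/and3P: vZ.
  by rewrite -(pblock_eq pZ (pblock_in pZ u) vu) block_sub_ball.
have same (C : {set G}) : v \notin C -> (C \subset S) = (C \subset S') /\ (C \subset ~: S) = (C \subset ~: S').
  move=> vC; have eqC w : w \in C -> (w \in S) = (w \in S').
    by move=> wC; apply: SS'; apply: contraNneq vC => <-.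
  by split; apply/subsetP/subsetP => h w wC; have := h w wC; rewrite ?inE ?eqC // -?eqC.
have one Z : valid B Z -> v \in pblock Z u -> [set u] \subset ball v B.
  move=> vZ vu; apply: subset_trans (through Z vZ vu); rewrite sub1set mem_own_pblock //.
  by case/and3P: vZ.
move: neq; rewrite /mix_block -(SS' u uv); case: (u \in S).
  have [vYu|vYu] := boolP (v \in pblock Y u).
    by case: ifP => _ _; [exact: through | exact: one vY vYu].
  by have [-> _] := same _ vYu; rewrite eqxx.
have [vXu|vXu] := boolP (v \in pblock X u).
  by case: ifP => _ _; [exact: through | exact: one vX vXu].
by have [_ ->] := same _ vXu; rewrite eqxx.
Qed.

Lemma mix_block_inner S u : u \notin edge_zone S ->
  mix_block X Y S u = if u \in S then pblock Y u else pblock X u.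
Proof.
rewrite inE negb_and !negbK /mix_block => zone; case: ifP => uS.
  case/orP: zone => [bS|/subsetP/(_ u (ball_center u B))]; last by rewrite inE uS.
  by rewrite (subset_trans (block_sub_ball u vY) bS).
case/orP: zone => [/subsetP/(_ u (ball_center u B))|bS]; first by rewrite uS.
by rewrite (subset_trans (block_sub_ball u vX) bS).
Qed.

End Pair.

Section Counting.
Variable s : G -> nat.
Hypothesis s_inj : injective s.

(** One marked vertex per block turns the number of blocks into a sum over vertices, which can be
    split along S. *)
Definition leader X (v : G) : bool := [forall u in pblock X v, s v <= s u].

Lemma leader_exists X u : partition X [set: G] ->
  exists2 v, v \in pblock X u & leader X v.
Proof.
move=> pX; case: (arg_minnP s (mem_own_pblock pX u)) => v vu vmin; exists v => //.
apply/forallP => w; apply/implyP => wv; apply: vmin.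
by rewrite -(pblock_eq pX (pblock_in pX u) vu).
Qed.

Lemma card_leaders X : partition X [set: G] -> #|[set v | leader X v]| = #|X|.
Proof.
move=> pX; rewrite -(card_in_imset (f := pblock X)) => [|v w].
  apply: eq_card => A; apply/imsetP/idP => [[v _ ->]|AX]; first exact: pblock_in.
  have [u uA] := block_inhabited pX AX; have [v vu lv] := leader_exists u pX.
  exists v; first by rewrite inE.
  by rewrite (pblock_eq pX (pblock_in pX u) vu) (pblock_eq pX AX uA).
rewrite !inE => /forallP/(_ w)/implyP lv /forallP/(_ v)/implyP lw vw.
apply: s_inj; apply/eqP; rewrite eqn_leq; apply/andP; split; [apply: lv | apply: lw].
  by rewrite vw mem_own_pblock.
by rewrite -vw mem_own_pblock.
Qed.

(** The set T below meets every block of the mixture: a vertex outside the edge zone has an uncut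
    block of X or Y, contained in one side together with its leader. *)
Lemma card_mix X Y S : valid B X -> valid B Y ->
  #|mix X Y S| <= #|[set v in S | leader Y v]| + #|[set v in ~: S | leader X v]| + #|edge_zone S|.
Proof.
move=> vX vY; have [pM bM] := mix_partition vX vY S.
have [pX pY] : partition X [set: G] /\ partition Y [set: G].
  by case/and3P: vX; case/and3P: vY.
pose T := [set v in S | leader Y v] :|: [set v in ~: S | leader X v] :|: edge_zone S.
apply: leq_trans (_ : #|T| <= _); last first.
  by apply: leq_trans (leq_card_setU _ _) _; rewrite leq_add2r; exact: leq_card_setU.
apply: leq_trans (leq_imset_card (mix_block X Y S) T).
apply/subset_leq_card/subsetP => A /imsetP[u _ ->].
have [uz|uz] := boolP (u \in edge_zone S); first by apply: imset_f; rewrite inE uz orbT.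
have blk v : v \in mix_block X Y S u -> mix_block X Y S u = mix_block X Y S v.
  by move=> vu; rewrite -!bM (pblock_eq pM (pblock_in pM u)) ?bM.
have [v vu lv] : exists2 v, v \in mix_block X Y S u & v \in T.
  move: (uz); rewrite inE negb_and !negbK (mix_block_inner vX vY uz).
  case: ifP => uS /orP[bS|bS].
  - have [v vu lv] := leader_exists u pY; exists v => //.
    have vS := subsetP bS _ (subsetP (block_sub_ball u vY) _ vu).
    by rewrite !inE vS lv.
  - by have := subsetP bS _ (ball_center u B); rewrite inE uS.
  - by have := subsetP bS _ (ball_center u B); rewrite uS.
  have [v vu lv] := leader_exists u pX; exists v => //.
  have vS := subsetP bS _ (subsetP (block_sub_ball u vX) _ vu).
  by move: vS; rewrite !inE => ->; rewrite lv orbT.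
by rewrite (blk _ vu); exact: imset_f.
Qed.

End Counting.

Section Encoding.
Variables (b : nat) (S : {set G}).
Hypothesis card_b : forall v : G, #|ball v B| <= b.

Let code X : {ffun G -> {set G}} := [ffun u => if u \in edge_zone S then pblock X u else set0].
Let codes : {set {ffun G -> {set G}}} :=
  [set c in pfamily set0 (mem (edge_zone S)) (fun u => mem (powerset (ball u B)))].

Let card_codes : #|codes| <= 2 ^ (b * #|edge_zone S|).
Proof.
rewrite cardsE card_pfamily expnM [#|edge_zone S|]cardE.
have bound (t : seq G) : foldr muln 1 [seq #|powerset (ball u B)| | u <- t] <= (2 ^ b) ^ size t.
  elim: t => //= u t IH; rewrite expnS leq_mul //.
  by rewrite card_powerset leq_exp2l.
exact: bound.
Qed.

Let mem_code X : valid B X -> code X \in codes.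
Proof.
move=> vX; rewrite inE; apply/pfamilyP; split=> [|u uz].
  by apply/subsetP => u; rewrite unfold_in ffunE; case: ifP => //; rewrite eqxx.
by rewrite ffunE uz inE block_sub_ball.
Qed.

(* X and Y are determined by both mixtures and by their blocks at the edge zone. *)
Lemma card_mix_fibre (V W : {set {set {set G}}}) P :
  (forall X, X \in V -> valid B X) ->
  #|[set XY in setX V V | (mix XY.1 XY.2 S == P) && (mix XY.2 XY.1 S \in W)]| <=
  #|W| * 2 ^ (2 * b * #|edge_zone S|).
Proof.
move=> Vv; set fib := [set _ in _ | _].
pose enc (XY : {set {set G}} * {set {set G}}) := (mix XY.2 XY.1 S, (code XY.1, code XY.2)).
have fibV XY : XY \in fib -> [/\ valid B XY.1, valid B XY.2, mix XY.1 XY.2 S = P & mix XY.2 XY.1 S \in W].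
  by rewrite !inE => /andP[/andP[/Vv h1 /Vv h2] /andP[/eqP h3 h4]].
apply: leq_trans (_ : #|setX W (setX codes codes)| <= _); last first.
  rewrite !cardsX leq_mul2l -mulnA mul2n -addnn expnD.
  by apply/orP; right; apply: leq_mul; exact: card_codes.
rewrite -(card_in_imset (f := enc)) => [|[X Y] [X' Y'] /fibV[/= vX vY E1 _] /fibV[/= vX' vY' E1' _]].
  apply/subset_leq_card/subsetP => c /imsetP[[X Y] /fibV[/= vX vY _ mW] ->].
  by rewrite !in_setX mW !mem_code.
case=> E2 cX cY.
have pv Z : valid B Z -> partition Z [set: G] by case/and3P.
have same Z Z' : code Z = code Z' -> forall u, u \in edge_zone S -> pblock Z u = pblock Z' u.
  by move=> /ffunP cc u uz; have := cc u; rewrite !ffunE uz.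
have inner Z1 Z2 : valid B Z1 -> valid B Z2 -> forall u, u \notin edge_zone S ->
    pblock (mix Z1 Z2 S) u = if u \in S then pblock Z2 u else pblock Z1 u.
  by move=> v1 v2 u uz; have [_ ->] := mix_partition v1 v2 S; exact: mix_block_inner.
have E3 : mix X Y S = mix X' Y' S by rewrite E1.
have outer u : u \notin edge_zone S -> pblock X u = pblock X' u /\ pblock Y u = pblock Y' u.
  move=> uz; have := inner _ _ vX vY u uz; rewrite E3 inner //.
  have := inner _ _ vY vX u uz; rewrite E2 inner //.
  by case: (u \in S).
by congr pair; apply: eq_partition => [||u]; try exact: pv;
  have [uz|/outer[]] := boolP (u \in edge_zone S); try exact: same.
Qed.

End Encoding.
End Mixture.

(** * Sweeping a balanced arc around the cycle *)

Section Sweep.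
Local Open Scope nat_scope.
Variables (G : sgraph) (B w : nat) (s : G -> nat).
Hypotheses (s_inj : injective s) (s_lt : forall v, s v < #|G|).
Hypothesis s_stretch : forall x y : G, adj x y -> s x <= s y + w.
Let n := #|G|.
Let L := 2 * n.

(* For t < L and a <= 2 * L: t lies modulo L in {k, ..., a - 1}. *)
Definition on_arc (k a t : nat) : bool := (k <= t < a) || (k <= t + L < a).

Definition arc_set (k a : nat) : {set G} := [set v | on_arc k a (s v)].

Definition zone_bound : nat := 4 * (2 * (B * w)).+1.

Let card_near (t : G -> nat) c m : injective t ->
  #|[set u | (c <= t u + m) && (t u <= c + m)]| <= (2 * m).+1.
Proof.
move=> t_inj.
rewrite -(card_in_imset (f := fun u => inord (t u + m - c) : 'I_(2 * m).+1)) => [|u v].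
  by apply: leq_trans (max_card _) _; rewrite card_ord.
rewrite !inE => /andP[u1 u2] /andP[v1 v2] /(congr1 val) /=.
by rewrite !inordK => [uv||]; [apply: t_inj; lia|lia|lia].
Qed.

(** Within distance B of a zone vertex u there are vertices on the arc and off it, with labels at
    most B w away from [s u]. So [s u] or [s u + L] is within B w of k or of a: four windows of 2 B
    w + 1 labels. *)
Lemma card_edge_zone k a : #|edge_zone B (~: arc_set k a)| <= zone_bound.
Proof.
pose m := B * w; pose s' v := s v + L.
have s'_inj : injective s' by move=> u v /addIn /s_inj.
pose near (t : G -> nat) c := [set u | (c <= t u + m) && (t u <= c + m)].
apply: leq_trans (_ : #|near s k :|: near s a :|: near s' k :|: near s' a| <= _); last first.
  rewrite /zone_bound -/m (_ : 4 * _ = (2 * m).+1 + (2 * m).+1 + (2 * m).+1 + (2 * m).+1); last by ring.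
  do 3![apply: leq_trans (leq_card_setU _ _) _; apply: leq_add; last exact: card_near].
  exact: card_near.
apply/subset_leq_card/subsetP => u; rewrite inE setCK => /andP[/subsetPn[x xu]].
rewrite inE negbK => xA /subsetPn[y yu yA].
have [] := ball_stretch s_stretch xu; have [] := ball_stretch s_stretch yu.
move: xA yA; rewrite !inE /on_arc /s' -/m.
rewrite /near /m /=; move: (s x) (s y) (s u) (B * w) L => sx sy su mm LL; clear; lia.
Qed.

Definition arc := ('I_(2 * L).+1 * 'I_(2 * L).+1)%type.

Definition outside (x : arc) : {set G} := ~: arc_set x.1 x.2.

Definition neighbour_arcs : rel arc := [rel x y : arc |
    (x.2 == y.2) && ((x.1.+1 == y.1 :> nat) || (y.1.+1 == x.1 :> nat)) ||
    (x.1 == y.1) && ((x.2.+1 == y.2 :> nat) || (y.2.+1 == x.2 :> nat))].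

Section Pair.
Variables (q : nat) (X Y : {set {set G}}).
Hypotheses (B_gt0 : 0 < B) (XO : X \in Omega G q B) (YO : Y \in Omega G q B).

Let vX : valid B X. Proof. by move: XO; rewrite in_Omega => /andP[]. Qed.
Let vY : valid B Y. Proof. by move: YO; rewrite in_Omega => /andP[]. Qed.
Let pX : partition X [set: G]. Proof. by case/and3P: vX. Qed.
Let pY : partition Y [set: G]. Proof. by case/and3P: vY. Qed.

(* Next to the vertices the cycle has n padding places, which make the total weight zero. *)
Let place (j : G + 'I_n) : nat := match j with inl v => s v | inr i => n + i end.
Let diff : int := (#|X|%:Z - #|Y|%:Z)%R.
Let pad (i : nat) : int := if i < `|diff| then sgz diff else 0%R.
Let weight (j : G + 'I_n) : int :=
  match j with
  | inl v => ((leader s Y v)%:Z - (leader s X v)%:Z)%R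
  | inr i => pad i
  end.

Let e (l : nat) : int := (\sum_(j | place j == l) weight j)%R.
(** The increment along an arc is the number of leaders of Y minus that of X on the arc, plus the
    padding there: the imbalance that the climbers keep small. *)
Let F (i : nat) : int := (\sum_(0 <= l < i) e (l %% L))%R.

Let place_inj : injective place.
Proof.
move=> [u|i] [v|j] /=; first by move=> /s_inj ->.
- by have := s_lt u; rewrite -/n; lia.
- by have := s_lt v; rewrite -/n; lia.
by move=> /addnI /ord_inj ->.
Qed.

Let place_lt j : place j < L.
Proof. by case: j => [v|i] /=; [have := s_lt v|have := ltn_ord i]; rewrite /L -/n; lia. Qed.

Let card_part_le (Z : {set {set G}}) : partition Z [set: G] -> #|Z| <= n.
Proof. by move=> pZ; rewrite -(card_leaders s_inj pZ) max_card. Qed.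

Let diff_le : `|diff| <= n.
Proof. by have := card_part_le pX; have := card_part_le pY; rewrite /diff; lia. Qed.

Let sum_pad : (\sum_(i < n) pad i)%R = diff.
Proof.
rewrite -(big_mkord xpredT pad) (big_cat_nat (n := `|diff|)) //=.
have -> : (\sum_(`|diff| <= i < n) pad i = 0)%R.
  by rewrite big_nat big1 // => i /andP[hi _]; rewrite /pad ltnNge hi.
rewrite addr0 big_nat (eq_bigr (fun=> sgz diff)) => [|i /andP[_ hi]]; last by rewrite /pad hi.
rewrite -big_nat sumr_const_nat subn0 -mulr_natr.
by case: (ltrgt0P diff) => [d0|d0|->]; rewrite ?mulr0 //; [rewrite gtr0_sgz|rewrite ltr0_sgz] => //; lia.
Qed.

Let sum_weight : (\sum_j weight j)%R = 0%R.
Proof.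
rewrite big_sumType /= sum_pad sumrB.
have lead (Z : {set {set G}}) : partition Z [set: G] -> (\sum_v (leader s Z v)%:Z)%R = #|Z|%:Z.
  move=> pZ; rewrite -(card_leaders s_inj pZ) -sum1dep_card [in RHS]big_mkcond /=.
  rewrite -[RHS]/(Posz _) (big_morph Posz PoszD (erefl 0%:Z)).
  by apply: eq_bigr => v _; case: leader.
by rewrite !lead // /diff; lia.
Qed.

Let F_end : F L = 0%R.
Proof.
rewrite /F big_nat (eq_bigr e) => [|l /andP[_ lL]]; last by rewrite modn_small.
rewrite -big_nat /e (exchange_big_dep xpredT) //= -[RHS]sum_weight.
apply: eq_bigr => j _; rewrite big_mkord (bigD1 (Ordinal (place_lt j))) //= big1 ?addr0 //.
by move=> l /andP[/eqP lj]; rewrite -val_eqE /= lj eqxx.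
Qed.

Let F_period i : F (i + L) = F i.
Proof.
elim: i => [|i IH]; first by rewrite add0n F_end /F big_nil.
by rewrite addSn /F !big_nat_recr //= -/(F _) -/(F _) IH modnDr.
Qed.

Let F_step i : (`|F i.+1 - F i| <= 1)%R.
Proof.
rewrite /F big_nat_recr //= addrAC subrr add0r /e; set l := i %% L.
case: (pickP (fun j => place j == l)) => [j jl|none]; last by rewrite big_pred0.
rewrite (big_pred1 j) => [|j']; last first.
  by apply/eqP/eqP => [|-> //]; [rewrite -(eqP jl) => /place_inj | exact/eqP].
case: j {jl} => [v|k] /=; first by case: leader; case: leader.
by rewrite /pad; case: ifP => _ //; case: sgzP.
Qed.

Let arc_count k a t : k <= a -> a <= k + L -> a <= 2 * L -> t < L ->
  (\sum_(k <= l < a) (t == l %% L) = on_arc k a t)%N.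
Proof.
move=> ka akL aL tL.
have ind c : \sum_(k <= l < a) (c == l) = (k <= c < a).
  have [/andP[kc ca]|nc] := boolP (k <= c < a).
    rewrite (big_cat_nat (n := c)) //=; last exact: ltnW.
    rewrite big_nat big1 => [|l /andP[_ lc]]; last by rewrite gtn_eqF.
    rewrite big_ltn // eqxx big_nat big1 // => l /andP[cl _]; by rewrite ltn_eqF.
  rewrite big_nat big1 // => l /andP[kl la]; case: eqP => // cl.
  by rewrite cl kl la in nc.
transitivity (\sum_(k <= l < a) ((t == l) + (t + L == l))).
  rewrite big_nat [RHS]big_nat; apply: eq_bigr => l /andP[kl la].
  have [lL|Ll] := ltnP l L.
    rewrite modn_small // [t + L == l]gtn_eqF ?addn0 //.
    by apply: leq_trans lL (leq_addl _ _).
  rewrite -{1}(subnK Ll) modnDr modn_small; last by lia.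
  by rewrite [t == l]ltn_eqF ?add0n; [congr nat_of_bool; lia|apply: leq_trans tL Ll].
rewrite big_split /= !ind /on_arc; lia.
Qed.

Let F_arc k a : k <= a -> a <= k + L -> a <= 2 * L ->
  (F a - F k = \sum_j weight j * (on_arc k a (place j))%:Z)%R.
Proof.
move=> ka akL aL; rewrite /F (big_cat_nat (n := k)) //= addrAC subrr add0r /e.
rewrite (eq_bigr (fun l => \sum_j weight j * (place j == (l %% L)%N)%:Z)%R); last first.
  move=> l _; rewrite big_mkcond; apply: eq_bigr => j _.
  by case: eqP; rewrite ?mulr1 ?mulr0.
rewrite exchange_big; apply: eq_bigr => j _.
rewrite -mulr_sumr; congr (_ * _)%R.
by rewrite -(arc_count ka akL aL (place_lt j)) (big_morph Posz PoszD (erefl 0%:Z)).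
Qed.

Let card_arc (Z : {set {set G}}) k a : partition Z [set: G] ->
  #|[set v in arc_set k a | leader s Z v]| + #|[set v in ~: arc_set k a | leader s Z v]| = #|Z|.
Proof.
move=> pZ; rewrite -(card_leaders s_inj pZ) -(cardsID (arc_set k a) [set v | leader s Z v]).
by congr (_ + _); apply: eq_card => v; rewrite !inE andbC.
Qed.

(** Write the increment of F as D + E with E the share of the padding, which lies between 0 and |X|
    - |Y|. Up to the edge zone the two mixtures have at most |Y| - D <= |Y| + E + 2 and |X| + D <=
    |X| - E + 2 blocks. Both |Y| + E and |X| - E lie between |X| and |Y|, hence are at most q. *)
Let arc_mixes k a : k <= a -> a <= k + L -> a <= 2 * L -> (`|F a - F k| <= 2)%R ->
  mix X Y (~: arc_set k a) \in Omega G (q + (zone_bound + 2)) B /\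
  mix Y X (~: arc_set k a) \in Omega G (q + (zone_bound + 2)) B.
Proof.
move=> ka akL aL; rewrite F_arc // big_sumType /=.
set D := (\sum_(v : G) _)%R; set E := (\sum_(i < n) _)%R.
have DE : D = (#|[set v in arc_set k a | leader s Y v]|%:Z - #|[set v in arc_set k a | leader s X v]|%:Z)%R.
  have lead Z : #|[set v in arc_set k a | leader s Z v]|%:Z =
      (\sum_v (leader s Z v)%:Z * (on_arc k a (s v))%:Z)%R.
    rewrite -sum1dep_card [in LHS]big_mkcond /= (big_morph Posz PoszD (erefl 0%:Z)).
    by apply: eq_bigr => v _; rewrite inE; case: on_arc; case: leader.
  by rewrite !lead -sumrB; apply: eq_bigr => v _; rewrite mulrBl.
have E_range : (0 <= E <= diff)%R \/ (diff <= E <= 0)%R.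
  have padE i : pad i = 0%R \/ pad i = sgz diff by rewrite /pad; case: ifP; [right|left].
  have [d0|d0] := lerP 0%R diff; [left|right]; rewrite -{1}sum_pad /E; apply/andP; split.
  - by apply: sumr_ge0 => i _; case: (padE i) => ->; case: on_arc; case: sgzP d0.
  - by apply: ler_sum => i _; case: (padE i) => ->; case: on_arc; case: sgzP d0.
  - by apply: ler_sum => i _; case: (padE i) => ->; case: on_arc; case: sgzP d0.
  - by apply: sumr_le0 => i _; case: (padE i) => ->; case: on_arc; case: sgzP d0.
move=> DE2; have zone := card_edge_zone k a.
have cX := card_arc k a pX; have cY := card_arc k a pY.
have [hX hY] : #|X| <= q /\ #|Y| <= q.
  by move: XO YO; rewrite !in_Omega => /andP[_ ->] /andP[_ ->].
have mXY := card_mix s (~: arc_set k a) vX vY; rewrite setCK in mXY.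
have mYX := card_mix s (~: arc_set k a) vY vX; rewrite setCK in mYX.
rewrite !in_Omega !valid_mix //=.
move: mXY mYX zone cX cY hX hY DE E_range DE2; rewrite /diff.
move: (D) (E) => d1 e1.
move: #|mix X Y _| #|mix Y X _| #|edge_zone B _| zone_bound #|X| #|Y| => m1 m2 z1 z2 cx cy.
move: #|[set v in ~: _ | leader s X v]| #|[set v in ~: _ | leader s Y v]| => x0 y0.
move: #|[set v in _ | leader s X v]| #|[set v in _ | leader s Y v]| => x1 y1.
clear; lia.
Qed.

Let mixable (x : arc) := (mix X Y (outside x) \in Omega G (q + (zone_bound + 2)) B) &&
  (mix Y X (outside x) \in Omega G (q + (zone_bound + 2)) B).

Lemma sweep : 0 < n -> exists x y : arc,
  [/\ mix X Y (outside x) = X, mix X Y (outside y) = Y &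
    connect [rel x y | [&& mixable x, mixable y & neighbour_arcs x y]] x y].
Proof.
move=> n0; have L0 : 0 < L by rewrite muln_gt0.
have [i0 [m [i0L /andP[im mi] C]]] := circular_climbing L0 F_period F_step.
have [l1 l2 l3] : [/\ i0 < (2 * L).+1, i0 + L < (2 * L).+1 & m < (2 * L).+1] by split; lia.
exists (inord i0, inord (i0 + L)), (inord m, inord m); split.
(* An arc of length L covers the whole cycle, so nothing is exchanged yet; the empty arc in the next
   case exchanges everything. *)
- rewrite /outside /= !inordK //.
  rewrite (_ : ~: _ = set0) ?(mix_set0 vX vY) //; apply/setP => v; rewrite !inE /on_arc.
  by have := s_lt v; rewrite -/n; have : L = 2 * n by []; lia.
- rewrite /outside /= !inordK //.
  rewrite (_ : ~: _ = setT) ?(mix_setT vX vY) //; apply/setP => v; rewrite !inE /on_arc; lia.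
have bal x : balanced_arc F x -> mixable x.
  case: x => k a /and3P[/= ka akL Fka].
  by apply/andP; apply: arc_mixes; rewrite // -ltnS.
apply: (@connect_map _ _ _ _ id) C => x y /and3P[/bal hx /bal hy xy].
by apply: connect1; rewrite /= hx hy.
Qed.

End Pair.
End Sweep.

(** * Congestion of the sweeps *)

Section SweepEnergy.
Variables (R : realType) (G : sgraph) (B w r b : nat) (s : G -> nat) (q : nat).
Hypotheses (s_inj : injective s) (s_lt : forall v, (s v < #|G|)%N).
Hypothesis s_stretch : forall x y : G, adj x y -> (s x <= s y + w)%N.
Hypotheses (B_gt0 : (0 < B)%N) (Br : (B <= r)%N) (card_b : forall v : G, (#|ball v B| <= b)%N).
Hypothesis n_gt0 : (0 < #|G|)%N.

(** Cauchy-Schwarz along a path without repetitions. The sum is over all edges instead of those of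
    the path, so that it can later be exchanged with the sum over X and Y, whose paths differ. *)
Lemma connect_sqr (I : finType) (e : rel I) (h : I -> R) x y : connect e x y ->
  (h x - h y) ^+ 2 <= (#|I| ^ 2)%N%:R * \sum_i \sum_(j | e i j) (h i - h j) ^+ 2.
Proof.
case/connectP=> p0 p0e ->; case/shortenP: p0e => p pe up _.
pose d i := \sum_(j | e i j) `|h i - h j|.
have d0 i : 0 <= d i by apply: sumr_ge0.
have hp : `|h x - h (last x p)| <= \sum_(i <- x :: p) d i.
  elim: p x pe {up} => [|z p IH] x /=; first by rewrite subrr normr0 big_seq1.
  case/andP=> xz /IH pz; rewrite big_cons.
  apply: le_trans (ler_distD (h z) _ _) (lerD _ pz).
  by rewrite /d (bigD1 z) //= lerDl sumr_ge0.
have {}hp : `|h x - h (last x p)| <= \sum_i \sum_j (e i j)%:R * `|h i - h j|.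
  apply: le_trans hp _; rewrite (big_uniq _ up) /=.
  apply: le_trans (_ : \sum_i d i <= _).
    by rewrite [X in X <= _]big_mkcond ler_sum // => i _; case: ifP.
  apply: ler_sum => i _; rewrite /d big_mkcond; apply: ler_sum => j _.
  by case: (e i j); rewrite ?mul1r ?mul0r.
rewrite -real_normK ?num_real //.
apply: le_trans (_ : (\sum_i \sum_j (e i j)%:R * `|h i - h j|) ^+ 2 <= _).
  by rewrite ler_pXn2r ?nnegrE ?(le_trans _ hp).
rewrite pair_bigA /=; apply: le_trans (weighted_cauchy_schwarz _ _) _; first by move=> ij; exact: ler0n.
have -> : \sum_i \sum_(j | e i j) (h i - h j) ^+ 2 =
    \sum_(ij : I * I) (e ij.1 ij.2)%:R * `|h ij.1 - h ij.2| ^+ 2.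
  rewrite -(pair_bigA _ (fun i j => (e i j)%:R * `|h i - h j| ^+ 2)) /=.
  apply: eq_bigr => i _; rewrite big_mkcond; apply: eq_bigr => j _.
  by rewrite real_normK ?num_real //; case: (e i j); rewrite ?mul1r ?mul0r.
rewrite ler_wpM2r //.
  by apply: sumr_ge0 => ij _; rewrite mulr_ge0 ?sqr_ge0.
apply: le_trans (_ : \sum_(ij : I * I) 1 <= _); first by apply: ler_sum => ij _; case: (e _ _).
by rewrite sumr_const card_prod -[X in _ <= X]/(_%:R) mulnn.
Qed.

(** The two arcs differ in one place of the cycle, which holds at most one vertex. *)
Lemma neighbour_outside (x y : arc G) : neighbour_arcs x y ->
  exists v, forall u, u != v -> (u \in outside s x) = (u \in outside s y).
Proof.
have [v0 _] : exists v : G, v \in [set: G] by apply/set0Pn; rewrite -card_gt0 cardsT.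
have key c : exists v, forall u, u != v -> (s u == c) || (s u + 2 * #|G| == c)%N = false.
  case: (pickP (fun v => (s v == c) || (s v + 2 * #|G| == c)%N)) => [v vc|none]; last by exists v0.
  exists v => u uv; apply: contraNF uv => uc; apply/eqP/s_inj.
  by have := s_lt u; have := s_lt v; lia.
case: x y => [k a] [k' a'] /= /orP[|] /andP[/eqP /= eq1 /orP[|]] /eqP /= eq2.
- have [v hv] := key k; exists v => u /hv; rewrite !inE /on_arc /= -eq1 -eq2; lia.
- have [v hv] := key k'; exists v => u /hv; rewrite !inE /on_arc /= -eq1 -eq2; lia.
- have [v hv] := key a; exists v => u /hv; rewrite !inE /on_arc /= -eq1 -eq2; lia.
- have [v hv] := key a'; exists v => u /hv; rewrite !inE /on_arc /= -eq1 -eq2; lia.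
Qed.

Let Z := zone_bound B w.
Let O := Omega G q B.
Let O' := Omega G (q + (Z + 2)) B.

(** One factor [#|arc|^2] comes from Cauchy-Schwarz, the other is the number of pairs of arcs; the
    power of 2 counts the blocks of X and Y at an edge zone of size at most Z. *)
Definition sweep_const : nat := (#|{: arc G}| ^ 2) ^ 2 * 2 ^ (2 * b * Z).

Lemma pairs_le_energy (f : {set {set G}} -> R) :
  \sum_(X in O) \sum_(Y in O) (f X - f Y) ^+ 2 <=
  sweep_const%:R * #|O'|%:R * energy (loc r) O' f.
Proof.
pose ell P := \sum_(Q in O' | loc r P Q) (f P - f Q) ^+ 2.
have ell0 P : 0 <= ell P by apply: sumr_ge0 => Q _; exact: sqr_ge0.
pose ok (i : arc G) X Y := (mix X Y (outside s i) \in O') && (mix Y X (outside s i) \in O').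
pose g (i j : arc G) X Y := (f (mix X Y (outside s i)) - f (mix X Y (outside s j))) ^+ 2.
have g0 i j X Y : 0 <= g i j X Y by exact: sqr_ge0.
have vO X : X \in O -> valid B X by rewrite in_Omega => /andP[].
set N := (#|{: arc G}| ^ 2)%N.
have one i j : neighbour_arcs i j ->
    \sum_(X in O) \sum_(Y in O | ok i X Y && ok j X Y) g i j X Y <=
    (#|O'| * 2 ^ (2 * b * Z))%N%:R * energy (loc r) O' f.
  move=> ij; have [v hv] := neighbour_outside ij.
  (* Each term is charged to P = [mix X Y (outside s i)], whose [ell P] contains the move to the
     mixture for j. The pairs charged to the same P are counted by [card_mix_fibre], the opposite
     mixture ranging over O'. *)
  apply: le_trans (_ : \sum_(X in O) \sum_(Y in O) \sum_(P in O')
    (if (mix X Y (outside s i) == P) && (mix Y X (outside s i) \in O') then ell P else 0) <= _).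
    apply: ler_sum => X XO; rewrite [X in X <= _]big_mkcondr; apply: ler_sum => Y YO.
    case: ifP => [/andP[/andP[i1 i2] /andP[j1 _]]|_]; last by apply: sumr_ge0 => P _; case: ifP.
    rewrite (bigD1 _ i1) /= eqxx i2 /=.
    apply: le_trans (_ : ell (mix X Y (outside s i)) <= _); last first.
      by rewrite lerDl sumr_ge0 // => P _; case: ifP.
    rewrite /ell (bigD1 (mix X Y (outside s j))) /=; last first.
      by rewrite j1 (loc_mix (vO _ XO) (vO _ YO) Br hv).
    by rewrite lerDl sumr_ge0 // => P _; exact: sqr_ge0.
  under eq_bigr => X _ do rewrite exchange_big /=.
  rewrite exchange_big /= /energy mulr_sumr; apply: ler_sum => P PO.
  rewrite pair_big /= -big_mkcondr sumr_const -[ell P *+ _]mulr_natl ler_wpM2r ?ell0 // ler_nat.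
  apply: leq_trans (_ : #|[set XY in setX O O | (mix XY.1 XY.2 (outside s i) == P) &&
    (mix XY.2 XY.1 (outside s i) \in O')]| <= _)%N.
    by apply/subset_leq_card/subsetP => -[X Y]; rewrite unfold_in /= => h; rewrite inE in_setX.
  apply: leq_trans (card_mix_fibre _ card_b _ _ vO) _.
  rewrite leq_mul2l leq_exp2l // leq_mul2l; apply/orP; right; apply/orP; right.
  exact: card_edge_zone.
apply: le_trans (_ : \sum_(X in O) \sum_(Y in O) N%:R * \sum_i \sum_j
    (if [&& ok i X Y, ok j X Y & neighbour_arcs i j] then g i j X Y else 0) <= _).
  apply: ler_sum => X XO; apply: ler_sum => Y YO.
  have [x [y [hx hy xy]]] := sweep s_inj s_lt s_stretch B_gt0 XO YO n_gt0.
  have h := connect_sqr (fun i => f (mix X Y (outside s i))) xy; rewrite hx hy in h.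
  apply: le_trans h _; rewrite ler_wpM2l // ler_sum // => i _.
  by rewrite big_mkcond.
have swap (F : arc G -> arc G -> {set {set G}} -> {set {set G}} -> R) :
    \sum_(X in O) \sum_(Y in O) \sum_i \sum_j F i j X Y =
    \sum_i \sum_j \sum_(X in O) \sum_(Y in O) F i j X Y.
  transitivity (\sum_(X in O) \sum_i \sum_j \sum_(Y in O) F i j X Y).
    apply: eq_bigr => X _; rewrite exchange_big; apply: eq_bigr => i _.
    by rewrite exchange_big.
  rewrite exchange_big; apply: eq_bigr => i _; by rewrite exchange_big.
under eq_bigr => X _ do rewrite -mulr_sumr.
rewrite -mulr_sumr swap.
have E0 : 0 <= energy (loc r) O' f by apply: sumr_ge0 => P _; exact: ell0.
apply: le_trans (_ : N%:R * \sum_(i : arc G) \sum_(j : arc G)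
   (#|O'| * 2 ^ (2 * b * Z))%N%:R * energy (loc r) O' f <= _).
  rewrite ler_wpM2l //; apply: ler_sum => i _; apply: ler_sum => j _.
  have [ij|nij] := boolP (neighbour_arcs i j); last first.
    by rewrite big1 ?mulr_ge0 // => X _; rewrite big1 // => Y _; rewrite !andbF.
  apply: le_trans (one i j ij); apply: ler_sum => X _.
  rewrite [X in _ <= X]big_mkcondr; apply: ler_sum => Y _.
  by rewrite andbT.
rewrite !sumr_const -mulrnA -[_ *+ _]mulr_natr /sweep_const -/N.
have -> : (#|{: arc G}| * #|{: arc G}|)%N = N by rewrite /N mulnn.
rewrite le_eqVlt; apply/orP; left; apply/eqP; clearbody N.
by rewrite !natrM; ring.
Qed.

End SweepEnergy.

(** * The Glauber dynamics *)

Section SingleVertexMoves.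
Local Open Scope nat_scope.
Variable G : sgraph.
Implicit Types (P Q : {set {set G}}) (A : {set G}) (u v : G).

(** P and Q induce the same partition of the vertices other than v. *)
Definition agree_off v P Q : bool :=
  [forall u, (u != v) ==> (pblock P u :\ v == pblock Q u :\ v)].

Lemma agree_offP v P Q :
  reflect (forall u, u != v -> pblock P u :\ v = pblock Q u :\ v) (agree_off v P Q).
Proof.
apply: (iffP forallP) => h u; first by move=> uv; apply/eqP/(implyP (h u)).
by apply/implyP => /h ->.
Qed.

Lemma agree_off_sym v P Q : agree_off v P Q = agree_off v Q P.
Proof. by apply/agree_offP/agree_offP => h u /h ->. Qed.

Lemma agree_off_trans v P Q P' : agree_off v P Q -> agree_off v P P' -> agree_off v Q P'.
Proof. by move=> /agree_offP h /agree_offP h'; apply/agree_offP => u uv; rewrite -h // h'. Qed.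

Lemma agree_off_eq v P Q : partition P [set: G] -> partition Q [set: G] ->
  agree_off v P Q -> pblock P v = pblock Q v -> P = Q.
Proof.
move=> pP pQ /agree_offP h hv; apply: eq_partition => // u.
have [->//|uv] := eqVneq u v.
have back Z (pZ : partition Z [set: G]) x y : y \in pblock Z x -> x \in pblock Z y.
  by move=> yx; rewrite (pblock_eq pZ (pblock_in pZ x) yx) mem_own_pblock.
have vPQ : (v \in pblock P u) = (v \in pblock Q u).
  apply/idP/idP => /back vu; apply: back => //; first by rewrite -hv vu.
  by rewrite hv vu.
apply/setP => x; have [->//|xv] := eqVneq x v.
by move/setP: (h u uv) => /(_ x); rewrite !inE xv.
Qed.

Section Reassign.
Variables (P : {set {set G}}) (v : G) (A : {set G}).
Hypotheses (pP : partition P [set: G]) (AP : A \in set0 |: P) (vA : v \notin A).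

Let blk u := if u \in v |: A then v |: A else pblock P u :\ v.

Let in_A u : u \in A -> A = pblock P u.
Proof.
move=> uA; move: AP; rewrite !inE => /orP[/eqP A0|AP']; first by rewrite A0 inE in uA.
by rewrite (pblock_eq pP AP' uA).
Qed.

Let reassignE : reassign P v A = [set blk u | u : G].
Proof.
apply/setP => C; apply/idP/imsetP => [|[u _ ->]].
  rewrite in_setD1 in_setU1 => /andP[/set0Pn[u uC] /orP[/eqP EC|/imsetP[X]]].
    by exists v; rewrite // /blk setU11.
  rewrite in_setD1 => /andP[XA XP] EC; exists u; rewrite // /blk.
  move: uC; rewrite EC in_setD1 => /andP[uv uX].
  rewrite in_setU1 (negbTE uv) /= (pblock_eq pP XP uX); case: ifP => // uA.
  by rewrite (in_A uA) (pblock_eq pP XP uX) eqxx in XA.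
rewrite in_setD1 in_setU1 /blk; case: ifP => [|/negbT].
  by rewrite eqxx andbT => _; apply/set0Pn; exists v; exact: setU11.
rewrite in_setU1 negb_or => /andP[uv uA]; apply/andP; split.
  by apply/set0Pn; exists u; rewrite in_setD1 uv mem_own_pblock.
apply/orP; right; apply/imsetP; exists (pblock P u) => //.
rewrite in_setD1 pblock_in // andbT; apply: contraNneq uA => <-; exact: mem_own_pblock.
Qed.

Lemma reassign_partition :
  partition (reassign P v A) [set: G] /\ pblock (reassign P v A) =1 blk.
Proof.
rewrite reassignE; apply: partition_blocks => [u|u w]; rewrite /blk.
  by case: ifP => [//|/negbT]; rewrite in_setU1 negb_or in_setD1 mem_own_pblock // andbT => /andP[].
case: ifP => [_ -> //|/negbT]; rewrite in_setU1 negb_or => /andP[uv uA].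
rewrite in_setD1 => /andP[wv wu]; have e := pblock_eq pP (pblock_in pP u) wu.
rewrite in_setU1 (negbTE wv) /= e; case: ifP => // wA.
by rewrite (in_A wA) e mem_own_pblock in uA.
Qed.

Lemma reassign_agree_off : agree_off v P (reassign P v A).
Proof.
have [_ bR] := reassign_partition; apply/agree_offP => u uv.
rewrite bR /blk in_setU1 (negbTE uv) /=; case: ifP => [uA|_].
  by rewrite -(in_A uA) setU1K // ; apply/setDidPl; rewrite disjoint_sym disjoints1.
by apply/setP => x; rewrite !inE; case: eqP.
Qed.

Lemma reassign_pblock : pblock (reassign P v A) v :\ v = A.
Proof. by have [_ ->] := reassign_partition; rewrite /blk setU11 setU1K. Qed.

End Reassign.

Lemma reassign_own P v : partition P [set: G] -> reassign P v (pblock P v) = P.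
Proof.
move=> pP; rewrite /reassign.
have -> : v |: pblock P v = pblock P v by apply/setUidPr; rewrite sub1set mem_own_pblock.
have -> : [set X :\ v | X in P :\ pblock P v] = P :\ pblock P v.
  rewrite -[RHS]imset_id; apply: eq_in_imset => X; rewrite in_setD1 => /andP[XP XinP] /=.
  apply/setDidPl; rewrite disjoint_sym disjoints1; apply: contra XP => vX.
  by rewrite (pblock_eq pP XinP vX).
rewrite setD1K ?pblock_in //; apply/setDidPl; rewrite disjoint_sym disjoints1.
by case/and3P: pP.
Qed.

Section Agree.
Variables (P Q : {set {set G}}) (v : G).
Hypotheses (pP : partition P [set: G]) (pQ : partition Q [set: G]).
Hypotheses (PQ : agree_off v P Q) (neq : P != Q).
Let A := pblock Q v :\ v.

Let vA : v \notin A. Proof. by rewrite !inE eqxx. Qed.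

Lemma agree_off_class : A \in set0 |: P.
Proof.
rewrite in_setU1; have [//|[u uA]] := set_0Vmem A.
  by move=> ->; rewrite eqxx.
apply/orP; right; move: uA; rewrite in_setD1 => /andP[uv uQ].
have E : pblock P u :\ v = A.
  by move/agree_offP: PQ => ->; rewrite // (pblock_eq pQ (pblock_in pQ v) uQ).
have [vPu|vPu] := boolP (v \in pblock P u); last first.
  rewrite -E (_ : pblock P u :\ v = pblock P u) ?pblock_in //.
  by apply/setDidPl; rewrite disjoint_sym disjoints1.
case/eqP: neq; apply: agree_off_eq PQ _ => //.
rewrite (pblock_eq pP (pblock_in pP u) vPu) -(setD1K vPu) E.
by rewrite setD1K // mem_own_pblock.
Qed.

Lemma agree_off_reassign : reassign P v A = Q.
Proof.
have [pR bR] := reassign_partition v pP agree_off_class.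
apply: (agree_off_eq pR pQ) (agree_off_trans (reassign_agree_off pP agree_off_class vA) PQ) _.
by rewrite bR setU11 setD1K // mem_own_pblock.
Qed.

(** When v is to become a singleton, the chain must be able to choose the empty set. A target with
    at most q blocks leaves P with fewer than q, so the empty set is then among [classes q P]. *)
Lemma agree_off_card : A = set0 -> #|P| < #|Q|.
Proof.
move=> A0; have Qv : pblock Q v = [set v].
  by rewrite -(setD1K (mem_own_pblock pQ v)) -/A A0 setU0.
have PQv : pblock P v != [set v].
  by apply: contra neq => /eqP Pv; apply/eqP/(agree_off_eq pP pQ PQ); rewrite Pv Qv.
have vQ : [set v] \in Q by rewrite -Qv pblock_in.
rewrite (cardsD1 [set v] Q) vQ ltnS.
have other X : X \in P -> exists2 u, u \in X & u != v.
  move=> XP; have [x xX] := block_inhabited pP XP.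
  have [xv|xv] := eqVneq x v; last by exists x.
  rewrite {x}xv in xX; rewrite (pblock_eq pP XP xX) in PQv.
  have /subsetPn[u uX] : ~~ (X \subset [set v]).
    by apply: contra PQv => Xv; rewrite eqEsubset Xv sub1set.
  by rewrite inE => uv; exists u.
rewrite -(card_in_imset (f := fun X => X :\ v) (D := P)) => [|X X' XP XP' e].
  apply/subset_leq_card/subsetP => C /imsetP[X XP ->].
  have [u uX uv] := other X XP.
  have E : X :\ v = pblock Q u.
    rewrite -(pblock_eq pP XP uX); move/agree_offP: PQ => -> //.
    apply/setDidPl; rewrite disjoint_sym disjoints1; apply: contra uv => vQu.
    by have := mem_own_pblock pQ u; rewrite -(pblock_eq pQ (pblock_in pQ u) vQu) Qv inE.
  rewrite in_setD1 E pblock_in // andbT -E; apply/eqP => /setP/(_ v).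
  by rewrite !inE eqxx.
have [u uX uv] := other X XP.
by apply: (block_eq pP XP XP' uX); move/setP: e => /(_ u); rewrite !inE uv uX.
Qed.

End Agree.

(** Q is determined by v and one companion of v in its new block; the pair (v, v) encodes that v is
    alone. *)
Lemma card_agree_off P : partition P [set: G] ->
  #|[set Q | partition Q [set: G] && [exists v, agree_off v P Q]]| <= #|G| ^ 2.
Proof.
move=> pP.
pose slot (vu : G * G) := if vu.2 == vu.1 then set0 else pblock P vu.2 :\ vu.1.
pose at_slot vu := [set Q | [&& partition Q [set: G], agree_off vu.1 P Q &
   pblock Q vu.1 :\ vu.1 == slot vu]].
have one vu : #|at_slot vu| <= 1.
  apply/card_le1_eqP => Q Q'; rewrite !inE => /and3P[pQ PQ /eqP hQ] /and3P[pQ' PQ' /eqP hQ'].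
  apply/esym/(agree_off_eq pQ pQ' (agree_off_trans PQ PQ')).
  by rewrite -(setD1K (mem_own_pblock pQ vu.1)) -(setD1K (mem_own_pblock pQ' vu.1)) hQ hQ'.
apply: leq_trans (_ : #|\bigcup_vu at_slot vu| <= _).
  apply/subset_leq_card/subsetP => Q; rewrite inE => /andP[pQ /existsP[v PQ]].
  have [A0|[u uA]] := set_0Vmem (pblock Q v :\ v).
    by apply/bigcupP; exists (v, v); rewrite // inE pQ PQ A0 /slot /= eqxx /=.
  apply/bigcupP; exists (v, u); rewrite // inE pQ PQ /slot /=.
  move: uA; rewrite in_setD1 => /andP[uv uQ]; rewrite (negbTE uv).
  by move/agree_offP: PQ => ->; rewrite // (pblock_eq pQ (pblock_in pQ v) uQ).
apply: leq_trans (_ : \sum_(vu : G * G) 1 <= _); last by rewrite sum1_card card_prod mulnn.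
apply: (big_ind2 (fun (Z : {set {set {set G}}}) k => #|Z| <= k)); rewrite ?cards0 //.
by move=> X a Z c ha hc; apply: leq_trans (leq_card_setU _ _) (leq_add ha hc).
Qed.

Lemma preim_agree_off (T : finType) (f g : G -> T) v : (forall u, u != v -> f u = g u) ->
  agree_off v (preim_partition f [set: G]) (preim_partition g [set: G]).
Proof.
move=> fg; apply/agree_offP => u uv; rewrite !mem_preim_partition.
by apply/setP => x; rewrite !inE; case: eqP => //= /eqP xv; rewrite !fg.
Qed.

Lemma labelled_partition q P (l : {set G} -> 'I_q) : partition P [set: G] ->
  {in P &, injective l} -> P = preim_partition [ffun u => l (pblock P u)] [set: G].
Proof.
move=> pP l_inj; apply: eq_partition => //; first exact: preim_partitionP.
move=> u; rewrite mem_preim_partition; apply/setP => x; rewrite inE !ffunE.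
apply/idP/eqP => [xu|/l_inj <-]; try exact: pblock_in; last exact: mem_own_pblock.
by rewrite (pblock_eq pP (pblock_in pP u) xu).
Qed.

(** Blocks are labelled by position in a list that starts with the common ones, in the same order
    for P and Q. A vertex outside W lies in a common block and so has the same label twice. *)
Lemma agree_except_common q P Q W : partition P [set: G] -> partition Q [set: G] ->
  #|P| <= q -> #|Q| <= q -> symdiff P Q \subset powerset W -> agree_except q W P Q.
Proof.
(* For q = 0 there are no labels, but then there are no vertices either. *)
move=> pP pQ Pq Qq PQ; have [q0|q0] := posnP q.
  have s0 (Z : {set {set G}}) : #|Z| <= q -> Z = set0.
    by move=> Zq; apply/eqP; rewrite -cards_eq0 -leqn0 -q0.
  have noG (v : G) : False by have := pblock_in pP v; rewrite (s0 P Pq) inE.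
  have e0 (g : {ffun G -> 'I_q}) : preim_partition g [set: G] = set0.
    by apply/setP => A; rewrite !inE; apply/imsetP => -[v]; have := noG v.
  have f : {ffun G -> 'I_q} by apply: finfun => v; case: (noG v).
  apply/existsP; exists f; apply/existsP; exists f.
  by rewrite e0 (s0 P Pq) (s0 Q Qq) eqxx; apply/forallP => v; case: (noG v).
pose l (Z Z' : {set {set G}}) (A : {set G}) : 'I_q :=
  insubd (Ordinal q0) (index A (enum (Z :&: Z') ++ enum (Z :\: Z'))).
have in_list Z Z' A : (A \in enum (Z :&: Z') ++ enum (Z :\: Z')) = (A \in Z).
  by rewrite mem_cat !mem_enum -in_setU setID.
have lE (Z Z' : {set {set G}}) A : #|Z| <= q -> A \in Z -> l Z Z' A = index A (enum (Z :&: Z') ++ enum (Z :\: Z')) :> nat.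
  move=> Zq AZ; rewrite /l val_insubd (leq_trans _ Zq) //.
  have := in_list Z Z' A; rewrite AZ -index_mem size_cat -!cardE cardsID //.
have l_inj (Z Z' : {set {set G}}) : #|Z| <= q -> {in Z &, injective (l Z Z')}.
  move=> Zq A A' AZ AZ' /(congr1 val) /=; rewrite !lE //.
  by apply: index_inj; rewrite ?in_list.
apply/existsP; exists [ffun u => l P Q (pblock P u)].
apply/existsP; exists [ffun u => l Q P (pblock Q u)].
rewrite -!labelled_partition ?eqxx //=; try exact: l_inj.
apply/forallP => v; apply/implyP => vW; rewrite !ffunE.
have far (Z Z' : {set {set G}}) : partition Z [set: G] -> symdiff Z Z' \subset powerset W -> pblock Z v \in Z'.
  move=> pZ /subsetP/(_ (pblock Z v)); rewrite !inE pblock_in // addTb => h.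
  apply: contraR vW => /h /subsetP; apply; exact: mem_own_pblock.
have vQ := far _ _ pP PQ; have vP := far Q P pQ; rewrite symdiffC in vP; have {}vP := vP PQ.
have e : pblock P v = pblock Q v.
  by rewrite (pblock_eq pQ vQ (mem_own_pblock pP v)).
apply/eqP/val_inj; rewrite /= !lE ?pblock_in // -e !index_cat !mem_enum !inE vQ pblock_in //=.
by rewrite setIC.
Qed.

End SingleVertexMoves.

(** * Energy along walks of bounded length *)

Section NearbyStates.
Variables (R : realType) (T : finType) (e : rel T) (d : nat).
Hypotheses (e_sym : symmetric e) (e_refl : reflexive e) (d_gt0 : (0 < d)%N)
  (e_deg : forall x, (#|[set y | e x y]| <= d)%N).

Fixpoint near (j : nat) : rel T :=
  if j is j'.+1 then [rel x y | [exists z, e x z && near j' z y]] else [rel x y | x == y].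

Lemma near_refl j x : near j x x.
Proof. by elim: j => [|j IH] /=; [exact: eqxx | apply/existsP; exists x; rewrite e_refl]. Qed.

Let card_union (A : {set T}) (F : T -> {set T}) k m : (#|A| <= k)%N -> (forall x, (#|F x| <= m)%N) ->
  (#|\bigcup_(x in A) F x| <= k * m)%N.
Proof.
move=> Ak Fm; apply: leq_trans (_ : #|A| * m <= _)%N; last by rewrite leq_mul2r Ak orbT.
rewrite -sum_nat_const; apply: (big_ind2 (fun (Z : {set T}) c => #|Z| <= c)%N) => //.
  by rewrite cards0.
by move=> X a Z c ha hc; apply: leq_trans (leq_card_setU _ _) (leq_add ha hc).
Qed.

Lemma card_near j x : (#|[set y | near j x y]| <= d ^ j)%N.
Proof.
elim: j x => [|j IH] x.
  by rewrite (_ : [set _ | _] = [set x]) ?cards1 //; apply/setP => y; rewrite !inE eq_sym.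
apply: leq_trans (_ : #|\bigcup_(z in [set z | e x z]) [set y | near j z y]| <= _)%N.
  apply/subset_leq_card/subsetP => y; rewrite inE => /existsP[z /andP[xz zy]].
  by apply/bigcupP; exists z; rewrite inE.
by rewrite expnS card_union.
Qed.

Lemma card_near_to j y : (#|[set x | near j x y]| <= d ^ j)%N.
Proof.
elim: j => [|j IH].
  by rewrite (_ : [set _ | _] = [set y]) ?cards1 //; apply/setP => x; rewrite !inE.
apply: leq_trans (_ : #|\bigcup_(z in [set z | near j z y]) [set x | e z x]| <= _)%N.
  apply/subset_leq_card/subsetP => x; rewrite inE => /existsP[z /andP[xz zy]].
  by apply/bigcupP; exists z; rewrite inE // e_sym.
by rewrite expnSr card_union.
Qed.

(** Splitting a walk after its first step, with (a + b)^2 <= 2 a^2 + 2 b^2, costs 2 d^j for the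
    first step and 2 d (4 d)^j for the rest, together at most (4 d)^(j + 1). *)
Lemma near_energy (f : T -> R) j :
  \sum_x \sum_(y | near j x y) (f x - f y) ^+ 2 <=
  (4 * d%:R) ^+ j * \sum_x \sum_(y | e x y) (f x - f y) ^+ 2.
Proof.
set E := \sum_x \sum_(y | e x y) _.
have E0 : 0 <= E by apply: sumr_ge0 => x _; apply: sumr_ge0 => y _; exact: sqr_ge0.
have d1 : 1 <= d%:R :> R by rewrite ler1n.
have d4 : 0 <= 4 * d%:R :> R by lra.
elim: j => [|j IH].
  rewrite big1 ?expr0 ?mul1r // => x _.
  by rewrite big1 // => y /eqP <-; rewrite subrr expr0n.
apply: le_trans (_ : \sum_x \sum_(z | e x z) \sum_(y | near j z y)
    (2 * (f x - f z) ^+ 2 + 2 * (f z - f y) ^+ 2) <= _).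
  apply: ler_sum => x _.
  rewrite (exchange_big_dep (near j.+1 x)) /=; last first.
    by move=> z y xz zy; apply/existsP; exists z; rewrite xz.
  apply: ler_sum => y /existsP[z /andP[xz zy]].
  rewrite (bigD1 z) ?xz //=; apply: le_trans (_ : 2 * (f x - f z) ^+ 2 + 2 * (f z - f y) ^+ 2 <= _).
    by have := sqr_ge0 (f x - 2 * f z + f y); lra.
  by rewrite lerDl sumr_ge0 // => u _; rewrite addr_ge0 // mulr_ge0 ?sqr_ge0.
under eq_bigr => x _ do (under eq_bigr => z _ do rewrite big_split /=).
under eq_bigr => x _ do rewrite big_split /=.
rewrite big_split /=.
have h1 : \sum_x \sum_(z | e x z) \sum_(y | near j z y) 2 * (f x - f z) ^+ 2 <= d%:R ^+ j * (2 * E).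
  rewrite /E mulr_sumr mulr_sumr; apply: ler_sum => x _; rewrite !mulr_sumr; apply: ler_sum => z _.
  rewrite sumr_const -[X in X <= _]mulr_natl -natrX.
  apply: ler_wpM2r; first by rewrite mulr_ge0 // sqr_ge0.
  rewrite ler_nat.
  by apply: leq_trans (card_near j z); apply/subset_leq_card/subsetP => y; rewrite inE.
have h2 : \sum_x \sum_(z | e x z) \sum_(y | near j z y) 2 * (f z - f y) ^+ 2 <=
    d%:R * (2 * ((4 * d%:R) ^+ j * E)).
  rewrite (exchange_big_dep xpredT) //=.
  apply: le_trans (_ : \sum_z d%:R * (2 * \sum_(y | near j z y) (f z - f y) ^+ 2) <= _).
    apply: ler_sum => z _; rewrite -mulr_sumr sumr_const -[X in X <= _]mulr_natl.
    apply: ler_wpM2r; first by rewrite mulr_ge0 // sumr_ge0 // => y _; exact: sqr_ge0.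
    rewrite ler_nat; apply: leq_trans (e_deg z).
    by apply/subset_leq_card/subsetP => x; rewrite !inE e_sym.
  by rewrite -!mulr_sumr !ler_wpM2l // ler0n.
apply: le_trans (lerD h1 h2) _; rewrite [in X in _ <= X]exprS.
have h3 : d%:R ^+ j <= (4 * d%:R) ^+ j :> R.
  by apply: lerXn2r; rewrite ?nnegrE //; lra.
have h4 : d%:R ^+ j <= d%:R * (4 * d%:R) ^+ j :> R.
  apply: le_trans h3 _; by rewrite ler_peMl // exprn_ge0.
have := ler_wpM2r E0 h4; nra.
Qed.

End NearbyStates.

(** * Reversibility and comparison with local moves *)

Section Glauber.
Variables (R : realType) (G : sgraph) (K q B : nat).
Hypothesis n_gt0 : (0 < #|G|)%N.
Let S := glauber_state G K q B.
Let gl := @glauber R G K q B.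
Implicit Types w : S.

Let n : R := #|G|%:R.

Definition nclasses w : R := #|classes q (val w)|%:R.

Let n0 : 0 < n. Proof. by rewrite ltr0n. Qed.

Let state_part w : partition (val w) [set: G].
Proof. by have := valP w; rewrite inE /qpartition => /andP[/andP[]]. Qed.

Let state_card w : (#|val w| <= q)%N.
Proof. by have := valP w; rewrite inE /qpartition => /andP[/andP[]]. Qed.

Let card_state w : (#|val w| <= #|G|)%N.
Proof.
have s_inj : injective (fun v : G => (enum_rank v : nat)) by move=> u v /ord_inj/enum_rank_inj.
by rewrite -(card_leaders s_inj (state_part w)) max_card.
Qed.

Let classes_sub w : classes q (val w) \subset set0 |: val w.
Proof. by rewrite /classes; case: ifP => // _; exact: subsetUr. Qed.

Let sub_classes w : val w \subset classes q (val w).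
Proof. by rewrite /classes; case: ifP => // _; exact: subsetUr. Qed.

Lemma nclasses_ge1 w : 1 <= nclasses w.
Proof.
rewrite ler1n card_gt0; have [v _] : exists v : G, v \in [set: G].
  by apply/set0Pn; rewrite -card_gt0 cardsT.
by apply/set0Pn; exists (pblock (val w) v); apply: (subsetP (sub_classes w)); exact: pblock_in.
Qed.

Lemma nclasses_le w : nclasses w <= n + 1.
Proof.
rewrite /n natr1 ler_nat; apply: leq_trans (subset_leq_card (classes_sub w)) _.
by rewrite cardsU1; case: (_ \notin _); rewrite ?add1n ?add0n ?ltnS // leqW.
Qed.

Let nc_gt0 w : 0 < nclasses w. Proof. exact: lt_le_trans ltr01 (nclasses_ge1 w). Qed.

Let weighted_glauber w w' : nclasses w * gl w w' =
  n^-1 * \sum_v \sum_(A in classes q (val w)) (insubd w (reassign (val w) v A) == w')%:R.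
Proof.
rewrite /gl /glauber !mulr_sumr; apply: eq_bigr => v _; rewrite !mulr_sumr; apply: eq_bigr => A _.
rewrite -/n -/(nclasses w); field.
by rewrite (gt_eqF n0) (gt_eqF (nc_gt0 w)).
Qed.

(** For w != w' a single class can send v to its place in w', namely the remainder of its block
    there. The count is symmetric in w and w', which makes the weights [nclasses] reversible. *)
Let slot_count w w' v : w != w' ->
  \sum_(A in classes q (val w)) (insubd w (reassign (val w) v A) == w')%:R =
  (agree_off v (val w) (val w'))%:R :> R.
Proof.
move=> ww'; have [pw pw'] := (state_part w, state_part w').
have nval : val w != val w' by apply: contra ww' => /eqP/val_inj ->.
have hit A : A \in classes q (val w) -> insubd w (reassign (val w) v A) = w' ->
    agree_off v (val w) (val w') /\ A = pblock (val w') v :\ v.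
  move=> Acl hA; have A0 := subsetP (classes_sub w) _ Acl.
  have [vA|vA] := boolP (v \in A).
    case/eqP: ww'; rewrite -hA; apply: val_inj; rewrite val_insubd.
    have -> : A = pblock (val w) v.
      move: A0; rewrite in_setU1 => /orP[/eqP A0|A0]; first by rewrite A0 inE in vA.
      by rewrite (pblock_eq pw A0 vA).
    by rewrite reassign_own //; case: ifP.
  have E : reassign (val w) v A = val w'.
    move: (congr1 val hA); rewrite val_insubd; case: ifP => // _ E.
    by rewrite E eqxx in nval.
  by rewrite -E reassign_pblock // reassign_agree_off.
have [agr|nagr] := boolP (agree_off _ _ _); last first.
  rewrite big1 // => A Acl; case: eqP => // /(hit A Acl)[agr _].
  by rewrite agr in nagr.
have Acl : pblock (val w') v :\ v \in classes q (val w).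
  have := agree_off_class pw pw' agr nval; rewrite in_setU1 => /orP[/eqP A0|]; last exact: subsetP.
  rewrite /classes (leq_trans (agree_off_card pw pw' agr nval A0)) //.
  by rewrite A0 setU11.
rewrite (bigD1 _ Acl) /= agree_off_reassign // valKd eqxx big1 ?addr0 // => A /andP[A1 AA].
by case: eqP => // /(hit A A1)[_ E]; rewrite E eqxx in AA.
Qed.

Lemma glauber_rev w w' : nclasses w * gl w w' = nclasses w' * gl w' w.
Proof.
have [->//|ww'] := eqVneq w w'; rewrite !weighted_glauber.
congr (_ * _); apply: eq_bigr => v _.
by rewrite (@slot_count w w') // (@slot_count w' w) 1?agree_off_sym // eq_sym.
Qed.

Lemma glauber_ge0 w w' : 0 <= gl w w'.
Proof.
by apply: sumr_ge0 => v _; apply: sumr_ge0 => A _; rewrite !mulr_ge0 ?invr_ge0.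
Qed.

Lemma glauber_row w : \sum_w' gl w w' = 1.
Proof.
apply: (mulfI (negbT (gt_eqF (nc_gt0 w)))); rewrite mulr_sumr mulr1.
under eq_bigr => w' _ do rewrite weighted_glauber.
rewrite -mulr_sumr exchange_big /=.
rewrite (eq_bigr (fun=> nclasses w)) => [|v _].
  by rewrite sumr_const -[_ *+ _]mulr_natl mulrA mulVf ?mul1r // gt_eqF.
rewrite exchange_big /= /nclasses -sum1_card natr_sum; apply: eq_bigr => A _.
rewrite (bigD1 (insubd w (reassign (val w) v A))) //= eqxx big1 ?addr0 // => w' /negbTE ww.
by rewrite eq_sym ww.
Qed.

Lemma glauber_loop w : (n + 1)^-1 <= gl w w.
Proof.
apply: le_trans (_ : (nclasses w)^-1 <= _).
  by rewrite lef_pV2 ?posrE ?nclasses_le // addr_gt0.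
rewrite -(ler_pM2l (nc_gt0 w)) divff ?gt_eqF // weighted_glauber.
rewrite -(ler_pM2l n0) mulrA divff ?gt_eqF // mulr1 mul1r /n -sum1_card natr_sum.
apply: ler_sum => v _.
rewrite (bigD1 (pblock (val w) v)); last first.
  exact: (subsetP (sub_classes w) _ (pblock_in (state_part w) v)).
by rewrite reassign_own // valKd eqxx lerDl sumr_ge0.
Qed.

Definition single_move : rel S := [rel w w' | [exists v, agree_off v (val w) (val w')]].

Lemma single_move_rate w w' : w != w' -> single_move w w' -> n^-1 <= nclasses w * gl w w'.
Proof.
move=> ww' /existsP[v agr]; rewrite weighted_glauber ler_peMr ?invr_ge0 ?(ltW n0) //.
rewrite (bigD1 v) //= slot_count // agr lerDl sumr_ge0 // => u _.
by rewrite slot_count.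
Qed.

Lemma single_move_sym : symmetric single_move.
Proof. by move=> w w'; apply: eq_existsb => v; exact: agree_off_sym. Qed.

Lemma single_move_refl : reflexive single_move.
Proof.
move=> w; have [v _] : exists v : G, v \in [set: G].
  by apply/set0Pn; rewrite -card_gt0 cardsT.
by apply/existsP; exists v; apply/agree_offP.
Qed.

Lemma single_move_deg w : (#|[set w' | single_move w w']| <= #|G| ^ 2)%N.
Proof.
rewrite -(card_imset _ val_inj); apply: leq_trans (card_agree_off (state_part w)).
apply/subset_leq_card/subsetP => P /imsetP[w' ww' ->].
by rewrite inE state_part; rewrite inE in ww'.
Qed.

(** The vertices of W receive their labels in w' one at a time. Each intermediate partition agrees
    with w' except on a subset of W, and therefore is a state. *)
Lemma near_agree_except j (W : {set G}) w w' : (#|W| <= j)%N -> (#|W| <= K)%N ->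
  val w' \in Omega G q B -> agree_except q W (val w) (val w') ->
  near single_move j w w'.
Proof.
move=> Wj WK w'O /existsP[f /existsP[g /and3P[/eqP wf /eqP w'g /forallP fg0]]].
have fg v : v \notin W -> f v = g v by move=> vW; apply/eqP/(implyP (fg0 v)).
elim: j f W Wj WK w wf fg {fg0} => [|j IH] f W Wj WK w wf fg.
  apply/eqP/val_inj; rewrite wf w'g; suff -> : f = g by [].
  apply/ffunP => v; apply: fg; move: Wj; rewrite leqn0 cards_eq0 => /eqP ->.
  by rewrite inE.
have [W0|[v vW]] := set_0Vmem W.
  rewrite (_ : w = w'); first exact: (near_refl single_move_refl).
  apply/val_inj; rewrite wf w'g; suff -> : f = g by [].
  by apply/ffunP => v; apply: fg; rewrite W0 inE.
pose f' : {ffun G -> 'I_q} := [ffun u => if u == v then g v else f u].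
have f'g u : u \notin W :\ v -> f' u = g u.
  rewrite ffunE in_setD1 negb_and negbK; case: eqVneq => [->|uv] //= uW; exact: fg.
have cW' : (#|W :\ v| < #|W|)%N by rewrite [X in (_ < X)%N](cardsD1 v) vW.
pose P' := preim_partition f' [set: G].
have P'K : P' \in OmegaK G K q B.
  rewrite inE; apply/andP; split; last first.
    apply/existsP; exists (val w'); rewrite w'O; apply/existsP; exists (W :\ v).
    rewrite (ltnW (leq_trans cW' WK)); apply/existsP; exists f'; apply/existsP; exists g.
    by rewrite eqxx w'g eqxx; apply/forallP => u; apply/implyP => /f'g ->.
  rewrite /qpartition preim_partitionP /=.
  apply: leq_trans (_ : #|[set [set u | f' u == l] | l : 'I_q]| <= q)%N; last first.
    by apply: leq_trans (leq_imset_card _ _) _; rewrite card_ord.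
  apply/subset_leq_card/subsetP => A AP'.
  have [u ->] := block_pblock (preim_partitionP f' [set: G]) AP'.
  by rewrite mem_preim_partition; apply: imset_f; rewrite inE.
apply/existsP; exists (Sub P' P'K); apply/andP; split.
  apply/existsP; exists v; rewrite wf SubK; apply: preim_agree_off => u uv.
  by rewrite ffunE (negbTE uv).
apply: (IH f' (W :\ v)) => //; first by rewrite -ltnS (leq_trans cW').
exact: ltnW (leq_trans cW' WK).
Qed.

Variables (r : nat) (A : R).
Hypotheses (A_ge0 : 0 <= A) (ball_K : forall v : G, (#|ball v r| <= K)%N).
Hypothesis Omega_poincare : forall f : {set {set G}} -> R,
  \sum_(X in Omega G q B) \sum_(Y in Omega G q B) (f X - f Y) ^+ 2 <=
  A * #|Omega G q B|%:R * energy (loc r) (Omega G q B) f.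

Let Omega_part P : P \in Omega G q B -> partition P [set: G] /\ (#|P| <= q)%N.
Proof. by rewrite in_Omega => /andP[/and3P[]]. Qed.

Lemma Omega_sub_OmegaK : Omega G q B \subset OmegaK G K q B.
Proof.
apply/subsetP => P PO; have [pP Pq] := Omega_part PO.
rewrite inE /qpartition pP Pq /=; apply/existsP; exists P; rewrite PO.
apply/existsP; exists set0; rewrite cards0 /=; apply: agree_except_common => //.
by apply/subsetP => C; rewrite inE addbb.
Qed.

Section Comparison.
Variables (w0 : S) (f : S -> R).

Let near_K := near single_move K.
Let near_gap := \sum_w \sum_(w' | near_K w w') (f w - f w') ^+ 2.
Let good w := val w \in Omega G q B.

Let near_gap_ge0 : 0 <= near_gap.
Proof. by apply: sumr_ge0 => w _; apply: sumr_ge0 => w' _; exact: sqr_ge0. Qed.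

Let center w : S := odflt w [pick w' | good w' && near_K w w'].

Let centerP w : good (center w) && near_K w (center w).
Proof.
rewrite /center; case: pickP => [w' //|none].
have := valP w; rewrite inE => /andP[_ /existsP[Q /andP[QO /existsP[W /andP[WK agr]]]]].
have QK := subsetP Omega_sub_OmegaK _ QO.
have := none (Sub Q QK); rewrite /good SubK QO /= /near_K.
by rewrite (near_agree_except WK WK) // SubK.
Qed.

Let m := ((#|G| ^ 2) ^ K)%N.

Let sum_center (h : S -> R) : (forall w, 0 <= h w) ->
  \sum_w h (center w) <= m%:R * \sum_(w | good w) h w.
Proof.
move=> h0; rewrite (partition_big center good) /=; last by move=> w _; case/andP: (centerP w).
rewrite mulr_sumr; apply: ler_sum => w gw.
rewrite (eq_bigr (fun=> h w)) => [|w' /eqP -> //].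
rewrite sumr_const -[X in X <= _]mulr_natl; apply: ler_wpM2r => //; rewrite ler_nat.
apply: leq_trans (card_near_to single_move_sym single_move_deg K w).
apply/subset_leq_card/subsetP => w' cw; have /eqP <- : center w' == w := cw.
by rewrite inE; case/andP: (centerP w').
Qed.

Let state P : S := insubd w0 P.

Let sum_Omega (h : {set {set G}} -> R) :
  \sum_(P in Omega G q B) h P = \sum_(w | good w) h (val w).
Proof.
rewrite (reindex_onto val state) /=.
  by apply: eq_bigl => w; rewrite /state valKd eqxx andbT.
by move=> P PO; rewrite insubdK // (subsetP Omega_sub_OmegaK).
Qed.

(** A local move inside [Omega] alters labels only in a ball with at most K vertices, so it is a
    walk of K single moves, rests included. *)
Let good_gap : \sum_(w | good w) \sum_(w' | good w') (f w - f w') ^+ 2 <= A * #|S|%:R * near_gap.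
Proof.
pose fh P := f (state P).
have fv w : fh (val w) = f w by rewrite /fh /state valKd.
have := Omega_poincare fh; rewrite sum_Omega.
under eq_bigr => w _ do rewrite sum_Omega.
have -> : \sum_(w | good w) \sum_(w' | good w') (fh (val w) - fh (val w')) ^+ 2 =
    \sum_(w | good w) \sum_(w' | good w') (f w - f w') ^+ 2.
  by apply: eq_bigr => w _; apply: eq_bigr => w' _; rewrite !fv.
move=> h; apply: le_trans h _.
have cO : (#|Omega G q B| <= #|S|)%N.
  by rewrite card_sig; apply: subset_leq_card; exact: Omega_sub_OmegaK.
have e0 : 0 <= energy (loc r) (Omega G q B) fh.
  by apply: sumr_ge0 => P _; apply: sumr_ge0 => Q _; exact: sqr_ge0.
apply: le_trans (_ : A * #|S|%:R * energy (loc r) (Omega G q B) fh <= _).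
  by rewrite ler_wpM2r // ler_wpM2l // ler_nat.
rewrite ler_wpM2l ?mulr_ge0 // /energy sum_Omega.
apply: le_trans (_ : \sum_w \sum_(w' | good w && (good w' && loc r (val w) (val w')))
   (fh (val w) - fh (val w')) ^+ 2 <= _).
  rewrite [X in X <= _]big_mkcond; apply: ler_sum => w _; case: ifP => gw; last first.
    by apply: sumr_ge0 => w' _; exact: sqr_ge0.
  rewrite (reindex_onto val state) /=; last first.
    by move=> P /andP[PO _]; rewrite insubdK // (subsetP Omega_sub_OmegaK).
  by rewrite le_eqVlt; apply/orP; left; apply/eqP/eq_bigl => w'; rewrite /state valKd eqxx andbT.
apply: ler_sum => w _; rewrite [X in X <= _]big_mkcond [X in _ <= X]big_mkcond; apply: ler_sum => w' _.
rewrite !fv; case: ifP => [/and3P[gw gw' /existsP[v ww']]|_]; last by case: ifP => // _; exact: sqr_ge0.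
rewrite ifT //; have [pw wq] := Omega_part gw; have [pw' wq'] := Omega_part gw'.
exact: near_agree_except (ball_K v) (ball_K v) gw' (agree_except_common pw pw' wq wq' ww').
Qed.

(** Two states are joined through their centers. The factor 3 comes from three legs, 6 from the two
    outer ones, [m] squared from the number of states sharing each center, and the K-th power from
    [near_energy] with degree n^2. *)
Lemma state_poincare : \sum_w \sum_w' (f w - f w') ^+ 2 <=
  #|S|%:R * (6 + 3 * m%:R ^+ 2 * A) * (4 * n ^+ 2) ^+ K *
  \sum_w \sum_(w' | single_move w w') (f w - f w') ^+ 2.
Proof.
have sq (a c d e : R) : (a - e) ^+ 2 <= 3 * ((a - c) ^+ 2 + (c - d) ^+ 2 + (e - d) ^+ 2).
  have h1 := sqr_ge0 ((a - c) - (c - d)); have h2 := sqr_ge0 ((a - c) - (d - e)).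
  have h3 := sqr_ge0 ((c - d) - (d - e)); lra.
pose c w := center w.
have toc : \sum_w (f w - f (c w)) ^+ 2 <= near_gap.
  apply: ler_sum => w _; rewrite (bigD1 (c w)) /=; last by case/andP: (centerP w).
  by rewrite lerDl sumr_ge0 // => w' _; exact: sqr_ge0.
have cc : \sum_w \sum_w' (f (c w) - f (c w')) ^+ 2 <= m%:R ^+ 2 * (A * #|S|%:R * near_gap).
  apply: le_trans (_ : m%:R * (m%:R * \sum_(w | good w) \sum_(w' | good w') (f w - f w') ^+ 2) <= _).
    apply: le_trans (sum_center (h := fun w => \sum_w' (f w - f (c w')) ^+ 2) _) _.
      by move=> w; apply: sumr_ge0 => w' _; exact: sqr_ge0.
    rewrite ler_wpM2l // mulr_sumr; apply: ler_sum => w _.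
    by apply: (sum_center (h := fun w' => (f w - f w') ^+ 2)) => w'; exact: sqr_ge0.
  by rewrite mulrA -expr2 ler_wpM2l ?exprn_ge0 //; exact: good_gap.
have n2 : (0 < #|G| ^ 2)%N by rewrite expn_gt0 n_gt0.
have := near_energy single_move_sym n2 single_move_deg f K; rewrite natrX -/n -/near_gap.
set E1 := \sum_w \sum_(w' | single_move w w') _ => ng.
apply: le_trans (_ : \sum_w \sum_w' 3 * ((f w - f (c w)) ^+ 2 + (f (c w) - f (c w')) ^+ 2 +
    (f w' - f (c w')) ^+ 2) <= _).
  by apply: ler_sum => w _; apply: ler_sum => w' _; exact: sq.
have dbl (a : S -> R) : \sum_w \sum_(w' : S) a w = #|S|%:R * \sum_w a w.
  by rewrite mulr_sumr; apply: eq_bigr => w _; rewrite sumr_const -[X in X = _]mulr_natl.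
have dbl' (a : S -> R) : \sum_(w : S) \sum_w' a w' = #|S|%:R * \sum_w a w.
  by rewrite exchange_big dbl.
under eq_bigr => w _ do rewrite -mulr_sumr !big_split /=.
rewrite -mulr_sumr !big_split /= dbl dbl'.
have k0 : 0 <= #|S|%:R * (6 + 3 * m%:R ^+ 2 * A).
  by rewrite mulr_ge0 // addr_ge0 // !mulr_ge0 // exprn_ge0.
apply: le_trans (_ : #|S|%:R * (6 + 3 * m%:R ^+ 2 * A) * near_gap <= _); last first.
  by rewrite -[X in _ <= X]mulrA; apply: ler_wpM2l.
have := ler_wpM2l (ler0n R #|S|) toc; lra.
Qed.

End Comparison.

Let c := (n + 1)^-1.
Let m := ((#|G| ^ 2) ^ K)%N.
Let aux : R := (6 + 3 * m%:R ^+ 2 * A) * (4 * n ^+ 2) ^+ K.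
Let den := (n + 1) ^+ 3 * n * aux.
Let W := \sum_w nclasses w.

Let n_ge1 : 1 <= n. Proof. by rewrite ler1n. Qed.

Let aux_ge6 : 6 <= aux.
Proof.
have a1 : 6 <= 6 + 3 * m%:R ^+ 2 * A by rewrite lerDl !mulr_ge0 // exprn_ge0.
have a2 : 1 <= (4 * n ^+ 2) ^+ K.
  by apply: exprn_ege1; have := exprn_ege1 2 n_ge1; lra.
rewrite /aux; nra.
Qed.

Let den_gt2 : 2 < den.
Proof.
have h1 : 1 <= (n + 1) ^+ 3 by apply: exprn_ege1; rewrite lerDr.
have h2 : 1 <= (n + 1) ^+ 3 * n by apply: mulr_ege1.
have := aux_ge6; rewrite /den; nra.
Qed.

Let dirichlet (f : S -> R) :
  \sum_w \sum_(w' | single_move w w') (f w - f w') ^+ 2 <=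
  n * \sum_w \sum_w' nclasses w * gl w w' * (f w - f w') ^+ 2.
Proof.
rewrite mulr_sumr; apply: ler_sum => w _; rewrite mulr_sumr [X in X <= _]big_mkcond.
apply: ler_sum => w' _.
have t0 : 0 <= n * (nclasses w * gl w w' * (f w - f w') ^+ 2).
  apply: mulr_ge0; first exact: ltW.
  by apply: mulr_ge0; [apply: mulr_ge0; [exact: ltW | exact: glauber_ge0] | exact: sqr_ge0].
case: ifP => // ww'; have [->|neq] := eqVneq w w'; first by rewrite subrr expr0n /= !mulr0.
rewrite mulrA ler_peMl ?sqr_ge0 //.
have := ler_wpM2l (ltW n0) (single_move_rate neq ww').
by rewrite divff ?gt_eqF.
Qed.

(** In [den], the weights account for (n + 1)^2, the resting probability c for another n + 1, the
    rate of a single move for n, and the comparison with uniform weights for [aux]. *)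
Let glauber_poincare (w0 : S) (f : S -> R) :
  2 / den * (\sum_w \sum_w' nclasses w * nclasses w' * (f w - f w') ^+ 2) <=
  2 * c * W * \sum_w \sum_w' nclasses w * gl w w' * (f w - f w') ^+ 2.
Proof.
set D := \sum_w \sum_w' nclasses w * gl w w' * _.
have D0 : 0 <= D.
  apply: sumr_ge0 => w _; apply: sumr_ge0 => w' _.
  by apply: mulr_ge0; [apply: mulr_ge0; [exact: ltW | exact: glauber_ge0] | exact: sqr_ge0].
have h1 : \sum_w \sum_w' nclasses w * nclasses w' * (f w - f w') ^+ 2 <=
    (n + 1) ^+ 2 * \sum_w \sum_w' (f w - f w') ^+ 2.
  rewrite mulr_sumr; apply: ler_sum => w _; rewrite mulr_sumr; apply: ler_sum => w' _.
  rewrite ler_wpM2r ?sqr_ge0 // expr2.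
  by apply: ler_pM; rewrite ?nclasses_le ?(ltW (nc_gt0 _)).
have h2 := state_poincare w0 f.
have h3 := dirichlet f; rewrite -/D in h3.
have SW : #|S|%:R <= W.
  by rewrite -sum1_card natr_sum; apply: ler_sum => w _; exact: nclasses_ge1.
have a0 : 0 <= aux by apply: le_trans aux_ge6.
have h4 : \sum_w \sum_w' (f w - f w') ^+ 2 <= W * aux * (n * D).
  apply: le_trans h2 _; rewrite -[X in X * \sum_w _]mulrA -/aux.
  apply: ler_pM => //; last by rewrite ler_wpM2r.
    by rewrite mulr_ge0.
  by apply: sumr_ge0 => w _; apply: sumr_ge0 => w' _; exact: sqr_ge0.
have den0 : 0 < den by apply: lt_trans den_gt2.
have np : n + 1 != 0 by rewrite gt_eqF // addr_gt0.
apply: le_trans (_ : 2 / den * ((n + 1) ^+ 2 * (W * aux * (n * D))) <= _).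
  rewrite ler_wpM2l ?divr_ge0 ?(ltW den0) //; apply: le_trans h1 _.
  by rewrite ler_wpM2l ?exprn_ge0 ?addr_ge0 // ltW.
rewrite le_eqVlt; apply/orP; left; apply/eqP; rewrite /c /den.
field; rewrite np !gt_eqF //; exact: lt_le_trans aux_ge6.
Qed.

(** A partition is recovered from a map that sends each vertex to a chosen representative of its
    block. *)
Let card_states : (#|S| <= #|G| ^ #|G|)%N.
Proof.
pose root (w : S) := [ffun u : G => odflt u [pick x in pblock (val w) u]].
rewrite -card_ffun -(card_imset (f := root) (mem S)); first exact: max_card.
have rootE w u : root w u \in pblock (val w) u.
  rewrite ffunE; case: pickP => [x //|/(_ u)] /=.
  by rewrite mem_own_pblock // state_part.
have same w x u : (x \in pblock (val w) u) = (root w x == root w u).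
  have pw := state_part w.
  apply/idP/eqP => [xu|e].
    have e := pblock_eq pw (pblock_in pw u) xu.
    rewrite !ffunE e; case: pickP => [//|/(_ u)] /=.
    by rewrite mem_own_pblock.
  have := rootE w x; rewrite e => hx.
  have := pblock_eq pw (pblock_in pw x) hx; rewrite (pblock_eq pw (pblock_in pw u) (rootE w u)) => ->.
  exact: mem_own_pblock.
move=> w w' e; apply/val_inj/eq_partition; try exact: state_part.
by move=> u; apply/setP => x; rewrite !same e.
Qed.

Let ln_weight (w0 : S) : ln W <= (n + 1) ^+ 2.
Proof.
have W0 : 0 < W by apply: lt_le_trans (nc_gt0 w0) _; rewrite /W (bigD1 w0) //= lerDl sumr_ge0 // => w _; exact: ltW.
have n1 : 0 < n + 1 by rewrite addr_gt0.
have WS : W <= (n + 1) ^+ #|G|.+1.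
  apply: le_trans (_ : (n + 1) * #|S|%:R <= _).
    rewrite -sum1_card natr_sum mulr_sumr; apply: ler_sum => w _.
    by rewrite mulr1 nclasses_le.
  rewrite exprS ler_wpM2l ?(ltW n1) //.
  apply: le_trans (_ : (#|G| ^ #|G|)%N%:R <= _); first by rewrite ler_nat.
  by rewrite natrX; apply: lerXn2r; rewrite ?nnegrE ?(ltW n0) ?(ltW n1) // lerDl.
apply: le_trans (_ : ln ((n + 1) ^+ #|G|.+1) <= _).
  by rewrite ler_ln ?posrE ?exprn_gt0.
rewrite lnXn // -mulr_natr -natr1 -/n expr2 ler_wpM2r ?(ltW n1) //.
exact/ltW/ln_sublinear.
Qed.

Lemma glauber_mixing_time (w0 : S) delta : 0 < delta -> delta <= 1 / 2 ->
  exists2 pi : S -> R, unique_stationary gl pi &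
    exists2 tau : nat, is_mixing_time gl pi delta tau &
    tau%:R <= ((n + 1) ^+ 2 + 1) * den * ln (1 / delta) + 2 * ln (1 / delta).
Proof.
move=> d0 d1.
have den0 : 0 < den by apply: lt_trans den_gt2.
have lam0 : 0 < 2 / den by rewrite divr_gt0.
have lam1 : 2 / den < 1 by rewrite ltr_pdivrMr // mul1r.
(* This lower bound lets ln W and the rounding of the time be absorbed into multiples of ln (1 /
   delta). *)
have ld : 1 / 2 <= ln (1 / delta).
  rewrite ln_div ?posrE // ln1 sub0r lerNr.
  apply: le_trans (_ : ln (1 / 2) <= _); first by rewrite ler_ln ?posrE // divr_gt0.
  have := @le_ln1Dx R (- (1 / 2)); rewrite (_ : 1 + - (1 / 2) = 1 / 2); last by field.
  by apply; lra.
exists (fun w => nclasses w / W).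
  exact: (unique_stationary_weights glauber_ge0 glauber_row nclasses_ge1 glauber_rev
    glauber_loop lam0 (glauber_poincare w0) w0).
pose tau0 := (ln W + 2 * ln (1 / delta)) / (2 / den).
have lnW := ln_weight w0.
have lnW0 : 0 <= ln W.
  apply: ln_ge0; apply: le_trans (nclasses_ge1 w0) _.
  by rewrite /W (bigD1 w0) //= lerDl sumr_ge0 // => w _; exact: ltW.
have tau00 : 0 <= tau0 by rewrite divr_ge0 ?(ltW lam0) //; lra.
have [tau mt taule] := mixing_time_le glauber_ge0 glauber_row nclasses_ge1 glauber_rev
    glauber_loop lam0 (glauber_poincare w0) w0 d0 (lexx tau0) lam1 tau00.
exists tau => //; apply: le_trans taule _.
have -> : tau0 = (ln W + 2 * ln (1 / delta)) * den / 2 by rewrite /tau0; field; rewrite gt_eqF.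
have h : (ln W + 2 * ln (1 / delta)) * den <= (2 * (n + 1) ^+ 2 + 2) * ln (1 / delta) * den.
  rewrite ler_wpM2r ?(ltW den0) //.
  have : 0 <= (n + 1) ^+ 2 by rewrite exprn_ge0 // addr_ge0 // ltW.
  nra.
lra.
Qed.

End Glauber.

(** * Dependence on the bandwidth and the final bound *)

(** The minimum is the cost of some ordering or its initial value [#|G|]; in the latter case every
    ordering has small enough stretch. *)
Lemma bandwidth_order (G : sgraph) : exists s : G -> nat,
  [/\ injective s, forall v, (s v < #|G|)%N &
      forall x y : G, adj x y -> (s x <= s y + bandwidth G)%N].
Proof.
pose cost (sg : {ffun G -> 'I_#|G|}) := (\max_(u : G) \max_(v : G | adj u v) `|sg u - sg v|)%N.
have le_cost (sg : {ffun G -> 'I_#|G|}) x y : adj x y -> (sg x <= sg y + cost sg)%N.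
  move=> xy; have h1 : (`|sg x - sg y| <= cost sg)%N.
    rewrite /cost (bigD1 x) //= leq_max; apply/orP; left.
    by rewrite (bigD1 y) //= leq_max leqnn.
  by move: h1; move: (nat_of_ord (sg x)) (nat_of_ord (sg y)) (cost sg) => a c m; lia.
have [bE|[sg [sg_inj bE]]] : bandwidth G = #|G| \/
    exists sg : {ffun G -> 'I_#|G|}, injectiveb sg /\ bandwidth G = cost sg.
  rewrite /bandwidth; apply: (big_ind (fun m => m = #|G| \/
    exists sg : {ffun G -> 'I_#|G|}, injectiveb sg /\ m = cost sg)).
  - by left.
  - by move=> m m' hm hm'; rewrite /minn; case: ifP.
  by move=> sg sg_inj; right; exists sg.
- exists (fun v => enum_rank v : nat); split=> [u v /ord_inj/enum_rank_inj //|v|x y _]; first exact: ltn_ord.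
  by rewrite bE; apply: leq_trans (ltnW (ltn_ord _)) (leq_addl _ _).
exists (fun v => sg v : nat); split=> [u v /ord_inj|v|x y xy]; first exact/injectiveP.
  exact: ltn_ord.
by rewrite bE; exact: le_cost.
Qed.

(** The sweeps use Z + 2 additional blocks, and each layer costs at most 2 ^ kappa twice, once in
    the energy and once in the number of partitions. *)
Lemma Omega_poincare_of_reductions (R : realType) (G : sgraph) (B K b q kappa w : nat)
    (delta0 : R) (s : G -> nat) (f : {set {set G}} -> R) :
  (0 < B)%N -> (0 < #|G|)%N -> 0 < delta0 ->
  (forall v : G, (#|ball v (K + B)| <= b)%N) ->
  (3 * b * b * 2 ^ 2 ^ b)%N%:R <= delta0 * #|G|%:R / 2 ->
  (forall k P, (q <= k)%N -> P \in Omega G k B -> #|P| = k ->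
    delta0 * #|G|%:R <= #|local_reductions K k B P|%:R) ->
  injective s -> (forall v, (s v < #|G|)%N) ->
  (forall x y : G, adj x y -> (s x <= s y + w)%N) ->
  layer_const b delta0 <= 2 ^+ kappa ->
  \sum_(X in Omega G q B) \sum_(Y in Omega G q B) (f X - f Y) ^+ 2 <=
  (4 * #|G|%:R + 1) ^+ 8 * 2 ^+ (8 * b + 12 * kappa) * 2 ^+ (16 * B * (b + kappa) * w) *
  #|Omega G q B|%:R * energy (loc (K + B)) (Omega G q B) f.
Proof.
move=> B0 n0 d0 ballb large red s_inj s_lt s_str kap.
set Z := zone_bound B w.
have [g [gf gE gC]] := energy_layers d0 ballb large n0 f red (Z + 2).
set E := energy (loc (K + B)) (Omega G q B) f in gE *.
have ballB (v : G) : (#|ball v B| <= b)%N.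
  by apply: leq_trans (ballb v); apply/subset_leq_card/ball_mono/leq_addl.
have E0 : 0 <= E by apply: sumr_ge0 => P _; apply: sumr_ge0 => Q _; exact: sqr_ge0.
have l1 := layer_const_ge1 b d0; set l := layer_const b delta0 in kap gE gC l1.
have -> : \sum_(X in Omega G q B) \sum_(Y in Omega G q B) (f X - f Y) ^+ 2 =
    \sum_(X in Omega G q B) \sum_(Y in Omega G q B) (g X - g Y) ^+ 2.
  by apply: eq_bigr => X XO; apply: eq_bigr => Y YO; rewrite !gf.
apply: le_trans (pairs_le_energy _ s_inj s_lt s_str B0 (leq_addl K B) ballB n0 g) _.
rewrite -/Z; set O' := Omega G (q + (Z + 2)) B in gE gC *.
have l0 : 0 <= l ^+ (Z + 2) by apply: exprn_ge0; lra.
have lk : l ^+ (Z + 2) <= 2 ^+ (kappa * (Z + 2)).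
  by rewrite exprM; apply: lerXn2r; rewrite ?nnegrE //; lra.
apply: le_trans (_ : (sweep_const G B w b)%:R *
   (2 ^+ (kappa * (Z + 2)) * #|Omega G q B|%:R) * (2 ^+ (kappa * (Z + 2)) * E) <= _).
  rewrite -!mulrA; apply: ler_wpM2l => //.
  rewrite mulrA; apply: ler_pM => //.
  - by apply: sumr_ge0 => P _; apply: sumr_ge0 => Q _; exact: sqr_ge0.
  - by apply: le_trans gC _; apply: ler_wpM2r.
  by apply: le_trans gE _; apply: ler_wpM2r.
have -> : (sweep_const G B w b)%:R = (4 * #|G|%:R + 1) ^+ 8 * 2 ^+ (2 * b * Z) :> R.
  rewrite /sweep_const card_prod !card_ord natrM !natrX natrM.
  have -> : (2 * (2 * #|G|)).+1%:R = 4 * #|G|%:R + 1 :> R.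
    by rewrite -natr1 !natrM mulrA -[2 * 2 : R]natrM.
  by congr (_ * _); ring.
rewrite le_eqVlt; apply/orP; left; apply/eqP.
(* Z = 8 B w + 4; the constant part of the exponent is separated from the multiple of w. *)
have eZ : (2 * b * Z + kappa * (Z + 2) + kappa * (Z + 2) =
    8 * b + 12 * kappa + 16 * B * (b + kappa) * w)%N.
  by rewrite /Z /zone_bound; ring.
transitivity ((4 * #|G|%:R + 1) ^+ 8 * 2 ^+ (2 * b * Z + kappa * (Z + 2) + kappa * (Z + 2)) *
   #|Omega G q B|%:R * E); first by rewrite !exprD; ring.
by rewrite eZ exprD; ring.
Qed.

Theorem theorem4 (R : realType) (B : nat) (alpha eps : R)
    (F : sgraph -> Prop) (B_ge1 : (1 <= B)%N) (alpha_gt0 : 0 < alpha)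
    (eps_gt0 : 0 < eps) (F_part : partitionable B alpha F)
    (F_deg : bounded_degree F) :
  exists (K : nat) (p : {poly R}) (C : R) (n0 : nat),
    forall G : sgraph, F G -> (n0 <= #|G|)%N -> connected_graph G ->
    forall q : nat, (1 + eps) * #|G|%:R / (alpha * B%:R) <= q%:R ->
    forall delta : R, 0 < delta -> delta <= 1 / 2 ->
    exists2 pi : glauber_state G K q B -> R,
      unique_stationary (@glauber R G K q B) pi &
      exists2 tau : nat,
        is_mixing_time (@glauber R G K q B) pi delta tau &
        tau%:R <= p.[#|G|%:R] * 2 `^ (C * (bandwidth G)%:R) * ln (1 / delta).
Proof.
(* Halving eps makes the lower bound on q strict, as partitionability demands, for q and for every
   larger number of blocks. *)
have eps2 : 0 < eps / 2 by rewrite divr_gt0.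
have [Kp [delta0 [n1 [delta0_gt0 [findable reducible]]]]] := F_part _ eps2.
have [D degD] := F_deg.
(* The size of a ball that contains the blocks changed by a local reduction; it also becomes the K
   of the state space. *)
pose b := (D.+1 ^ (Kp + B))%N.
pose kappa := (Num.truncn (layer_const b delta0)).+1.
pose large : R := (3 * b * b * 2 ^ 2 ^ b)%N%:R.
pose n2 := (Num.truncn (2 * large / delta0)).+1.
(* [a] is the part of the Poincare constant free of the bandwidth, and p is the bound of
   [glauber_mixing_time] with this constant. *)
pose a : {poly R} := (4%:P * 'X + 1%:P) ^+ 8 * (2 ^+ (8 * b + 12 * kappa))%:P.
pose p : {poly R} := (('X + 1%:P) ^+ 2 + 1%:P) * (('X + 1%:P) ^+ 3 * 'X *
  ((6%:P + 3%:P * (('X ^+ 2) ^+ b) ^+ 2 * a) * (4%:P * 'X ^+ 2) ^+ b)) + 2%:P.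
exists b, p, (16 * B * (b + kappa))%N%:R, (maxn n1 n2).
move=> G FG; rewrite geq_max => /andP[n1G n2G] _ q hq delta d0 d1.
have n_gt0 : (0 < #|G|)%N by apply: leq_trans n2G.
have nR : 0 < #|G|%:R :> R by rewrite ltr0n.
have aB : 0 < alpha * B%:R by rewrite mulr_gt0 // ltr0n.
have adm k : (q <= k)%N -> [/\ F G, (n1 <= #|G|)%N &
    (1 + eps / 2) * #|G|%:R / (alpha * B%:R) < k%:R].
  move=> qk; split=> //; apply: lt_le_trans (_ : q%:R <= _); last by rewrite ler_nat.
  apply: lt_le_trans hq; rewrite ltr_pM2r ?invr_gt0 // ltr_pM2r //; lra.
have [s [s_inj s_lt s_str]] := bandwidth_order G.
have ballb (v : G) : (#|ball v (Kp + B)| <= b)%N by apply: card_ball => u; exact: degD.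
have largeG : large <= delta0 * #|G|%:R / 2.
  have : 2 * large / delta0 <= #|G|%:R.
    apply: le_trans (_ : n2%:R <= _); last by rewrite ler_nat.
    have pos : 0 <= 2 * large / delta0 by rewrite divr_ge0 ?(ltW delta0_gt0) // mulr_ge0.
    by have /andP[_ /ltW] := truncn_itv pos.
  rewrite ler_pdivrMr // mulrC => h; rewrite ler_pdivlMr //; lra.
have kap : layer_const b delta0 <= 2 ^+ kappa.
  have /andP[_ /ltW h] := truncn_itv (le_trans ler01 (layer_const_ge1 b delta0_gt0)).
  by apply: le_trans h _; rewrite -natrX ler_nat ltnW // ltn_expl.
pose x : R := 2 ^+ (16 * B * (b + kappa) * bandwidth G).
have x1 : 1 <= x by apply: exprn_ege1; rewrite ler1n.
pose aG : R := (4 * #|G|%:R + 1) ^+ 8 * 2 ^+ (8 * b + 12 * kappa).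
have aG0 : 0 <= aG by rewrite mulr_ge0 ?exprn_ge0 // addr_ge0 // mulr_ge0.
have poin (f : {set {set G}} -> R) :
    \sum_(X in Omega G q B) \sum_(Y in Omega G q B) (f X - f Y) ^+ 2 <=
    aG * x * #|Omega G q B|%:R * energy (loc (Kp + B)) (Omega G q B) f.
  apply: (Omega_poincare_of_reductions f B_ge1 n_gt0 delta0_gt0 ballb largeG _ s_inj s_lt s_str kap).
  by move=> k P qk PO Pk; apply: reducible (adm k qk) P PO Pk.
(* The partition that the search machine outputs shows that the state space is not empty. *)
have [w0 _] : exists w0 : glauber_state G b q B, True.
  have [M [pM find]] := findable.
  have [f [_ fO]] := find G q (adm q (leqnn q)) (enum G) (perm_refl _).
  by exists (exist (fun w => w \in OmegaK G b q B) _ (subsetP (Omega_sub_OmegaK G b q B) _ fO)).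
have ax0 : 0 <= aG * x by rewrite mulr_ge0 // (le_trans ler01).
have [pi st [tau mix tau_le]] := glauber_mixing_time n_gt0 ax0 ballb poin w0 d0 d1.
exists pi => //; exists tau => //; apply: le_trans tau_le _.
rewrite -natrM powR_mulrn // -/x.
have ln0 : 0 <= ln (1 / delta) by rewrite ln_ge0 // ler_pdivlMr // mul1r; lra.
rewrite -mulrDl ler_wpM2r //.
have -> : p.[#|G|%:R] = ((#|G|%:R + 1) ^+ 2 + 1) * ((#|G|%:R + 1) ^+ 3 * #|G|%:R *
    ((6 + 3 * ((#|G| ^ 2) ^ b)%N%:R ^+ 2 * aG) * (4 * #|G|%:R ^+ 2) ^+ b)) + 2.
  by rewrite /p /a /aG !(hornerD, hornerM, horner_exp, hornerX, hornerC) !natrX.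
set t1 := _ ^+ 2 + 1; set t2 := _ ^+ 3 * _; set m2 := _ ^+ 2; set t3 := _ ^+ b.
have [t10 t20 t30] : [/\ 0 <= t1, 0 <= t2 & 0 <= t3].
  have n10 : 0 <= #|G|%:R + 1 :> R by rewrite addr_ge0.
  by split; rewrite ?addr_ge0 ?mulr_ge0 ?exprn_ge0 // mulr_ge0 // exprn_ge0.
have m20 : 0 <= m2 by rewrite exprn_ge0.
(* Since x >= 1, the exponential of the bandwidth can be pulled out of the whole bound as a single
   factor. *)
have step : 6 + 3 * m2 * (aG * x) <= (6 + 3 * m2 * aG) * x.
  rewrite (_ : (6 + 3 * m2 * aG) * x = 6 * x + 3 * m2 * (aG * x)); last by ring.
  by rewrite lerD2r; lra.
have : t1 * (t2 * ((6 + 3 * m2 * (aG * x)) * t3)) <= t1 * (t2 * ((6 + 3 * m2 * aG) * t3)) * x.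
  rewrite (_ : t1 * _ * x = t1 * (t2 * ((6 + 3 * m2 * aG) * x * t3))); last by ring.
  by rewrite !ler_wpM2l // ler_wpM2r.
rewrite mulrDl; lra.
Qed.
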